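(* Let $G$ be a locally compact group acting continuously on topological graphs $E=(E^0,E^1,r,s)$ and $F=(F^0,F^1,r',s')$, and let $\varphi$ and $\varphi'$ be cocycles for the actions of $G$ on $E$ and on $F$, respectively. Suppose that $(E,G,\varphi)$ and $(F,G,\varphi')$ are cohomology conjugate in the sense that there exist $G$-equivariant homeomorphisms $\theta_j\colon F^j\to E^j$ for $j=0,1$ such that $r\circ\theta_1=\theta_0\circ r'$, $s\circ\theta_1=\theta_0\circ s'$, and the map $(g,f)\mapsto\varphi(g,\theta_1(f))$ is a cocycle for the action of $G$ on $F$ that is cohomologous to $\varphi'$. Then $Y^\varphi$ is isomorphic to $Y^{\varphi'}$, and it follows that the Toeplitz algebra $\mathcal T_{Y^\varphi}$ (respectively the Cuntz-Pimsner algebra $\mathcal O_{Y^\varphi}$) is isomorphic to $\mathcal T_{Y^{\varphi'}}$ (respectively $\mathcal O_{Y^{\varphi'}}$).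
   Context: A topological graph $E=(E^0,E^1,r,s)$ consists of locally compact Hausdorff spaces $E^0$ and $E^1$, a continuous map $r\colon E^1\to E^0$ and a local homeomorphism $s\colon E^1\to E^0$. A continuous action of $G$ on $E$ consists of continuous actions of $G$ by homeomorphisms on $E^0$ and $E^1$ with $r(ge)=g\,r(e)$ and $s(ge)=g\,s(e)$. A cocycle for the action of $G$ on $E$ is a continuous map $\varphi\colon G\times E^1\to G$ with $\varphi(gh,e)=\varphi(g,he)\varphi(h,e)$ and $\varphi(g,e)s(e)=g\,s(e)$ for all $g,h\in G$, $e\in E^1$. Two such cocycles $\varphi_1,\varphi_2$ for the same action are cohomologous if there is a continuous map $\psi\colon E^1\to G$ such that $\varphi_2(g,e)=\psi(ge)\varphi_1(g,e)\psi(e)^{-1}$ and $\psi(e)s(e)=s(e)$ for all $g\in G$, $e\in E^1$. Let $dh$ be left Haar measure and $\Delta$ the modular function. Put $B=C_0(E^0)\rtimes_\alpha G$ (full crossed product, $\alpha_g(a)(v)=a(g^{-1}v)$), viewed as a completion of the $*$-algebra $C_c(E^0\times G)$ with $(b*c)(v,g)=\int_G b(v,h)c(h^{-1}v,h^{-1}g)\,dh$ and $b^*(v,g)=\Delta(g^{-1})\overline{b(g^{-1}v,g^{-1})}$. For a cocycle $\varphi$, $Y^\varphi$ is the $C^*$-correspondence over $B$ obtained by completing $C_c(E^1\times G)$ with the operations, for $b\in C_c(E^0\times G)$ and $\xi,\eta\in C_c(E^1\times G)$, \begin{align*} \langle\xi,\eta\rangle_B(v,g)&=\int_G\sum_{s(e)=hv}\overline{\xi(e,h)}\,\eta(e,hg)\,dh,\\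 (\xi\cdot b)(e,g)&=\int_G\xi(e,h)\,b(h^{-1}s(e),h^{-1}g)\,dh,\\ (b\cdot\xi)(e,g)&=\int_G b(r(e),h)\,\xi\bigl(h^{-1}e,\varphi(h^{-1},e)g\bigr)\,dh. \end{align*} $Y^{\varphi'}$ is defined in the same way from $(F,G,\varphi')$, over $B'=C_0(F^0)\rtimes G$. An isomorphism between correspondences $Y$ over $B$ and $Y'$ over $B'$ consists of a $*$-isomorphism $\iota\colon B\to B'$ and a linear bijection $\Phi\colon Y\to Y'$ with $\langle\Phi\xi,\Phi\eta\rangle_{B'}=\iota(\langle\xi,\eta\rangle_B)$, $\Phi(\xi\cdot b)=\Phi(\xi)\cdot\iota(b)$, $\Phi(b\cdot\xi)=\iota(b)\cdot\Phi(\xi)$. For a $B$-correspondence $Y$ with left action $\phi\colon B\to\mathcal L(Y)$, a Toeplitz representation of $(Y,B)$ in a $C^*$-algebra $D$ is a pair $(\psi,\zeta)$ of a linear map $\psi\colon Y\to D$ and a $*$-homomorphism $\zeta\colon B\to D$ with $\psi(\xi)^*\psi(\eta)=\zeta(\langle\xi,\eta\rangle_B)$ and $\zeta(b)\psi(\xi)=\psi(b\cdot\xi)$. It induces $\psi^{(1)}\colon\mathcal K(Y)\to D$ with $\psi^{(1)}(\theta_{\xi,\eta})=\psi(\xi)\psi(\eta)^*$, where $\theta_{\xi,\eta}\zeta'=\xi\cdot\langle\eta,\zeta'\rangle_B$. The Katsura ideal is $J_Y=\phi^{-1}(\mathcal K(Y))\cap(\ker\phi)^\perp$, where $I^\perp=\{b\in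 B: bI=0\}$, and $(\psi,\zeta)$ is Cuntz-Pimsner covariant if $\psi^{(1)}(\phi(b))=\zeta(b)$ for all $b\in J_Y$. $\mathcal T_Y$ is the $C^*$-algebra generated by a universal Toeplitz representation of $(Y,B)$, and $\mathcal O_Y$ is the $C^*$-algebra generated by a universal Cuntz-Pimsner covariant Toeplitz representation. *)

(* Defs.v *)
From HB Require Import structures.
From mathcomp Require Import all_boot all_order all_algebra.
From mathcomp Require Import monoid complex.
From mathcomp Require Import all_classical all_reals all_analysis.

Set Implicit Arguments.
Unset Strict Implicit.
Unset Printing Implicit Defensive.

Import Order.TTheory GRing.Theory Num.Theory.
Import numFieldNormedType.Exports.

Local Open Scope classical_set_scope.
Local Open Scope ring_scope.
Local Open Scope complex_scope.

(* The base point inherited from [PointedTopological] is arbitrary; the Borel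
   sigma-algebra of the library is only available on pointed types. *)
HB.mixin Record isTopologicalGroup G of PointedTopological G & Group G := {
  mulg_continuous : continuous (fun p : G * G => (p.1 * p.2)%g) ;
  invg_continuous : continuous (fun g : G => (g^-1)%g)
}.

#[short(type="topologicalGroupType")]
HB.structure Definition TopologicalGroup :=
  {G of PointedTopological G & Group G & isTopologicalGroup G}.

Definition borel (G : topologicalGroupType) := g_sigma_algebraType (@open G).

Record left_haar (R : realType) (G : topologicalGroupType)
    (mu : {measure set (borel G) -> \bar R}) : Prop := LeftHaar {
  haar_neq0 : mu setT <> 0%E ;
  haar_invariant : forall (g : G) (A : set (borel G)), measurable A ->
    mu ((fun h : G => (g * h)%g) @` A) = mu A ;
  haar_compact : forall K : set G, compact K -> (mu K < +oo)%E ;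
  haar_outer : forall A : set (borel G), measurable A ->
    mu A = ereal_inf [set mu U | U in [set U : set G | open U /\ A `<=` U]] ;
  haar_inner : forall U : set G, open U ->
    mu U = ereal_sup [set mu K | K in [set K : set G | compact K /\ K `<=` U]]
}.

(* Normalised so that [\int f(h g) dh = Delta(g)^-1 \int f(h) dh]; this is the
   convention under which [cp_star] below is the adjoint. *)
Definition modular_function (R : realType) (G : topologicalGroupType)
    (mu : {measure set (borel G) -> \bar R}) (Delta : G -> R) : Prop :=
  forall g : G, 0 < Delta g /\
    forall A : set (borel G), measurable A ->
      mu ((fun h : G => (h * g)%g) @` A) = ((Delta g)%:E * mu A)%E.

Definition cintegral (R : realType) (G : topologicalGroupType)
    (mu : {measure set (borel G) -> \bar R}) (f : G -> R[i]) : R[i] :=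
  Rintegral mu setT (fun h => complex.Re (f h))
  +i* Rintegral mu setT (fun h => complex.Im (f h)).

Definition homeomorphism (X Y : topologicalType) (f : X -> Y) : Prop :=
  continuous f /\
  exists f' : Y -> X, [/\ continuous f', cancel f f' & cancel f' f].

Definition local_homeomorphism (X Y : topologicalType) (f : X -> Y) : Prop :=
  forall x, exists U : set X, [/\ open U, U x, open (f @` U),
    {within U, continuous f} &
    exists f' : Y -> X, {within f @` U, continuous f'} /\
      {in U, cancel f f'}].

Record topologicalGraph := TopologicalGraph {
  vertex : topologicalType ;
  edge : topologicalType ;
  range_map : edge -> vertex ;
  source_map : edge -> vertex ;
  vertex_hausdorff : hausdorff_space vertex ;
  vertex_locally_compact : locally_compact [set: vertex] ;
  edge_hausdorff : hausdorff_space edge ;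
  edge_locally_compact : locally_compact [set: edge] ;
  range_continuous : continuous range_map ;
  source_local_homeo : local_homeomorphism source_map
}.

Record continuousAction (G : topologicalGroupType) (X : topologicalType) :=
  ContinuousAction {
  gact :> G -> X -> X ;
  gact1 : forall x, gact 1%g x = x ;
  gactM : forall g h x, gact (g * h)%g x = gact g (gact h x) ;
  gact_continuous : continuous (fun p : G * X => gact p.1 p.2)
}.

Record graphAction (G : topologicalGroupType) (E : topologicalGraph) :=
  GraphAction {
  vact : continuousAction G (vertex E) ;
  eact : continuousAction G (edge E) ;
  range_equivariant : forall g e,
    range_map (eact g e) = vact g (range_map e) ;
  source_equivariant : forall g e,
    source_map (eact g e) = vact g (source_map e)
}.

Record is_cocycle (G : topologicalGroupType) (E : topologicalGraph)
    (a : graphAction G E) (phi : G -> edge E -> G) : Prop := IsCocycle {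
  cocycle_continuous : continuous (fun p : G * edge E => phi p.1 p.2) ;
  cocycleM : forall g h e, phi (g * h)%g e = (phi g (eact a h e) * phi h e)%g ;
  cocycle_source : forall g e,
    vact a (phi g e) (source_map e) = vact a g (source_map e)
}.

Definition cohomologous (G : topologicalGroupType) (E : topologicalGraph)
    (a : graphAction G E) (phi1 phi2 : G -> edge E -> G) : Prop :=
  [/\ is_cocycle a phi1, is_cocycle a phi2 &
    exists psi : edge E -> G, [/\ continuous psi,
      forall g e, phi2 g e = (psi (eact a g e) * phi1 g e * (psi e)^-1)%g &
      forall e, vact a (psi e) (source_map e) = source_map e]].

Definition cohomology_conjugate (G : topologicalGroupType)
    (E : topologicalGraph) (aE : graphAction G E) (phi : G -> edge E -> G)
    (F : topologicalGraph) (aF : graphAction G F) (phi' : G -> edge F -> G) :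
    Prop :=
  exists (theta0 : vertex F -> vertex E) (theta1 : edge F -> edge E),
    [/\ homeomorphism theta0 /\ homeomorphism theta1,
        forall g v, theta0 (vact aF g v) = vact aE g (theta0 v),
        forall g f, theta1 (eact aF g f) = eact aE g (theta1 f),
        (forall f, range_map (theta1 f) = theta0 (range_map f)) /\
        (forall f, source_map (theta1 f) = theta0 (source_map f)) &
        is_cocycle aF (fun g f => phi g (theta1 f)) /\
        cohomologous aF (fun g f => phi g (theta1 f)) phi'].

(* C*-algebras need not be unital, so MathComp's rings cannot be used for the
   multiplication. *)
HB.mixin Record isCStarAlgebra (R : realType) A
    of CompleteNormedModule R[i] A := {
  cmul : A -> A -> A ;
  cstar : A -> A ;
  cmulA : forall a b c, cmul a (cmul b c) = cmul (cmul a b) c ;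
  cmul_linearl : forall (k : R[i]) a b c,
    cmul (k *: a + b) c = k *: cmul a c + cmul b c ;
  cmul_linearr : forall (k : R[i]) a b c,
    cmul c (k *: a + b) = k *: cmul c a + cmul c b ;
  cstarK : forall a, cstar (cstar a) = a ;
  cstar_antilinear : forall (k : R[i]) a b,
    cstar (k *: a + b) = conjc k *: cstar a + cstar b ;
  cstarM : forall a b, cstar (cmul a b) = cmul (cstar b) (cstar a) ;
  cnormM : forall a b, `|cmul a b| <= `|a| * `|b| :> R[i] ;
  cnorm_star : forall a, `|cmul (cstar a) a| = `|a| ^+ 2 :> R[i]
}.

#[short(type="cstarAlgType")]
HB.structure Definition CStarAlgebra (R : realType) :=
  {A of CompleteNormedModule R[i] A & isCStarAlgebra R A}.

Definition star_hom (R : realType) (A B : cstarAlgType R)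
    (f : {linear A -> B}) : Prop :=
  (forall a b, f (cmul a b) = cmul (f a) (f b)) /\
  (forall a, f (cstar a) = cstar (f a)).

Definition star_isomorphic (R : realType) (A B : cstarAlgType R) : Prop :=
  exists f : {linear A -> B}, star_hom f /\ bijective f.

Record closed_star_subalgebra (R : realType) (A : cstarAlgType R)
    (S : set A) : Prop := ClosedStarSubalgebra {
  subalg_closed : closed S ;
  subalg0 : S 0 ;
  subalg_linear : forall (k : R[i]) a b, S a -> S b -> S (k *: a + b) ;
  subalg_mul : forall a b, S a -> S b -> S (cmul a b) ;
  subalg_star : forall a, S a -> S (cstar a)
}.

Definition cstar_generated (R : realType) (A : cstarAlgType R) (X : set A) :
    Prop :=
  forall S : set A, closed_star_subalgebra S -> X `<=` S -> S = setT.

(* Inner products, here and below, are linear in the second variable. *)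
Record hilbertSpace (R : realType) := HilbertSpace {
  hilbert_sort :> completeNormedModType R[i] ;
  hdot : hilbert_sort -> hilbert_sort -> R[i] ;
  hdot_linear : forall x (k : R[i]) y z,
    hdot x (k *: y + z) = k * hdot x y + hdot x z ;
  hdotC : forall x y, hdot y x = conjc (hdot x y) ;
  hnormE : forall x : hilbert_sort, `|x| ^+ 2 = hdot x x :> R[i]
}.

Definition Cc (R : realType) (X : topologicalType) : set (X -> R[i]^o) :=
  [set f | continuous f /\ compact (closure [set x | f x != 0])].

Definition C0 (R : realType) (X : topologicalType) : set (X -> R[i]^o) :=
  [set f | continuous f /\
    forall e : R, 0 < e -> compact [set x | e%:C <= `|f x|]].

(* A covariant representation [(pi, U)] of [(C_0(X), G, alpha)] on [H]; [pi] is
   only constrained on [C_0(X)].  Boundedness of [pi a] is automatic, since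
   [pi a] is everywhere defined and has an adjoint. *)
Record covariant_rep (R : realType) (G : topologicalGroupType)
    (X : topologicalType) (a : continuousAction G X) (H : hilbertSpace R)
    (pi : (X -> R[i]^o) -> H -> H) (U : G -> H -> H) : Prop := CovariantRep {
  crep_op_linear : forall f, C0 f -> forall (k : R[i]) x y,
    pi f (k *: x + y) = k *: pi f x + pi f y ;
  crep_linear : forall (k : R[i]) f f', C0 f -> C0 f' ->
    forall x, pi (fun v => k * f v + f' v) x = k *: pi f x + pi f' x ;
  crep_mul : forall f f', C0 f -> C0 f' ->
    forall x, pi (fun v => f v * f' v) x = pi f (pi f' x) ;
  crep_star : forall f, C0 f ->
    forall x y, hdot (pi f x) y = hdot x (pi (fun v => conjc (f v)) y) ;
  crep_U_linear : forall g (k : R[i]) x y,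
    U g (k *: x + y) = k *: U g x + U g y ;
  crep_U1 : forall x, U 1%g x = x ;
  crep_UM : forall g h x, U (g * h)%g x = U g (U h x) ;
  crep_U_isometry : forall g x y, hdot (U g x) (U g y) = hdot x y ;
  crep_U_continuous : forall x, continuous (fun g => U g x) ;
  crep_covariant : forall g f, C0 f ->
    forall x, pi (fun v => f (a (g^-1)%g v)) x = U g (pi f (U (g^-1)%g x))
}.

Section CrossedProduct.
Variables (R : realType) (G : topologicalGroupType).
Variables (mu : {measure set (borel G) -> \bar R}) (Delta : G -> R).
Variables (X : topologicalType) (a : continuousAction G X).
Implicit Types b c : X * G -> R[i]^o.

Definition cp_mul b c : X * G -> R[i]^o := fun p =>
  cintegral mu (fun h =>
    b (p.1, h) * c (a (h^-1)%g p.1, (h^-1 * p.2)%g)).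

Definition cp_star b : X * G -> R[i]^o := fun p =>
  (Delta (p.2^-1)%g)%:C * conjc (b (a (p.2^-1)%g p.1, (p.2^-1)%g)).

(* The integrated form of [(pi, U)] at [b] is the operator given by the weak
   integral [\int pi(b(., g)) U_g dg].  As [x] and [y] range over the unit ball,
   the supremum of this set is the supremum, over all covariant
   representations, of the operator norms of the integrated forms at [b]. *)
Definition integrated_coefficients b : set R :=
  [set r | exists (H : hilbertSpace R) (pi : (X -> R[i]^o) -> H -> H)
      (U : G -> H -> H) (x y : H),
    [/\ covariant_rep a pi U, `|x| <= 1, `|y| <= 1 &
      r%:C = `|cintegral mu (fun g =>
            hdot x (pi (fun v => b (v, g)) (U g y)))| ]].

Definition full_norm b : R := sup (integrated_coefficients b).

(* [B], together with [i], is the completion of the *-algebra [C_c(X x G)] in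
   the full norm.  Only the values of [i] on [C_c(X x G)] matter. *)
Record is_crossed_product (B : cstarAlgType R) (i : (X * G -> R[i]^o) -> B) :
    Prop := IsCrossedProduct {
  cp_linear : forall (k : R[i]) b c, Cc b -> Cc c ->
    i (fun p => k * b p + c p) = k *: i b + i c ;
  cp_mulE : forall b c, Cc b -> Cc c -> i (cp_mul b c) = cmul (i b) (i c) ;
  cp_starE : forall b, Cc b -> i (cp_star b) = cstar (i b) ;
  cp_norm : forall b, Cc b -> `|i b| = (full_norm b)%:C ;
  cp_dense : dense (i @` @Cc R (X * G)%type)
}.

End CrossedProduct.

Record correspondence (R : realType) (B : cstarAlgType R) := Correspondence {
  corr_sort :> completeNormedModType R[i] ;
  bdot : corr_sort -> corr_sort -> B ;
  ract : corr_sort -> B -> corr_sort ;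
  lact : B -> corr_sort -> corr_sort ;
  bdot_linear : forall x (k : R[i]) y z,
    bdot x (k *: y + z) = k *: bdot x y + bdot x z ;
  bdotC : forall x y, bdot y x = cstar (bdot x y) ;
  bdot_pos : forall x, exists b : B, bdot x x = cmul (cstar b) b ;
  bdot_norm : forall x : corr_sort, `|x| ^+ 2 = `|bdot x x| :> R[i] ;
  ract_linearl : forall (k : R[i]) x y b,
    ract (k *: x + y) b = k *: ract x b + ract y b ;
  ract_linearr : forall x (k : R[i]) b c,
    ract x (k *: b + c) = k *: ract x b + ract x c ;
  ractM : forall x b c, ract x (cmul b c) = ract (ract x b) c ;
  bdot_ract : forall x y b, bdot x (ract y b) = cmul (bdot x y) b ;
  lact_linearl : forall (k : R[i]) b c x,
    lact (k *: b + c) x = k *: lact b x + lact c x ;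
  lact_linearr : forall b (k : R[i]) x y,
    lact b (k *: x + y) = k *: lact b x + lact b y ;
  lactM : forall b c x, lact (cmul b c) x = lact b (lact c x) ;
  lact_star : forall b x y, bdot (lact b x) y = bdot x (lact (cstar b) y)
}.

Definition correspondence_isomorphic (R : realType) (B B' : cstarAlgType R)
    (Y : correspondence B) (Y' : correspondence B') : Prop :=
  exists (iota : {linear B -> B'}) (Phi : {linear Y -> Y'}),
    [/\ star_hom iota /\ bijective iota,
        bijective Phi,
        forall x y, bdot (Phi x) (Phi y) = iota (bdot x y),
        forall x b, Phi (ract x b) = ract (Phi x) (iota b) &
        forall b x, Phi (lact b x) = lact (iota b) (Phi x)].

Section CocycleCorrespondence.
Variables (R : realType) (G : topologicalGroupType).
Variable mu : {measure set (borel G) -> \bar R}.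
Variables (E : topologicalGraph) (a : graphAction G E).
Variable phi : G -> edge E -> G.
Implicit Types (b : vertex E * G -> R[i]^o) (xi eta : edge E * G -> R[i]^o).

(* For [xi], [eta] in [C_c(E^1 x G)] the sum over the fibre has finite support,
   because the fibres of [s] are closed and discrete. *)
Definition y_inner xi eta : vertex E * G -> R[i]^o := fun p =>
  cintegral mu (fun h =>
    \sum_(e \in [set e : edge E | source_map e = vact a h p.1])
      (conjc (xi (e, h)) * eta (e, (h * p.2)%g))).

Definition y_ract xi b : edge E * G -> R[i]^o := fun p =>
  cintegral mu (fun h =>
    xi (p.1, h) * b (vact a (h^-1)%g (source_map p.1), (h^-1 * p.2)%g)).

Definition y_lact b xi : edge E * G -> R[i]^o := fun p =>
  cintegral mu (fun h =>
    b (range_map p.1, h) *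
    xi (eact a (h^-1)%g p.1, (phi (h^-1)%g p.1 * p.2)%g)).

(* [(Y, j)] is the completion [Y^phi] of [C_c(E^1 x G)]; its norm is determined
   by [y_inner] through [bdot_norm].  Only the values of [j] on
   [C_c(E^1 x G)] matter. *)
Record is_cocycle_correspondence (B : cstarAlgType R)
    (i : (vertex E * G -> R[i]^o) -> B) (Y : correspondence B)
    (j : (edge E * G -> R[i]^o) -> Y) : Prop := IsCocycleCorrespondence {
  yc_linear : forall (k : R[i]) xi eta, Cc xi -> Cc eta ->
    j (fun p => k * xi p + eta p) = k *: j xi + j eta ;
  yc_inner : forall xi eta, Cc xi -> Cc eta ->
    bdot (j xi) (j eta) = i (y_inner xi eta) ;
  yc_ract : forall xi b, Cc xi -> Cc b -> j (y_ract xi b) = ract (j xi) (i b) ;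
  yc_lact : forall b xi, Cc b -> Cc xi -> j (y_lact b xi) = lact (i b) (j xi) ;
  yc_dense : dense (j @` @Cc R (edge E * G)%type)
}.

End CocycleCorrespondence.

Section CuntzPimsner.
Variables (R : realType) (B : cstarAlgType R) (Y : correspondence B).

Definition theta (xi eta : Y) : Y -> Y := fun x => ract xi (bdot eta x).

(* The closed linear span of the [theta xi eta] in operator norm; scalars are
   absorbed in [xi]. *)
Definition compact_operators : set (Y -> Y) :=
  [set T | forall e : R, 0 < e -> exists s : seq (Y * Y), forall x : Y,
    `|T x - \sum_(p <- s) theta p.1 p.2 x| <= e%:C * `|x|].

Definition katsura_ideal : set B :=
  [set b | compact_operators (lact b) /\
    forall c : B, (forall x : Y, lact c x = 0) -> cmul b c = 0].

Section Representations.
Variables (D : cstarAlgType R) (psi : {linear Y -> D}) (zeta : {linear B -> D}).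

Definition toeplitz_rep : Prop :=
  [/\ star_hom zeta,
      forall xi eta, cmul (cstar (psi xi)) (psi eta) = zeta (bdot xi eta) &
      forall b xi, cmul (zeta b) (psi xi) = psi (lact b xi)].

(* [psi1], restricted to the compact operators, is the *-homomorphism
   [psi^(1)]. *)
Record induced_hom (psi1 : (Y -> Y) -> D) : Prop := InducedHom {
  induced_linear : forall (k : R[i]) S T,
    compact_operators S -> compact_operators T ->
    psi1 (fun x => k *: S x + T x) = k *: psi1 S + psi1 T ;
  induced_mul : forall S T, compact_operators S -> compact_operators T ->
    psi1 (S \o T) = cmul (psi1 S) (psi1 T) ;
  induced_star : forall S T, compact_operators S -> compact_operators T ->
    (forall x y, bdot (S x) y = bdot x (T y)) -> psi1 T = cstar (psi1 S) ;
  induced_theta : forall xi eta,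
    psi1 (theta xi eta) = cmul (psi xi) (cstar (psi eta))
}.

Definition cp_covariant : Prop :=
  exists psi1, induced_hom psi1 /\
    forall b, katsura_ideal b -> psi1 (lact b) = zeta b.

End Representations.

Definition is_toeplitz_algebra (T : cstarAlgType R) : Prop :=
  exists (psi : {linear Y -> T}) (zeta : {linear B -> T}),
    [/\ toeplitz_rep psi zeta,
        cstar_generated (range psi `|` range zeta) &
        forall (D : cstarAlgType R) (psi' : {linear Y -> D})
            (zeta' : {linear B -> D}),
          toeplitz_rep psi' zeta' ->
          exists f : {linear T -> D}, [/\ star_hom f,
            forall xi, f (psi xi) = psi' xi & forall b, f (zeta b) = zeta' b]].

Definition is_cuntz_pimsner_algebra (O : cstarAlgType R) : Prop :=
  exists (psi : {linear Y -> O}) (zeta : {linear B -> O}),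
    [/\ toeplitz_rep psi zeta, cp_covariant psi zeta,
        cstar_generated (range psi `|` range zeta) &
        forall (D : cstarAlgType R) (psi' : {linear Y -> D})
            (zeta' : {linear B -> D}),
          toeplitz_rep psi' zeta' -> cp_covariant psi' zeta' ->
          exists f : {linear O -> D}, [/\ star_hom f,
            forall xi, f (psi xi) = psi' xi & forall b, f (zeta b) = zeta' b]].

End CuntzPimsner.

(* Main.v *)
Require Import Defs.

From HB Require Import structures.
From mathcomp Require Import all_boot all_order all_algebra.
From mathcomp Require Import complex ring lra.
From mathcomp Require Import all_classical all_reals all_analysis.
From mathcomp Require Import measurable_realfun.

Set Implicit Arguments.
Unset Strict Implicit.
Unset Printing Implicit Defensive.

Import Order.TTheory GRing.Theory Num.Theory.
Import numFieldNormedType.Exports.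

Local Open Scope classical_set_scope.
Local Open Scope ring_scope.
Local Open Scope complex_scope.

(** The obvious candidate for the isomorphism sends a compactly supported [xi] to
    [(e, g) |-> xi (e, psi(e)^-1 g)], where [psi] implements the cohomology.  It
    intertwines the left and right actions: for the right one substitute
    [psi(e) h] for [h] and use that [psi(e)] fixes [s(e)]; for the left one use
    the cohomology relation.  It need not preserve inner products.  The inner
    product integrates over the space of pairs [(e, h)] with [s(e) = h v], where
    left translation of [h] by an element of the stabilizer of [s(e)] that varies
    with [e] need not preserve Haar measure.

    The failure is measured by a Jacobian ([fibre_jacobian]).  The translation
    maps each coset of the stabilizer of [v] to itself, so it rescales measure by
    a factor, which is shown to depend only on the edge: there are a continuous
    [d > 0] on edges and an identity comparing the fibre integrals of a function
    and of its translate.  In place of Haar measure on the stabilizer the proof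
    uses a functional on [C_c(G)] obtained as a cluster point of normalised
    integrals concentrating at [v] ([stabilizer_functional]); Weil's formula holds for it by Fubini's theorem for
    positive functionals ([pf_fubini]).

    The function [d] is also [G]-invariant, provided that fibre integrals are
    invariant under the actions [(e, g) |-> (x e, phi(x, e) g)] of both cocycles.
    That invariance ([fibre_int_cocycle]) is read off from the adjointness of the
    left actions of the two given correspondences.  An equation in the crossed
    product becomes an equation between functions because [C_c] embeds in it
    ([full_norm_eq0]).  This holds since the regular representations on the
    completion of [C_c(G)] separate functions, and since the supremum that
    defines the full norm is finite: representations of [C_0] are contractive
    ([crep_contractive]).

    Hence [xi |-> d^(-1/2) xi (e, psi(e)^-1 g)] is isometric and, [d] being
    invariant, intertwines both actions ([twist_inner], [twist_ract],
    [twist_lact]).  It extends to the completions ([isometric_extension]), and the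
    required identities extend by continuity; that [*]-homomorphisms and left
    actions are bounded follows by writing a selfadjoint [c] with [|c| < 1] as
    half the sum of two unitaries ([selfadjoint_contractive]).  This settles two
    cohomologous cocycles on one graph ([cohomologous_isomorphic]).  Conjugate
    data reduce to that case since the homeomorphisms turn a crossed product and a
    correspondence for [E] into ones for [F] ([crossed_product_pull],
    [cocycle_correspondence_pull]).  Finally isomorphic correspondences have the
    same representations up to composition with the isomorphism, so their
    universal algebras are isomorphic ([universal_isomorphic]). *)

(** * Topological preliminaries *)

(** A property stable under finite unions and subsets passes from small
    neighbourhoods to compact sets.  All arguments by finite subcovers below take
    this form. *)
Lemma compact_ind (X : topologicalType) (K : set X) (P : set X -> Prop) :
    compact K -> P set0 -> (forall A B, P A -> P B -> P (A `|` B)) ->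
    (forall A B, A `<=` B -> P B -> P A) ->
    (forall x, K x -> exists2 U, nbhs x U & P U) -> P K.
Proof.
move=> /compact_near_coveringP cK P0 PU PS PK.
pose F : set_system (set X) :=
  [set A | exists2 D0, P D0 & forall D, P D -> D0 `<=` D -> A D].
have FF : Filter F.
  split.
  - by exists set0.
  - move=> A B [D PD HD] [D' PD' HD']; exists (D `|` D'); first exact: PU.
    move=> E PE sub; split; [apply: HD|apply: HD'] => //.
      by move=> x Dx; apply: sub; left.
    by move=> x Dx; apply: sub; right.
  - by move=> A B AB [D PD HD]; exists D => // E PE sub; apply/AB/HD.
have [D PD /(_ D PD)] : F [set D | K `<=` D].
  apply: (cK _ F (fun D x => D x)) => x Kx.
  have [U xU PU'] := PK x Kx.
  exists (U, [set D | U `<=` D]); first by split=> //=; exists U.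
  by move=> [y D] /= [Uy]; apply.
by move=> /(_ (fun _ h => h)) KD; exact: PS KD PD.
Qed.

Definition lch (X : topologicalType) :=
  locally_compact [set: X] /\ hausdorff_space X.


Lemma ct_pair (X Y Z : topologicalType) (f : X -> Y) (g : X -> Z) :
  continuous f -> continuous g -> continuous (fun x => (f x, g x)).
Proof. by move=> cf cg x; apply: cvg_pair; [exact: cf|exact: cg]. Qed.

Lemma ct_comp (X Y Z : topologicalType) (f : X -> Y) (g : Y -> Z) :
  continuous g -> continuous f -> continuous (fun x => g (f x)).
Proof. by move=> cg cf x; apply: continuous_comp; [exact: cf|exact: cg]. Qed.

Lemma ct_fst (X Y : topologicalType) : continuous (fun p : X * Y => p.1).
Proof. by move=> x; apply: cvg_fst. Qed.

Lemma ct_snd (X Y : topologicalType) : continuous (fun p : X * Y => p.2).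
Proof. by move=> x; apply: cvg_snd. Qed.

Lemma ct_id (X : topologicalType) : continuous (fun x : X => x).
Proof. by move=> x; apply: cvg_id. Qed.

Lemma ct_cst (X Y : topologicalType) (y : Y) : continuous (fun x : X => y).
Proof. by move=> x; apply: cvg_cst. Qed.

Section RealContinuity.
Variables (R : realType) (X : topologicalType).
Implicit Types f g : X -> R.

Lemma ct_add f g : continuous f -> continuous g -> continuous (fun x => f x + g x).
Proof. by move=> cf cg x; apply: (@cvgD _ R^o); [exact: cf|exact: cg]. Qed.

Lemma ct_opp f : continuous f -> continuous (fun x => - f x).
Proof. by move=> cf x; apply: (@cvgN _ R^o); exact: cf. Qed.

Lemma ct_sub f g : continuous f -> continuous g -> continuous (fun x => f x - g x).
Proof. by move=> cf cg x; apply: (@cvgB _ R^o); [exact: cf|exact: cg]. Qed.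

Lemma ct_mul f g : continuous f -> continuous g -> continuous (fun x => f x * g x).
Proof. by move=> cf cg x; apply: (@cvgM R); [exact: cf|exact: cg]. Qed.

Lemma ct_abs f : continuous f -> continuous (fun x => `|f x|).
Proof. by move=> cf x; apply: (@cvg_norm _ R^o); exact: cf. Qed.

Lemma ct_min f g : continuous f -> continuous g ->
  continuous (fun x => Num.min (f x) (g x)).
Proof. by move=> cf cg x; apply: continuous_min; [exact: cf|exact: cg]. Qed.

Lemma ct_max f g : continuous f -> continuous g ->
  continuous (fun x => Num.max (f x) (g x)).
Proof. by move=> cf cg x; apply: continuous_max; [exact: cf|exact: cg]. Qed.

Lemma open_gtf f a : continuous f -> open [set x | a < f x].
Proof.
move=> cf; apply: (@open_comp _ _ f [set y | a < y]) => [x _|]; first exact: cf.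
exact: open_gt.
Qed.

Lemma closed_gef f a : continuous f -> closed [set x | a <= f x].
Proof.
move=> cf; apply: (@preimage_closed _ _ f [set y | a <= y]) => [x _|].
  exact: cf.
exact: closed_ge.
Qed.

Lemma closed_eqf f a : continuous f -> closed [set x | f x = a].
Proof.
move=> cf; apply: (@preimage_closed _ _ f [set y | y = a]) => [x _|].
  exact: cf.
exact: closed_eq.
Qed.

Lemma continuous_eps f :
  (forall x e, 0 < e -> \forall y \near x, `|f y - f x| <= e) -> continuous f.
Proof.
move=> H x; apply/(@cvgrPdist_le R R^o) => e e0.
by near=> y; rewrite distrC; near: y; exact: H.
Unshelve. all: by end_near. Qed.

Lemma continuous_near f x e : continuous f -> 0 < e ->
  \forall y \near x, `|f y - f x| < e.
Proof.
move=> cf e0; have /(@cvgrPdist_lt R R^o) /(_ e e0) := cf x.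
by apply: filterS => y; rewrite distrC.
Qed.
End RealContinuity.

Lemma compactU (X : topologicalType) (A B : set X) :
  compact A -> compact B -> compact (A `|` B).
Proof.
move=> /compact_near_coveringP cA /compact_near_coveringP cB.
apply/compact_near_coveringP => I F P FF H.
have HA := cA I F P FF (fun x Ax => H x (or_introl Ax)).
have HB := cB I F P FF (fun x Bx => H x (or_intror Bx)).
by apply: filterS2 HA HB => i HA HB x [/HA|/HB].
Qed.

Lemma compact_image (X Y : topologicalType) (f : X -> Y) (A : set X) :
  continuous f -> compact A -> compact (f @` A).
Proof.
by move=> cf; apply: continuous_compact; apply: continuous_subspaceT.
Qed.

Lemma lch_nbhs (X : topologicalType) (x : X) : lch X ->
  exists K : set X, [/\ compact K, closed K & nbhs x K].
Proof.
case=> lc hX; have [C xC [cC clC]] := lc x I; exists C; split=> //.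
by move: xC; rewrite /within /=; apply: filterS => y; apply.
Qed.

Definition supp_in (R : realType) (X : Type) (f : X -> R) (K : set X) :=
  forall x, ~ K x -> f x = 0.

Definition ccr (R : realType) (X : topologicalType) (f : X -> R) :=
  continuous f /\ exists2 K, compact K & supp_in f K.

Section Bump.
Variables (R : realType) (X : topologicalType).
Hypothesis lX : lch X.

Lemma bump_pt (x : X) (U : set X) : open U -> U x ->
  exists f : X -> R, [/\ continuous f, forall y, 0 <= f y <= 1, f x = 1 &
    exists K, [/\ compact K, K `<=` U & supp_in f K]].
Proof.
move=> oU Ux; have [K [cK clK xK]] := lch_nbhs x lX.
pose B := ~` (K^° `&` U).
have clB : closed B by apply: open_closedC; apply: openI => //; exact: open_interior.
have nBx : ~ B x by apply: contrapT => /contrapT; apply; split.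
have [f [cf rf f0 f1]] := (uniform_separatorP (R := R) _ _).1
  (@locally_compact_completely_regular X R lX.1 lX.2 x B clB nBx).
have fr y : 0 <= f y <= 1.
  by have := rf (f y) (ex_intro2 _ _ y I erefl); rewrite /= in_itv.
have fx : f x = 0 by apply: f0; exists x.
have fB y : B y -> f y = 1 by move=> By; apply: f1; exists y.
pose g y := Num.max 0 (1 - 2 * f y).
have cg : continuous g.
  apply: ct_max; first exact: ct_cst.
  apply: ct_sub; first exact: ct_cst.
  by apply: ct_mul => //; exact: ct_cst.
exists g; split => //.
- by move=> y; rewrite /g le_max lexx /= ge_max ler01 /=; have := fr y; lra.
- by rewrite /g fx mulr0 subr0 max_r.
exists [set y | 1/2 <= 1 - f y]; split.
- apply: (@subclosed_compact _ _ K) => //.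
    by apply: closed_gef; apply: ct_sub => //; exact: ct_cst.
  move=> y /= Hy; apply: contrapT => nKy.
  have : B y by move=> -[/interior_subset].
  by move=> /fB e; move: Hy; rewrite e; lra.
- move=> y /= Hy; apply: contrapT => nUy.
  have : B y by move=> -[_ ].
  by move=> /fB e; move: Hy; rewrite e; lra.
- by move=> y /= /negP; rewrite -ltNge => Hy; rewrite /g max_l//; lra.
Qed.

Lemma bump_on (K U : set X) : compact K -> open U -> K `<=` U ->
  exists f : X -> R, [/\ continuous f, forall y, 0 <= f y <= 1,
    forall x, K x -> f x = 1 &
    exists C, [/\ compact C, C `<=` U & supp_in f C]].
Proof.
move=> cK oU KU.
pose P (A : set X) := exists f : X -> R, [/\ continuous f, forall y, 0 <= f y,
  forall x, A x -> 1 <= f x &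
    exists C, [/\ compact C, C `<=` U & supp_in f C]].
have [f [cf f0 f1 [C [cC CU fC]]]] : P K.
  apply: compact_ind => //.
  - exists (fun _ => 0); split=> //; first exact: ct_cst.
    by exists set0; split=> //; exact: compact0.
  - move=> A B [f [cf f0 f1 [C [cC CU fC]]]] [g [cg g0 g1 [D [cD DU gD]]]].
    exists (fun x => f x + g x); split.
    + exact: ct_add.
    + by move=> y; rewrite addr_ge0.
    + by move=> x [/f1|/g1] h; [rewrite -[1]addr0|rewrite -[1]add0r]; exact: lerD.
    + exists (C `|` D); split; first exact: compactU.
        by move=> x [/CU|/DU].
      by move=> x /not_orP[/fC -> /gD ->]; rewrite addr0.
  - by move=> A B AB [f [cf f0 f1 HC]]; exists f; split=> // x /AB /f1.
  - move=> x /KU Ux; have [f [cf f01 fx [C [cC CU fC]]]] := bump_pt oU Ux.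
    exists [set y | 1/2 < f y].
      apply: open_nbhs_nbhs; split; first exact: open_gtf.
      by rewrite /= fx; lra.
    exists (fun y => 2 * f y); split.
    + by apply: ct_mul => //; exact: ct_cst.
    + by move=> y; have := f01 y; lra.
    + by move=> y /=; lra.
    + by exists C; split=> // y /fC ->; rewrite mulr0.
exists (fun x => Num.min (f x) 1); split.
- by apply: ct_min => //; exact: ct_cst.
- by move=> y; rewrite le_min f0 ler01 /= ge_min lexx orbT.
- by move=> x /f1 h; rewrite min_r.
- by exists C; split=> // x /fC ->; rewrite min_l.
Qed.
End Bump.

(** Each point has a compact neighbourhood, and finitely many of them cover [K]. *)
Lemma ccr_nbhs (X : topologicalType) (K : set X) : lch X -> compact K ->
  exists2 C, compact C & exists2 U, open U & K `<=` U /\ U `<=` C.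
Proof.
move=> lX; pose P (A : set X) :=
  exists2 C, compact C & exists2 U, open U & A `<=` U /\ U `<=` C.
move=> cK; apply: (@compact_ind X K P) => //.
- by exists set0; [exact: compact0|by exists set0; [exact: open0|split]].
- move=> A B [C cC [U oU [AU UC]]] [D cD [V oV [BV VD]]].
  exists (C `|` D); first exact: compactU.
  by exists (U `|` V); [exact: openU|split; exact: setUSS].
- by move=> A B AB [C cC [U oU [BU UC]]]; exists C => //; exists U => //; split=> // x /AB/BU.
- move=> x _; have [C [cC _ xC]] := lch_nbhs x lX.
  exists C^° ; first by apply: open_nbhs_nbhs; split; [exact: open_interior|].
  exists C => //; exists C^° ; first exact: open_interior.
  by split=> //; exact: interior_subset.
Qed.

Lemma lch_prod (X Y : topologicalType) : lch X -> lch Y -> lch (X * Y)%type.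
Proof.
move=> lX lY; split.
- move=> [x y] _; have [K [cK clK xK]] := lch_nbhs x lX.
  have [L [cL clL yL]] := lch_nbhs y lY.
  exists (K `*` L); first by exists (K, L) => // -[a b] /= ab _.
  split; first exact: compact_setX.
  have -> : K `*` L = (fst @^-1` K) `&` (snd @^-1` L) by [].
  by apply: closedI; apply: preimage_closed => // z _; [exact: ct_fst|exact: ct_snd].
- move=> [x y] [x' y'] H; congr pair.
  + apply: lX.2 => A B xA xB.
    have [] := H (A `*` setT) (B `*` setT).
    * by exists (A, setT); [split=> //; exact: filterT|].
    * by exists (B, setT); [split=> //; exact: filterT|].
    by move=> [a b] [[Aa _] [Ba _]]; exists a.
  + apply: lY.2 => A B xA xB.
    have [] := H (setT `*` A) (setT `*` B).
    * by exists (setT, A); [split=> //; exact: filterT|].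
    * by exists (setT, B); [split=> //; exact: filterT|].
    by move=> [a b] [[_ Aa] [_ Ba]]; exists b.
Qed.

(** * Positive functionals and Fubini's theorem *)

Lemma bump_nbhd (R : realType) (X : topologicalType) (x : X) (U : set X) :
    lch X -> open U -> U x ->
  exists f : X -> R, [/\ continuous f, forall y, 0 <= f y <= 1,
    nbhs x [set y | f y = 1] &
    exists K, [/\ compact K, K `<=` U & supp_in f K]].
Proof.
move=> lX oU Ux; have [f [cf f01 fx [K [cK KU fK]]]] := bump_pt R lX oU Ux.
exists (fun y => Num.min 1 (2 * f y)); split.
- by apply: ct_min; [exact: ct_cst|apply: ct_mul => //; exact: ct_cst].
- move=> y; have := f01 y; rewrite le_min ge_min lexx /= ler01 /=; lra.
- have : nbhs x [set y | 1/2 < f y].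
    apply: open_nbhs_nbhs; split; first exact: open_gtf.
    by rewrite /= fx; lra.
  by apply: filterS => y /= h; rewrite min_l //; lra.
- by exists K; split=> // y /fK ->; rewrite mulr0 min_r.
Qed.

Section CcrClosure.
Variables (R : realType) (X : topologicalType).
Implicit Types f g : X -> R.

Lemma ccr_add f g : ccr f -> ccr g -> ccr (fun x => f x + g x).
Proof.
move=> [cf [K cK fK]] [cg [L cL gL]]; split; first exact: ct_add.
exists (K `|` L); first exact: compactU.
by move=> x /not_orP[/fK -> /gL ->]; rewrite addr0.
Qed.

Lemma ccr_mull f g : continuous g -> ccr f -> ccr (fun x => g x * f x).
Proof.
move=> cg [cf [K cK fK]]; split; first exact: ct_mul.
by exists K => // x /fK ->; rewrite mulr0.
Qed.

Lemma ccr_mulr f g : continuous g -> ccr f -> ccr (fun x => f x * g x).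
Proof.
move=> cg [cf [K cK fK]]; split; first exact: ct_mul.
by exists K => // x /fK ->; rewrite mul0r.
Qed.

Lemma ccr_scale (c : R) f : ccr f -> ccr (fun x => c * f x).
Proof. by apply: ccr_mull; exact: ct_cst. Qed.

Lemma ccr_opp f : ccr f -> ccr (fun x => - f x).
Proof.
move=> [cf [K cK fK]]; split; first exact: ct_opp.
by exists K => // x /fK ->; rewrite oppr0.
Qed.

Lemma ccr_sub f g : ccr f -> ccr g -> ccr (fun x => f x - g x).
Proof. by move=> cf cg; apply: ccr_add => //; exact: ccr_opp. Qed.

Lemma ccr_bump (K : set X) : lch X -> compact K ->
  exists f : X -> R, [/\ ccr f, forall x, 0 <= f x <= 1 & forall x, K x -> f x = 1].
Proof.
move=> lX cK; have [f [cf f01 fK [C [cC _ fC]]]] := bump_on R lX cK openT (fun _ _ => I).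
by exists f; split=> //; split=> //; exists C.
Qed.

Lemma ccr_bounded f : ccr f -> exists2 M : R, 0 <= M & forall x, `|f x| <= M.
Proof.
move=> [cf [K cK fK]].
have [M M0 HM] : exists2 M, 0 <= M & forall x, K x -> `|f x| <= M.
  apply: (@compact_ind X K (fun A => exists2 M, 0 <= M & forall x, A x -> `|f x| <= M)) => //.
  - by exists 0.
  - move=> A B [M M0 HM] [N N0 HN]; exists (M + N); first exact: addr_ge0.
    by move=> x [/HM|/HN] h; apply: (le_trans h); rewrite ?lerDl ?lerDr.
  - by move=> A B AB [M M0 HM]; exists M => // x /AB/HM.
  - move=> x _; exists [set y | `|f y - f x| < 1].
      by apply: continuous_near => //; exact: ltr01.
    exists (1 + `|f x|); first by rewrite addr_ge0.
    move=> y /= h; rewrite -(subrK (f x) (f y)) (le_trans (ler_normD _ _))//.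
    by rewrite lerD2r ltW.
by exists M => // x; have [/HM|/fK ->] := pselect (K x); rewrite ?normr0.
Qed.
End CcrClosure.

Lemma ccr_slice (R : realType) (X Y : topologicalType) (F : X * Y -> R) x :
  ccr F -> ccr (fun y => F (x, y)).
Proof.
move=> [cF [K cK FK]]; split.
  by apply: ct_comp => //; apply: ct_pair; [exact: ct_cst|exact: ct_id].
exists (snd @` K); first by apply: compact_image => //; exact: ct_snd.
by move=> y ny; apply: FK => Kxy; apply: ny; exists (x, y).
Qed.

Lemma ccr_slicel (R : realType) (X Y : topologicalType) (F : X * Y -> R) y :
  ccr F -> ccr (fun x => F (x, y)).
Proof.
move=> [cF [K cK FK]]; split.
  by apply: ct_comp => //; apply: ct_pair; [exact: ct_id|exact: ct_cst].
exists (fst @` K); first by apply: compact_image => //; exact: ct_fst.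
by move=> x nx; apply: FK => Kxy; apply: nx; exists (x, y).
Qed.

(** By Riesz's theorem these functionals are the Radon measures. *)
Record posfun (R : realType) (X : topologicalType) (L : (X -> R) -> R) : Prop :=
  Posfun {
  pfD : forall f g, ccr f -> ccr g -> L (fun x => f x + g x) = L f + L g ;
  pfZ : forall c f, ccr f -> L (fun x => c * f x) = c * L f ;
  pf_ge0 : forall f, ccr f -> (forall x, 0 <= f x) -> 0 <= L f
}.

Section PosfunTheory.
Variables (R : realType) (X : topologicalType) (L : (X -> R) -> R).
Hypothesis pL : posfun L.
Implicit Types f g : X -> R.

Lemma pfN f : ccr f -> L (fun x => - f x) = - L f.
Proof.
move=> cf; rewrite -mulN1r -pfZ//; congr L; apply/funext => x.
by rewrite mulN1r.
Qed.

Lemma pfB f g : ccr f -> ccr g -> L (fun x => f x - g x) = L f - L g.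
Proof. by move=> cf cg; rewrite pfD ?pfN//; exact: ccr_opp. Qed.

Lemma pf_le f g : ccr f -> ccr g -> (forall x, f x <= g x) -> L f <= L g.
Proof.
move=> cf cg fg; rewrite -subr_ge0 -pfB//; apply: pf_ge0 => //.
  exact: ccr_sub.
by move=> x; rewrite subr_ge0.
Qed.

Lemma pf_abs f g : ccr f -> ccr g -> (forall x, `|f x| <= g x) -> `|L f| <= L g.
Proof.
move=> cf cg fg; rewrite ler_norml -pfN//; apply/andP; split; apply: pf_le => //.
- exact: ccr_opp.
- by move=> x; have := fg x; rewrite ler_norml => /andP[].
- by move=> x; have := fg x; rewrite ler_norml => /andP[].
Qed.

Lemma pf_absB f g h : ccr f -> ccr g -> ccr h ->
  (forall x, `|f x - g x| <= h x) -> `|L f - L g| <= L h.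
Proof. by move=> cf cg ch fg; rewrite -pfB//; apply: pf_abs => //; exact: ccr_sub. Qed.

Lemma pf0 : L (fun=> 0) = 0.
Proof.
have c0 : @ccr R X (fun=> 0).
  by split; [exact: ct_cst|exists set0 => //; exact: compact0].
have h := pfZ pL 0 c0; rewrite -[RHS](mul0r (L (fun=> 0))) -h; congr L; apply/funext => x.
by rewrite mul0r.
Qed.

Lemma pf_scaler c f : ccr f -> L (fun x => f x * c) = L f * c.
Proof.
by move=> cf; rewrite mulrC -pfZ//; congr L; apply/funext => x; rewrite mulrC.
Qed.
End PosfunTheory.

(** Integrals of jointly continuous functions depend continuously on
    parameters, as long as the supports stay locally in a compact set. *)
Lemma pf_param (R : realType) (X Y : topologicalType) (L : (Y -> R) -> R)
    (F : X -> Y -> R) : lch Y -> posfun L ->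
  continuous (fun p : X * Y => F p.1 p.2) ->
  (forall x0 : X, exists2 C, compact C &
     \forall x \near nbhs x0, supp_in (F x) C) ->
  continuous (fun x => L (F x)).
Proof.
move=> lY pL cF HF; apply: continuous_eps => x0 e e0.
have [C cC HC] := HF x0.
have [l [cl l01 lC]] := ccr_bump R lY cC.
have Ll0 : 0 <= L l by apply: pf_ge0 => // y; have /andP[] := l01 y.
pose e' := e / (L l + 1).
have e'0 : 0 < e' by rewrite divr_gt0 // ltr_wpDl.
have ccF x : supp_in (F x) C -> ccr (F x).
  move=> FC; split; last by exists C.
  by apply: (@ct_comp _ _ _ (fun y => (x, y)) _ cF); apply: ct_pair; [exact: ct_cst|exact: ct_id].
have FC0 : supp_in (F x0) C := nbhs_singleton HC.
have ccF0 := ccF _ FC0.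
have HK : \forall x \near x0, C `<=` [set y | `|F x y - F x0 y| <= e'].
  have /compact_near_coveringP := cC.
  apply => y Cy.
  have c1 : continuous (fun p : X * Y => F p.1 p.2 - F x0 p.2).
    apply: ct_sub => //; apply: (@ct_comp _ _ _ (fun p : X * Y => (x0, p.2)) _ cF).
    by apply: ct_pair; [exact: ct_cst|exact: ct_snd].
  have := @continuous_near R (X * Y)%type _ (x0, y) _ c1 e'0.
  case=> -[A B] [/= xA yB] AB; exists (B, A) => //.
  move=> [y' x'] [/= By' Ax']; have := AB (x', y') (conj Ax' By').
  by rewrite /= subrr subr0 => /ltW.
apply: filterS2 HC HK => x FC HK.
apply: (@le_trans _ _ (e' * L l)).
  rewrite -(pfZ pL) //; apply: (pf_absB pL) => //; [exact: ccF|exact: ccr_scale|].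
  move=> y; have [Cy|nCy] := pselect (C y); first by rewrite lC// mulr1; exact: HK.
  rewrite FC// FC0// subrr normr0 mulr_ge0//; first exact: ltW.
  by have /andP[] := l01 y.
rewrite /e' mulrAC ler_pdivrMr ?ltr_wpDl// ler_pM2l//.
by rewrite lerDl ler01.
Qed.

Section Fubini.
Variables (R : realType) (X Y : topologicalType).
Variables (L : (X -> R) -> R) (M : (Y -> R) -> R).
Hypotheses (lX : lch X) (lY : lch Y) (pL : posfun L) (pM : posfun M).

Lemma ccr_pfr (F : X * Y -> R) : ccr F -> ccr (fun x => M (fun y => F (x, y))).
Proof.
move=> ccF; have [cF [K cK FK]] := ccF; split.
  apply: (pf_param (F := fun x y => F (x, y)) lY pM).
    by apply: ct_comp => //; apply: ct_pair; [exact: ct_fst|exact: ct_snd].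
  move=> x0; exists (snd @` K); first by apply: compact_image => //; exact: ct_snd.
  by near=> x => y ny; apply: FK => Kxy; apply: ny; exists (x, y).
exists (fst @` K); first by apply: compact_image => //; exact: ct_fst.
move=> x nx; rewrite -(pf0 pM); congr M; apply/funext => y.
by apply: FK => Kxy; apply: nx; exists (x, y).
Unshelve. all: by end_near. Qed.

Lemma ccr_pfl (F : X * Y -> R) : ccr F -> ccr (fun y => L (fun x => F (x, y))).
Proof.
move=> ccF; have [cF [K cK FK]] := ccF; split.
  apply: (pf_param (F := fun y x => F (x, y)) lX pL).
    by apply: ct_comp => //; apply: ct_pair; [exact: ct_snd|exact: ct_fst].
  move=> x0; exists (fst @` K); first by apply: compact_image => //; exact: ct_fst.
  by near=> y => x nx; apply: FK => Kxy; apply: nx; exists (x, y).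
exists (snd @` K); first by apply: compact_image => //; exact: ct_snd.
move=> y ny; rewrite -(pf0 pL); congr L; apply/funext => x.
by apply: FK => Kxy; apply: ny; exists (x, y).
Unshelve. all: by end_near. Qed.

Variable F : X * Y -> R.
Hypothesis ccF : ccr F.

Let Phi (f : X -> R) := L (fun x => f x * M (fun y => F (x, y)))
  - M (fun y => L (fun x => f x * F (x, y))).

Let ccfF (f : X -> R) : continuous f -> ccr (fun p : X * Y => f p.1 * F p).
Proof. by move=> cf; apply: ccr_mull => //; apply: ct_comp => //; exact: ct_fst. Qed.

Let PhiD (f g : X -> R) : continuous f -> continuous g ->
  Phi (fun x => f x + g x) = Phi f + Phi g.
Proof.
move=> cf cg; rewrite /Phi.
have -> : (fun x => (f x + g x) * M (fun y => F (x, y))) =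
  (fun x => f x * M (fun y => F (x, y)) + g x * M (fun y => F (x, y))).
  by apply/funext => x; rewrite mulrDl.
rewrite (pfD pL); [|by apply: ccr_mull => //; exact: ccr_pfr..].
have -> : (fun y => L (fun x => (f x + g x) * F (x, y))) =
  (fun y => L (fun x => f x * F (x, y)) + L (fun x => g x * F (x, y))).
  apply/funext => y; rewrite -(pfD pL); [|by apply: ccr_mull => //; exact: ccr_slicel..].
  by congr L; apply/funext => x; rewrite mulrDl.
rewrite (pfD pM); [|exact: (ccr_pfl (ccfF cf))|exact: (ccr_pfl (ccfF cg))].
by ring.
Qed.

(* If [F] varies by at most [e l(y)] on the support of [f], both iterated
   integrals are within [e M(l) L(f)] of [L(f) M(F(x0, .))]. *)
Let Phi_local (l : Y -> R) (e : R) (x0 : X) (U : set X) (f : X -> R) : ccr l -> 0 <= e ->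
  (forall y, 0 <= l y) ->
  (forall x y, U x -> `|F (x, y) - F (x0, y)| <= e * l y) ->
  ccr f -> (forall x, 0 <= f x) -> supp_in f U ->
  `|Phi f| <= (2 * e * M l) * L f.
Proof.
move=> cl e0 l0 HU ccf f0 fU.
have cf := ccf.1.
have H1 : `|L (fun x => f x * M (fun y => F (x, y))) - M (fun y => F (x0, y)) * L f|
    <= e * M l * L f.
  rewrite -!(pfZ pL)//; apply: (pf_absB pL); [|exact: ccr_scale..|].
    by apply: ccr_mull => //; exact: ccr_pfr.
  move=> x; rewrite (mulrC (M _)) -mulrBr normrM (ger0_norm (f0 x)) mulrC.
  have [Ux|/fU ->] := pselect (U x); last by rewrite !mulr0.
  apply: ler_wpM2r => //; rewrite -(pfZ pM)//.
  by apply: (pf_absB pM); [exact: ccr_slice..|exact: ccr_scale|move=> y; exact: HU].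
have H2 : `|M (fun y => L (fun x => f x * F (x, y))) - M (fun y => F (x0, y)) * L f|
    <= e * M l * L f.
  rewrite (mulrAC e) -(pf_scaler pM); last exact: ccr_slice.
  rewrite -(pfZ pM)//; apply: (pf_absB pM).
  - exact: (ccr_pfl (ccfF cf)).
  - by apply: ccr_mulr; [exact: ct_cst|exact: ccr_slice].
  - exact: ccr_scale.
  move=> y; rewrite mulrAC -!(pfZ pL)//; apply: (pf_absB pL).
  - by apply: ccr_mull => //; exact: ccr_slicel.
  - exact: ccr_scale.
  - exact: ccr_scale.
  move=> x; rewrite (mulrC (F (x0, y))) -mulrBr normrM (ger0_norm (f0 x)) mulrC.
  have [Ux|/fU ->] := pselect (U x); last by rewrite !mulr0.
  by apply: ler_wpM2r => //; exact: HU.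
rewrite /Phi.
move: H1 H2; set a := L (fun x => _); set b := M (fun y => L _).
set c := _ * L f; set d := e * _ * _ => H1 H2.
have -> : 2 * e * M l * L f = d + d by rewrite /d; ring.
have -> : a - b = (a - c) - (b - c) by ring.
by rewrite (le_trans (ler_normB _ _))// lerD.
Qed.

(** Fubini for positive functionals: the integrand is split by a partition of
    unity into pieces on which it is almost constant in the first variable. *)
Lemma pf_fubini : L (fun x => M (fun y => F (x, y))) = M (fun y => L (fun x => F (x, y))).
Proof.
have [cF [K0 cK0 FK0]] := ccF.
pose K := fst @` K0; pose C := snd @` K0.
have cK : compact K by apply: compact_image => //; exact: ct_fst.
have cC : compact C by apply: compact_image => //; exact: ct_snd.
have FK x y : ~ K x -> F (x, y) = 0.
  by move=> nK; apply: FK0 => Kxy; apply: nK; exists (x, y).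
have FC x y : ~ C y -> F (x, y) = 0.
  by move=> nC; apply: FK0 => Kxy; apply: nC; exists (x, y).
have [l [cl l01 lC]] := ccr_bump R lY cC.
have l0 y : 0 <= l y by have /andP[] := l01 y.
have [k [ck k01 kK]] := ccr_bump R lX cK.
have k0 x : 0 <= k x by have /andP[] := k01 x.
have key e : 0 < e -> `|Phi k| <= (2 * e * M l) * L k.
  move=> e0.
  have cst0 : 0 <= 2 * e * M l.
    by rewrite !mulr_ge0//; [exact: ltW|exact: pf_ge0].
  pose P (A : set X) := exists u : X -> R, [/\ continuous u, forall x, 0 <= u x <= 1,
    forall x, A x -> u x = 1 &
    forall f, ccr f -> (forall x, 0 <= f x) ->
      `|Phi (fun x => f x * u x)| <= (2 * e * M l) * L (fun x => f x * u x)].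
  have : P K.
    apply: compact_ind => //.
    - exists (fun=> 0); split=> //; first exact: ct_cst.
        by move=> x; rewrite lexx ler01.
      move=> f ccf f0.
      have -> : (fun x => f x * 0) = (fun=> 0) by apply/funext => x; rewrite mulr0.
      rewrite (pf0 pL) mulr0 /Phi.
      have -> : (fun x => 0 * M (fun y => F (x, y))) = (fun=> 0).
        by apply/funext => x; rewrite mul0r.
      have -> : (fun y => L (fun x => 0 * F (x, y))) = (fun=> 0).
        apply/funext => y; rewrite -[RHS](pf0 pL); congr L; apply/funext => x.
        by rewrite mul0r.
      by rewrite (pf0 pL) (pf0 pM) subrr normr0.
    - move=> A B [u [cu u01 uA Hu]] [v [cv v01 vB Hv]].
      have c1u : continuous (fun x => 1 - u x) by apply: ct_sub => //; exact: ct_cst.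
      exists (fun x => u x + (1 - u x) * v x); split.
      + by apply: ct_add => //; exact: ct_mul.
      + move=> x; have := u01 x; have := v01 x; nra.
      + by move=> x [/uA ->|/vB ->]; ring.
      + move=> f ccf f0.
        have -> : (fun x => f x * (u x + (1 - u x) * v x)) =
          (fun x => f x * u x + (f x * (1 - u x)) * v x).
          by apply/funext => x; ring.
        have c2 : ccr (fun x => f x * (1 - u x)) by exact: ccr_mulr.
        rewrite PhiD; [|by apply: ct_mul => //; exact: ccf.1|
          by apply: ct_mul => //; exact: c2.1].
        rewrite (pfD pL); [|exact: ccr_mulr..].
        rewrite mulrDr (le_trans (ler_normD _ _))// lerD//; first exact: Hu.
        apply: Hv => // x; apply: mulr_ge0 => //; have := u01 x; lra.
    - by move=> A B AB [u [cu u01 uB Hu]]; exists u; split=> // x /AB/uB.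
    - move=> x0 _.
      have : \forall x \near x0, C `<=` [set y | `|F (x, y) - F (x0, y)| <= e].
        have /compact_near_coveringP := cC.
        apply => y Cy.
        have c1 : continuous (fun p : X * Y => F p - F (x0, p.2)).
          apply: ct_sub => //; apply: ct_comp => //.
          by apply: ct_pair; [exact: ct_cst|exact: ct_snd].
        have := @continuous_near R (X * Y)%type _ (x0, y) _ c1 e0.
        case=> -[A B] [/= xA yB] AB; exists (B, A) => //.
        move=> [y' x'] [/= By' Ax']; have := AB (x', y') (conj Ax' By').
        by rewrite /= subrr subr0 => /ltW.
      move=> HN; have [U [oU Ux0] HU] : exists2 U, open_nbhs x0 U &
          U `<=` [set x | C `<=` [set y | `|F (x, y) - F (x0, y)| <= e]].
        by move: HN; rewrite /prop_near1 nbhsE.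
      have [u [cu u01 ux [D [cD DU uD]]]] := bump_nbhd R lX oU Ux0.
      exists [set y | u y = 1] => //; exists u; split=> //.
      move=> f ccf f0; apply: (@Phi_local l e x0 U) => //.
      + exact: ltW.
      + move=> x y /HU h; have [Cy|nCy] := pselect (C y).
          by rewrite lC// mulr1; exact: h.
        by rewrite !FC// subrr normr0 mulr_ge0// ltW.
      + exact: ccr_mulr.
      + by move=> x; rewrite mulr_ge0//; have /andP[] := u01 x.
      + by move=> x nU; rewrite uD ?mulr0// => /DU.
  case=> u [cu u01 uK Hu].
  have kuE x : (k x * u x) * M (fun y => F (x, y)) = k x * M (fun y => F (x, y)).
    have [Kx|nK] := pselect (K x); first by rewrite uK// mulr1.
    have -> : (fun y => F (x, y)) = fun=> 0 by apply/funext => y; rewrite FK.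
    by rewrite (pf0 pM) !mulr0.
  have kuE' x y : (k x * u x) * F (x, y) = k x * F (x, y).
    have [Kx|nK] := pselect (K x); first by rewrite uK// mulr1.
    by rewrite FK// !mulr0.
  have -> : Phi k = Phi (fun x => k x * u x).
    rewrite /Phi; congr (L _ - M _); first by apply/funext => x; rewrite kuE.
    by apply/funext => y; congr L; apply/funext => x; rewrite kuE'.
  rewrite (le_trans (Hu k _ _))// ler_wpM2l//; apply: pf_le => //.
    exact: ccr_mulr.
  by move=> x; rewrite ler_piMr//; have /andP[] := u01 x.
have Phik : Phi k = 0.
  apply/eqP; rewrite -normr_eq0; apply/eqP/le_anti; rewrite normr_ge0 andbT.
  have Ml : 0 <= M l by exact: pf_ge0.
  have Lk : 0 <= L k by exact: pf_ge0.
  have ML : 0 < 2 * M l * L k + 1.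
    by rewrite ltr_wpDl// !mulr_ge0.
  apply/ler_addgt0Pl => e e0; rewrite addr0.
  have := key (e / (2 * M l * L k + 1)) (divr_gt0 e0 ML).
  move=> /le_trans; apply.
  have -> : 2 * (e / (2 * M l * L k + 1)) * M l * L k =
     e * ((2 * M l * L k) / (2 * M l * L k + 1)) by field; rewrite gt_eqF.
  apply: ler_piMr; first exact: ltW.
  by rewrite ler_pdivrMr// mul1r lerDl ler01.
move: Phik; rewrite /Phi => /eqP; rewrite subr_eq0 => /eqP.
have -> : (fun x => k x * M (fun y => F (x, y))) = (fun x => M (fun y => F (x, y))).
  apply/funext => x; have [Kx|nK] := pselect (K x); first by rewrite kK// mul1r.
  have -> : (fun y => F (x, y)) = fun=> 0 by apply/funext => y; rewrite FK.
  by rewrite (pf0 pM) mulr0.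
move=> ->; congr M; apply/funext => y; congr L; apply/funext => x.
have [Kx|nK] := pselect (K x); first by rewrite kK// mul1r.
by rewrite FK// mulr0.
Qed.
End Fubini.

(** * The Haar integral of compactly supported functions *)

(** Split a function into positive and negative parts. *)
Lemma pf_ext (R : realType) (X : topologicalType) (L M : (X -> R) -> R) :
  posfun L -> posfun M ->
  (forall f, ccr f -> (forall x, 0 <= f x) -> L f = M f) ->
  forall f, ccr f -> L f = M f.
Proof.
move=> pL pM LM f cf.
have c1 : ccr (fun x => Num.max (f x) 0).
  have [ctf [K cK fK]] := cf; split; first by apply: ct_max => //; exact: ct_cst.
  by exists K => // x /fK ->; rewrite maxxx.
have c2 : ccr (fun x => Num.max (- f x) 0).
  have [ctf [K cK fK]] := cf; split.
    by apply: ct_max; [exact: ct_opp|exact: ct_cst].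
  by exists K => // x /fK ->; rewrite oppr0 maxxx.
have -> : f = (fun x => Num.max (f x) 0 - Num.max (- f x) 0).
  apply/funext => x; have [f0|f0] := leP 0 (f x).
    by rewrite max_r ?subr0// oppr_le0.
  by rewrite max_l ?sub0r ?opprK// oppr_ge0 ltW.
rewrite (pfB pL)// (pfB pM)// !LM// => x; by rewrite le_max lexx orbT.
Qed.

Lemma ct_mulg (G : topologicalGroupType) (X : topologicalType) (f g : X -> G) :
  continuous f -> continuous g -> continuous (fun x => (f x * g x)%g).
Proof.
move=> cf cg; apply: (@ct_comp _ _ _ (fun x => (f x, g x)) (fun p : G * G => (p.1 * p.2)%g)).
  exact: mulg_continuous.
exact: ct_pair.
Qed.

Lemma ct_invg (G : topologicalGroupType) (X : topologicalType) (f : X -> G) :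
  continuous f -> continuous (fun x => ((f x)^-1)%g).
Proof.
by move=> cf; apply: (ct_comp (g := fun g : G => (g^-1)%g)) => //; exact: invg_continuous.
Qed.

Ltac ct := repeat (first [assumption | exact: ct_id | exact: ct_cst | exact: ct_fst
  | exact: ct_snd | apply: ct_pair | apply: ct_mulg | apply: ct_invg
  | apply: (ct_comp (@ct_fst _ _)) | apply: (ct_comp (@ct_snd _ _))
  | apply: ct_mul | apply: ct_add | apply: ct_opp | apply: ct_abs ]).

Section Haar.
Variables (R : realType) (G : topologicalGroupType).
Hypotheses (hausG : hausdorff_space G) (lcG : locally_compact [set: G]).
Variables (mu : {measure set (borel G) -> \bar R}) (haar : left_haar mu).
Variables (Delta : G -> R) (modular : modular_function mu Delta).

Let lG : lch G. Proof. by []. Qed.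

Definition hint (f : G -> R) : R := Rintegral mu setT (f : borel G -> R).

Lemma open_borel (U : set G) : open U -> measurable (U : set (borel G)).
Proof. by move=> oU; apply: sub_sigma_algebra. Qed.

Lemma closed_borel (U : set G) : closed U -> measurable (U : set (borel G)).
Proof.
move=> cU; rewrite -[U]setCK; apply: measurableC; apply: open_borel.
exact: closed_openC.
Qed.

Lemma compact_borel (K : set G) : compact K -> measurable (K : set (borel G)).
Proof. by move=> cK; apply: closed_borel; exact: compact_closed. Qed.

Lemma ct_measurable (f : G -> R) : continuous f ->
  measurable_fun setT (f : borel G -> R).
Proof.
move=> cf; apply: (measurability _ (RGenOInfty.measurableE R)).
move=> /= _ [_ [a ->]] <-; rewrite setTI; apply: open_borel.
have -> : f @^-1` `]a, +oo[ = [set x | a < f x].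
  by apply/seteqP; split=> x /=; rewrite in_itv /= andbT.
exact: open_gtf.
Qed.

Lemma ct_measurableG (f : G -> G) : continuous f ->
  measurable_fun setT (f : borel G -> borel G).
Proof.
move=> cf; apply: (@measurability _ _ (borel G) (borel G) setT f (@open G)) => //.
move=> /= _ [A oA <-]; rewrite setTI; apply: open_borel.
by apply: open_comp => // x _; exact: cf.
Qed.

Lemma ccr_integrable (f : G -> R) : ccr f ->
  mu.-integrable setT (EFin \o (f : borel G -> R)).
Proof.
move=> cf; have [ctf [K cK fK]] := cf.
have [M M0 fM] := ccr_bounded cf.
have mK := compact_borel cK.
apply: (@le_integrable _ (borel G) R mu setT measurableT (EFin \o f)
  (EFin \o (fun x : borel G => M * \1_(K : set (borel G)) x))) => //.
- by apply/(@measurable_EFinP _ (borel G) R setT f); exact: ct_measurable.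
- move=> x _ /=; rewrite lee_fin indicE.
  have [Kx|nK] := pselect (K x); first by rewrite mem_set// mulr1 (ger0_norm M0).
  by rewrite fK// normr0.
- apply/integrableP; split.
    by apply/measurable_EFinP; apply: measurable_funM => //; exact: measurable_indic.
  under eq_integral do rewrite /= normrM (ger0_norm M0) ger0_norm ?indicE// EFinM.
  rewrite ge0_integralZl//=.
  + rewrite (_ : (fun x => _) = (fun x => (\1_K x)%:E))// integral_indic// setIT.
    by rewrite lte_mul_pinfty//; [exact: haar_compact].
  + exact/measurable_EFinP/measurable_indic.
Qed.

Lemma hint_posfun : posfun hint.
Proof.
split.
- by move=> f g cf cg; rewrite /hint RintegralD//; exact: ccr_integrable.
- by move=> c f cf; rewrite /hint RintegralZl//; exact: ccr_integrable.
- by move=> f cf f0; apply: Rintegral_ge0.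
Qed.

Lemma hint_change (phi : G -> G) (c : R) : continuous phi -> 0 <= c ->
  (forall A : set (borel G), measurable A -> mu (phi @^-1` A) = (c%:E * mu A)%E) ->
  forall f, ccr f -> (forall x, 0 <= f x) -> hint (fun h => f (phi h)) = c * hint f.
Proof.
move=> cphi c0 muphi f cf f0; rewrite /hint /Rintegral.
have mphi := ct_measurableG cphi.
pose phim : {mfun borel G >-> borel G} :=
  HB.pack (phi : borel G -> borel G) (isMeasurableFun.Build _ _ _ _ _ mphi).
have mf : measurable_fun (setT : set (borel G)) (EFin \o (f : borel G -> R)).
  by apply/(@measurable_EFinP _ (borel G) R setT f); apply: ct_measurable; exact: cf.1.
have := ge0_integral_pushforward mphi mu (@measurableT _ _) mf.
rewrite preimage_setT => <-; last by move=> y _; rewrite lee_fin.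
have -> : (\int[pushforward mu (phi : borel G -> borel G)]_y (f y)%:E =
    \int[mscale (NngNum c0) mu]_y (f y)%:E)%E.
  apply: (@eq_measure_integral _ _ _ _ (mscale (NngNum c0) mu) (pushforward mu phim)).
  by move=> A mA _; exact: (muphi A mA).
rewrite ge0_integral_mscale//; last by move=> x _; rewrite lee_fin.
rewrite fineM//.
exact: integrable_fin_num (ccr_integrable cf).
Qed.

Lemma ccr_homeo (X Y : topologicalType) (phi : X -> Y) (phi' : Y -> X) (f : Y -> R) :
  continuous phi -> continuous phi' -> cancel phi phi' -> cancel phi' phi ->
  ccr f -> ccr (fun x => f (phi x)).
Proof.
move=> cphi cphi' K1 K2 [cf [K cK fK]]; split; first exact: ct_comp.
exists (phi' @` K); first exact: compact_image.
by move=> x nx; apply: fK => Kx; apply: nx; exists (phi x).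
Qed.

Lemma ccr_transl (f : G -> R) g : ccr f -> ccr (fun h => f (g * h)%g).
Proof.
apply: (@ccr_homeo _ _ (fun h => (g * h)%g) (fun h => (g^-1 * h)%g)).
- by apply: ct_mulg; [exact: ct_cst|exact: ct_id].
- by apply: ct_mulg; [exact: ct_cst|exact: ct_id].
- by move=> x; rewrite mulgA mulVg mul1g.
- by move=> x; rewrite mulgA mulgV mul1g.
Qed.

Lemma ccr_transr (f : G -> R) g : ccr f -> ccr (fun h => f (h * g)%g).
Proof.
apply: (@ccr_homeo _ _ (fun h => (h * g)%g) (fun h => (h * g^-1)%g)).
- by apply: ct_mulg; [exact: ct_id|exact: ct_cst].
- by apply: ct_mulg; [exact: ct_id|exact: ct_cst].
- by move=> x; rewrite -mulgA mulgV mulg1.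
- by move=> x; rewrite -mulgA mulVg mulg1.
Qed.

Lemma ccr_inv (f : G -> R) : ccr f -> ccr (fun h => f (h^-1)%g).
Proof.
apply: (@ccr_homeo _ _ (fun h => (h^-1)%g) (fun h => (h^-1)%g)) => //.
- exact: invg_continuous.
- exact: invg_continuous.
- exact: invgK.
- exact: invgK.
Qed.

Lemma posfun_comp (X Y : topologicalType) (L : (X -> R) -> R) (phi : X -> Y) :
  posfun L -> (forall f : Y -> R, ccr f -> ccr (fun x => f (phi x))) ->
  posfun (fun f : Y -> R => L (fun x => f (phi x))).
Proof.
move=> pL H; split.
- by move=> f g cf cg; rewrite (pfD pL)//; exact: H.
- by move=> c f cf; rewrite (pfZ pL)//; exact: H.
- by move=> f cf f0; apply: (pf_ge0 pL) => //; exact: H.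
Qed.

Lemma posfun_scale (X : topologicalType) (L : (X -> R) -> R) c :
  posfun L -> 0 <= c -> posfun (fun f : X -> R => c * L f).
Proof.
move=> pL c0; split.
- by move=> f g cf cg; rewrite (pfD pL)// mulrDr.
- by move=> k f cf; rewrite (pfZ pL)// mulrCA.
- by move=> f cf f0; rewrite mulr_ge0//; exact: (pf_ge0 pL).
Qed.

Lemma hint_left g f : ccr f -> hint (fun h => f (g * h)%g) = hint f.
Proof.
move: f; apply: pf_ext.
- apply: (posfun_comp (phi := fun h => (g * h)%g)) hint_posfun _ => f.
  exact: ccr_transl.
- exact: hint_posfun.
move=> f cf f0; rewrite -[RHS]mul1r.
apply: (@hint_change (fun h => (g * h)%g)) => //.
  by apply: ct_mulg; [exact: ct_cst|exact: ct_id].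
move=> A mA; rewrite mul1e -(haar_invariant haar (g^-1)%g mA); congr (mu _).
apply/seteqP; split=> [h /= Ah|h /= [k Ak <-]].
  by exists (g * h)%g => //; rewrite mulgA mulVg mul1g.
by rewrite mulgA mulgV mul1g.
Qed.

Lemma Delta_gt0 g : 0 < Delta g. Proof. by have [] := modular g. Qed.

(** By inner regularity of the whole group. *)
Lemma haar_pos_compact : exists K : set G, [/\ compact K, (0 < mu K)%E & (mu K < +oo)%E].
Proof.
apply: contrapT => b; apply: (haar_neq0 haar).
rewrite (haar_inner haar openT); apply/eqP; rewrite eq_le; apply/andP; split.
  apply: ge_ereal_sup => _ [K [cK _] <-]; rewrite leNgt; apply/negP => mK.
  by apply: b; exists K; split=> //; exact: haar_compact.
apply: le_trans (ereal_sup_ubound _); last first.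
  by exists set0 => //; split=> //; exact: compact0.
by rewrite measure0.
Qed.

Lemma meas_transr (A : set (borel G)) g : measurable A ->
  measurable ((fun h : G => (h * g)%g) @` A : set (borel G)).
Proof.
move=> mA; have -> : (fun h : G => (h * g)%g) @` A = (fun h : G => (h * g^-1)%g) @^-1` A.
  apply/seteqP; split=> [_ /= [k Ak <-]|h /= Ah].
    by rewrite -mulgA mulgV mulg1.
  by exists (h * g^-1)%g => //; rewrite -mulgA mulVg mulg1.
have /(_ measurableT _ mA) : measurable_fun setT ((fun h : G => (h * g^-1)%g) : borel G -> borel G).
  by apply: ct_measurableG; ct.
by rewrite setTI.
Qed.

(** Compare [mu] on the two right translates of one compact set of positive finite
    measure. *)
Lemma DeltaM g h : Delta (g * h)%g = Delta g * Delta h.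
Proof.
have [K [cK K0 Koo]] := haar_pos_compact.
have mK := compact_borel cK.
have [_ Dg] := modular g; have [_ Dh] := modular h; have [_ Dgh] := modular (g * h)%g.
have := Dh _ (meas_transr g mK).
have -> : (fun k : G => (k * h)%g) @` ((fun k : G => (k * g)%g) @` K) =
    (fun k : G => (k * (g * h))%g) @` K.
  apply/seteqP; split=> [_ /= [_ [k Kk <-] <-]|_ /= [k Kk <-]].
    by exists k => //; rewrite mulgA.
  by exists (k * g)%g; [exists k|rewrite mulgA].
rewrite Dg// Dgh//.
have Kfin : mu K \is a fin_num by rewrite ge0_fin_numE// ltW.
rewrite -(fineK Kfin) -!EFinM => -[].
have r0 : fine (mu K) != 0 by rewrite gt_eqF// fine_gt0// K0.
by rewrite mulrA => /(mulIf r0) ->; rewrite mulrC.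
Qed.

Lemma Delta1 : Delta 1%g = 1.
Proof.
have := DeltaM 1%g 1%g; rewrite mulg1 => /eqP.
have D1 := Delta_gt0 1%g.
by rewrite -subr_eq0 -{1}(mulr1 (Delta _)) -mulrBr mulf_eq0 gt_eqF//= subr_eq0 => /eqP.
Qed.

Lemma DeltaV g : Delta (g^-1)%g = (Delta g)^-1.
Proof.
have Dg := Delta_gt0 g.
by apply: (mulIf (lt0r_neq0 Dg)); rewrite -DeltaM mulVg Delta1 mulVf ?gt_eqF.
Qed.

(** Outer regularity bounds [mu (K g)] for [g] near the identity. *)
Lemma Delta_le_near1 e : 0 < e -> \forall g \near (1%g : G), Delta g <= 1 + e.
Proof.
move=> e0; have [K [cK K0 Koo]] := haar_pos_compact.
have mK := compact_borel cK.
have Kfin : mu K \is a fin_num by rewrite ge0_fin_numE// ltW.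
have r0 : 0 < fine (mu K) by rewrite fine_gt0// K0.
have [U [oU KU] muU] : exists2 U, open U /\ K `<=` U &
    (mu U < ((1 + e) * fine (mu K))%:E)%E.
  have := haar_outer haar mK.
  have : (mu K < ((1 + e) * fine (mu K))%:E)%E.
    by rewrite -{1}(fineK Kfin) lte_fin ltr_pMl// ltrDl.
  move=> /[swap] {1}-> /ereal_inf_lt [_ [U HU <-] h].
  by exists U.
have : \forall g \near (1%g : G), K `<=` [set x | U (x * g)%g].
  have /compact_near_coveringP := cK; apply => x Kx.
  have c1 : continuous (fun p : G * G => (p.1 * p.2)%g) by ct.
  have : nbhs (x, 1%g) ((fun p : G * G => (p.1 * p.2)%g) @^-1` U).
    apply: c1; rewrite /= mulg1; apply: open_nbhs_nbhs; split=> //.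
    exact: KU.
  case=> -[A B] [/= xA gB] AB; exists (A, B) => //.
apply: filterS => g HK.
have [_ Dg] := modular g.
have : (mu ((fun h : G => (h * g)%g) @` K) <= mu U)%E.
  apply: le_measure; rewrite ?inE.
  - exact: meas_transr.
  - exact: open_borel.
  - by move=> _ [h Kh <-]; exact: HK.
rewrite Dg// -(fineK Kfin) -EFinM => /le_lt_trans/(_ muU).
by rewrite lte_fin ltr_pM2r// => /ltW.
Qed.

(** [Delta] is multiplicative, so the bound near the identity, applied to [g] and to
    [g^-1], suffices. *)
Lemma ct_Delta : continuous Delta.
Proof.
apply: continuous_eps => g e e0.
have Dg := Delta_gt0 g.
pose e' := e / Delta g.
have e'0 : 0 < e' by exact: divr_gt0.
have H1 := Delta_le_near1 e'0.
have H2 : \forall u \near (1%g : G), Delta (u^-1)%g <= 1 + e'.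
  have ci : continuous (fun u : G => (u^-1)%g) by ct.
  have := ci 1%g _ (_ : nbhs ((1 : G)^-1)%g [set u | Delta u <= 1 + e']).
  by apply; rewrite invg1.
have H : \forall u \near (1%g : G), `|Delta u - 1| <= e'.
  apply: filterS2 H1 H2 => u; rewrite DeltaV => h1 h2.
  have Du := Delta_gt0 u.
  have h3 : 1 <= (1 + e') * Delta u by rewrite -ler_pdivrMr// div1r.
  rewrite ler_norml; apply/andP; split; last by lra.
  nra.
have ct' : continuous (fun h : G => (g^-1 * h)%g) by ct.
have : \forall h \near g, `|Delta (g^-1 * h)%g - 1| <= e'.
  have := ct' g _ (_ : nbhs (g^-1 * g)%g [set u | `|Delta u - 1| <= e']).
  by apply; rewrite mulVg.
apply: filterS => h; rewrite DeltaM DeltaV => hh.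
have -> : Delta h - Delta g = Delta g * ((Delta g)^-1 * Delta h - 1).
  by rewrite mulrBr mulrA mulfV ?gt_eqF// mul1r mulr1.
rewrite normrM (gtr0_norm Dg) (le_trans (ler_wpM2l (ltW Dg) hh))//.
by rewrite /e' mulrCA mulfV ?gt_eqF// mulr1.
Qed.

Lemma hint_right x f : ccr f -> hint (fun h => f (h * x)%g) = (Delta x)^-1 * hint f.
Proof.
have Dx := Delta_gt0 x.
move: f; apply: pf_ext.
- apply: (posfun_comp (phi := fun h => (h * x)%g)) hint_posfun _ => f.
  exact: ccr_transr.
- by apply: posfun_scale; [exact: hint_posfun|rewrite invr_ge0 ltW].
move=> f cf f0.
apply: (@hint_change (fun h => (h * x)%g)) => //.
- by ct.
- by rewrite invr_ge0 ltW.
move=> A mA; have [_ HM] := modular (x^-1)%g; rewrite -DeltaV -HM//.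
congr (mu _); apply/seteqP; split=> [h /= Ah|h /= [k Ak <-]].
    by exists (h * x)%g => //; rewrite -mulgA mulgV mulg1.
  by rewrite -mulgA mulVg mulg1.
Qed.

(** If the integral vanished, finitely many left translates of [f] would majorise the
    indicator function of any compact set, and every compact set would be null. *)
Lemma hint_gt0 f x : ccr f -> (forall h, 0 <= f h) -> 0 < f x -> 0 < hint f.
Proof.
move=> cf f0 fx; rewrite lt_def (pf_ge0 hint_posfun cf f0) andbT; apply/negP => /eqP h0.
have [K [cK K0 Koo]] := haar_pos_compact.
pose P (A : set G) := exists F : G -> R, [/\ ccr F, forall h, 0 <= F h,
  forall h, A h -> 1 <= F h & hint F = 0].
have [F [cF F0 F1 hF]] : P K.
  apply: compact_ind => //.
  - exists (fun=> 0); split=> //.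
      by split; [exact: ct_cst|exists set0 => //; exact: compact0].
    exact: (pf0 hint_posfun).
  - move=> A B [F [cF F0 F1 hF]] [F' [cF' F0' F1' hF']].
    exists (fun h => F h + F' h); split.
    + exact: ccr_add.
    + by move=> h; rewrite addr_ge0.
    + by move=> h [/F1|/F1'] k; rewrite (le_trans k)// ?lerDl ?lerDr.
    + by rewrite (pfD hint_posfun)// hF hF' addr0.
  - by move=> A B AB [F [cF F0 F1 hF]]; exists F; split=> // h /AB/F1.
  - move=> y _; exists [set h | f x / 2 < f (x * y^-1 * h)%g].
      apply: open_nbhs_nbhs; split.
        by apply: open_gtf; apply: ct_comp; [exact: cf.1|ct].
      by rewrite /= -mulgA mulVg mulg1 ltr_pdivrMr// ltr_pMr// ltr1n.
    have cf' := ccr_transl (x * y^-1)%g cf.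
    exists (fun h => (2 / f x) * f (x * y^-1 * h)%g); split.
    + exact: ccr_scale.
    + by move=> h; rewrite mulr_ge0// divr_ge0// ltW.
    + move=> h /= Hh; rewrite mulrAC ler_pdivlMr// mul1r.
      by move: Hh; rewrite ltr_pdivrMr// mulrC => /ltW.
    + by rewrite (pfZ hint_posfun)// hint_left// h0 mulr0.
have : (mu K <= 0)%E.
  have : ((\int[mu]_x (F x)%:E)%E = 0)%E.
    have fin := integrable_fin_num (@measurableT _ (borel G)) (ccr_integrable cF).
    by rewrite -(fineK fin); congr EFin.
  move=> <-.
  have mK := compact_borel cK.
  have -> : mu K = (\int[mu]_x (\1_(K : set (borel G)) x)%:E)%E.
    by rewrite integral_indic// setIT.
  apply: ge0_le_integral => //.
  - by apply/measurable_EFinP; exact: measurable_indic.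
  - by apply/(@measurable_EFinP _ (borel G) R setT F); apply: ct_measurable; exact: cF.1.
  - move=> h _; rewrite lee_fin indicE; have [Kh|nK] := pselect (K h).
      by rewrite mem_set//; exact: F1.
    by rewrite memNset.
by rewrite leNgt K0.
Qed.

Lemma ccr_tensor (X Y : topologicalType) (f : X -> R) (g : Y -> R) :
  ccr f -> ccr g -> ccr (fun p : X * Y => f p.1 * g p.2).
Proof.
move=> [cf [K cK fK]] [cg [L cL gL]]; split.
  by apply: ct_mul; apply: ct_comp => //; [exact: ct_fst|exact: ct_snd].
exists (K `*` L); first exact: compact_setX.
by move=> [x y] /= /not_andP[/fK ->|/gL ->]; rewrite ?mul0r ?mulr0.
Qed.

Let D1 (h : G) := (Delta h)^-1.

Lemma ct_DeltaV : continuous (fun h => (Delta h)^-1).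
Proof.
have -> : (fun h => (Delta h)^-1) = (fun h => Delta (h^-1)%g).
  by apply/funext => h; rewrite DeltaV.
by apply: ct_comp; [exact: ct_Delta|ct].
Qed.

(** Inversion turns left Haar measure into [Delta^-1] times it.  Evaluating a
    double integral in two ways gives [I(f) J(g) = J(g) J(f)]. *)
Lemma hint_inv f : ccr f -> hint (fun h => f (h^-1)%g * (Delta h)^-1) = hint f.
Proof.
move=> cf; pose J (f : G -> R) := hint (fun h => f (h^-1)%g * (Delta h)^-1).
have cJ g : ccr g -> ccr (fun h => g (h^-1)%g * (Delta h)^-1).
  by move=> cg; apply: ccr_mulr; [exact: ct_DeltaV|exact: ccr_inv].
have [g [cg g01 g1]] := ccr_bump R lG (@compact_set1 _ (1%g : G)).
have g0 x : 0 <= g x by have /andP[] := g01 x.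
have Jg : 0 < J g.
  apply: (@hint_gt0 _ 1%g); first exact: cJ.
    by move=> h; rewrite mulr_ge0// invr_ge0 ltW// Delta_gt0.
  by rewrite invg1 g1// Delta1 invr1 mulr1.
suff H : hint f * J g = J f * J g by apply/esym/(mulIf (lt0r_neq0 Jg)).
pose F1 (p : G * G) := (f p.1 * g (p.1^-1 * p.2^-1)%g) * (Delta p.2)^-1.
pose F2 (p : G * G) := (f (p.1^-1 * p.2)%g * g (p.2^-1)%g) * (Delta p.1)^-1.
have ctD1 : continuous (fun p : G * G => (Delta p.1)^-1).
  by apply: (ct_comp (f := fun p : G * G => p.1) ct_DeltaV); ct.
have ctD2 : continuous (fun p : G * G => (Delta p.2)^-1).
  by apply: (ct_comp (f := fun p : G * G => p.2) ct_DeltaV); ct.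
have cF1 : ccr F1.
  apply: ccr_mulr => //.
  apply: (@ccr_homeo (G * G)%type (G * G)%type (fun p => (p.1, (p.1^-1 * p.2^-1)%g))
    (fun p => (p.1, ((p.1 * p.2)^-1)%g)) (fun p => f p.1 * g p.2)).
  - by ct.
  - by ct.
  - by move=> [x y] /=; rewrite mulgA mulgV mul1g invgK.
  - by move=> [x y] /=; rewrite invgK mulgA mulVg mul1g.
  - exact: ccr_tensor.
have cF2 : ccr F2.
  apply: ccr_mulr => //.
  apply: (@ccr_homeo (G * G)%type (G * G)%type (fun p => ((p.1^-1 * p.2)%g, (p.2^-1)%g))
    (fun p => ((p.2^-1 * p.1^-1)%g, (p.2^-1)%g)) (fun p => f p.1 * g p.2)).
  - by ct.
  - by ct.
  - by move=> [x y] /=; rewrite invgK invgM invgK mulgA mulgV mul1g.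
  - by move=> [x y] /=; rewrite invgM !invgK -mulgA mulgV mulg1.
  - exact: ccr_tensor.
have E1 : hint f * J g = hint (fun x => hint (fun y => F1 (x, y))).
  rewrite -(pf_scaler hint_posfun)//; congr hint; apply/funext => x.
  have -> : (fun y => F1 (x, y)) = (fun y => f x * (g (x^-1 * y^-1)%g * (Delta y)^-1)).
    by apply/funext => y; rewrite /F1 /= mulrA.
  rewrite (pfZ hint_posfun); last first.
    have := ccr_transr x (cJ _ cg); move=> /(ccr_scale (Delta x)).
    congr ccr; apply/funext => y; rewrite invgM DeltaM invfM.
    by have := Delta_gt0 x; move: (g _) (Delta x) (Delta y)^-1 => a b c b0; field; rewrite gt_eqF.
  congr (_ * _); rewrite /J -[LHS]mul1r -(mulfV (lt0r_neq0 (Delta_gt0 x))) -mulrA.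
  rewrite -hint_right; last exact: cJ.
  rewrite -(pfZ hint_posfun); last exact: (ccr_transr x (cJ _ cg)).
  congr hint; apply/funext => y; rewrite invgM DeltaM invfM.
  by have := Delta_gt0 x; move: (g _) (Delta x) (Delta y)^-1 => a b c b0; field; rewrite gt_eqF.
have E2 : hint (fun x => hint (fun y => F1 (x, y))) = hint (fun y => hint (fun x => F2 (y, x))).
  rewrite (pf_fubini lG lG hint_posfun hint_posfun cF1).
  congr hint; apply/funext => y.
  rewrite -(hint_left (y^-1)%g (ccr_slicel y cF1)); congr hint; apply/funext => x.
  by rewrite /F1 /F2 /= invgM invgK -mulgA mulgV mulg1.
have E3 : hint (fun y => hint (fun x => F2 (y, x))) = J f * J g.
  rewrite (pf_fubini lG lG hint_posfun hint_posfun cF2) mulrC.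
  rewrite -(pf_scaler hint_posfun); last exact: cJ.
  congr hint; apply/funext => x.
  rewrite -(hint_left x (ccr_slicel x cF2)) /J -(pfZ hint_posfun); last exact: cJ.
  congr hint; apply/funext => y; rewrite /F2 /= invgM -mulgA mulVg mulg1 DeltaM invfM.
  by ring.
by rewrite E1 E2 E3.
Qed.
End Haar.

(** * Integration over the fibres of the source map *)

Lemma ct_ext (X Y : topologicalType) (f g : X -> Y) :
  continuous f -> f =1 g -> continuous g.
Proof. by move=> cf /funext <-. Qed.

Section FibreSum.
Variables (R : realType) (E : topologicalGraph).

Let lchV : lch (vertex E).
Proof. by split; [exact: vertex_locally_compact|exact: vertex_hausdorff]. Qed.
Let lchE : lch (edge E).
Proof. by split; [exact: edge_locally_compact|exact: edge_hausdorff]. Qed.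

Definition fibre_sum (V : nmodType) (z : edge E -> V) (w : vertex E) : V :=
  \sum_(e \in [set e | source_map e = w]) z e.

Lemma ct_source : continuous (@source_map E).
Proof.
move=> e; have [U [oU Ue _ cU _]] := source_local_homeo e.
by move: cU; rewrite continuous_open_subspace// => /(_ e); apply; rewrite inE.
Qed.

(** [s] is injective near each edge, so each edge has a neighbourhood that meets the
    fibre at most once. *)
Lemma fibre_finite (K : set (edge E)) w : compact K ->
  finite_set (K `&` [set e | source_map e = w]).
Proof.
move=> cK; apply: (@compact_ind _ K (fun A => finite_set (A `&` [set e | source_map e = w]))) => //.
- by rewrite set0I.
- by move=> A B fA fB; rewrite setIUl finite_setU.
- by move=> A B AB; apply: sub_finite_set; apply: setSI.
- move=> e _; have [U [oU Ue _ _ [s' [_ s'K]]]] := source_local_homeo e.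
  exists U; first exact: open_nbhs_nbhs.
  apply: (sub_finite_set (B := [set s' w])); last exact: finite_set1.
  by move=> e' [Ue' /= <-]; rewrite s'K// inE.
Qed.

Section Additivity.
Variables (V : nmodType) (K : set (edge E)).
Hypothesis cK : compact K.
Implicit Types z : edge E -> V.

Lemma fibre_sumE z w : (forall e, ~ K e -> z e = 0) ->
  fibre_sum z w = \sum_(e <- finmap.enum_fset (fset_set (K `&` [set e | source_map e = w]))) z e.
Proof.
move=> zK; rewrite /fibre_sum -fsbig_finite; last exact: fibre_finite.
apply/esym/fsbig_widen; first exact: subIsetr.
by move=> e [/= se nK]; apply: zK => Ke; apply: nK; split.
Qed.
End Additivity.

Lemma fibre_sum_morph (V W : nmodType) (f : V -> W) (K : set (edge E)) z w :
  compact K -> (forall e, ~ K e -> z e = 0) -> f 0 = 0 -> {morph f : x y / x + y} ->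
  f (fibre_sum z w) = fibre_sum (fun e => f (z e)) w.
Proof.
move=> cK zK f0 fD; rewrite (fibre_sumE cK)// (fibre_sumE cK).
  exact: (big_morph f fD f0).
by move=> e /zK ->.
Qed.

Lemma eq_fibre_sum (V : nmodType) (z z' : edge E -> V) w :
  (forall e, source_map e = w -> z e = z' e) -> fibre_sum z w = fibre_sum z' w.
Proof. by move=> zz'; apply: eq_fsbigr => e; rewrite inE; exact: zz'. Qed.

Section RealSums.
Variable K : set (edge E).
Hypothesis cK : compact K.
Implicit Types z : edge E -> R.

Lemma fibre_sumD z z' w : supp_in z K -> supp_in z' K ->
  fibre_sum (fun e => z e + z' e) w = fibre_sum z w + fibre_sum z' w.
Proof.
move=> zK zK'; rewrite !(fibre_sumE cK)// ?big_split//.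
by move=> e nK; rewrite zK// zK'// addr0.
Qed.

Lemma fibre_sumZ c z w : supp_in z K ->
  fibre_sum (fun e => c * z e) w = c * fibre_sum z w.
Proof.
move=> zK; rewrite !(fibre_sumE cK)// ?mulr_sumr//.
by move=> e nK; rewrite zK// mulr0.
Qed.

Lemma fibre_sum_ge0 z w : supp_in z K -> (forall e, 0 <= z e) -> 0 <= fibre_sum z w.
Proof. by move=> zK z0; rewrite (fibre_sumE cK)//; exact: sumr_ge0. Qed.

Lemma fibre_sum_ge z e : supp_in z K -> (forall e, 0 <= z e) ->
  z e <= fibre_sum z (source_map e).
Proof.
move=> zK z0; have [Ke|nK] := pselect (K e); last first.
  by rewrite zK//; exact: fibre_sum_ge0.
rewrite (fibre_sumE cK)// (bigD1_seq e)/=; first by rewrite lerDl sumr_ge0.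
  by apply: eq_trans (in_fset_set (fibre_finite (source_map e) cK) e) _; apply/mem_set.
exact: finmap.fset_uniq.
Qed.
End RealSums.

Lemma fibre_sum0 (V : nmodType) (w : vertex E) : fibre_sum (fun=> 0 : V) w = 0.
Proof. by rewrite /fibre_sum fsbig1. Qed.

(** Fibre sums of compactly supported functions are continuous because [s] is a
    local homeomorphism: on a piece supported in a sheet the sum has at most one term,
    and vanishes off the closed image of the support. *)
Lemma ct_fibre_sum (Q : topologicalType) (K : set (edge E)) (z : edge E * Q -> R) :
  compact K -> continuous z -> (forall e q, ~ K e -> z (e, q) = 0) ->
  continuous (fun p : vertex E * Q => fibre_sum (fun e => z (e, p.2)) p.1).
Proof.
move: z => z0 cK.
pose P (A : set (edge E)) := exists u : edge E -> R, [/\ continuous u,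
  forall e, A e -> u e = 1 &
  forall z : edge E * Q -> R, continuous z -> (forall e q, ~ K e -> z (e, q) = 0) ->
    continuous (fun p : vertex E * Q => fibre_sum (fun e => u e * z (e, p.2)) p.1)].
have [u [cu uK Hu]] : P K.
  apply: compact_ind => //.
  - exists (fun=> 0); split=> //; first exact: ct_cst.
    move=> z _ _; have -> : (fun p : vertex E * Q =>
        fibre_sum (fun e => 0 * z (e, p.2)) p.1) = (fun=> 0).
      apply/funext => p; rewrite -[RHS](fibre_sum0 _ p.1); apply: eq_fibre_sum => e _.
      by rewrite mul0r.
    exact: ct_cst.
  - move=> A B [u [cu uA Hu]] [v [cv vB Hv]].
    have c1u : continuous (fun e => 1 - u e) by apply: ct_sub => //; exact: ct_cst.
    exists (fun e => u e + (1 - u e) * v e); split.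
    + by apply: ct_add => //; exact: ct_mul.
    + by move=> e [/uA ->|/vB ->]; ring.
    + move=> z cz zK.
      have cz' : continuous (fun p : edge E * Q => (1 - u p.1) * z p).
        by apply: ct_mul => //; apply: (ct_comp (f := fun p : edge E * Q => p.1) c1u); ct.
      have zK' e q : ~ K e -> (1 - u e) * z (e, q) = 0 by move=> /zK ->; rewrite mulr0.
      apply: ct_ext (ct_add (Hu z cz zK) (Hv _ cz' zK')) _ => p /=.
      rewrite -(fibre_sumD cK).
      * by apply: eq_fibre_sum => e _; ring.
      * by move=> e /zK ->; rewrite mulr0.
      * by move=> e /zK ->; rewrite !mulr0.
  - by move=> A B AB [u [cu uB Hu]]; exists u; split=> // e /AB/uB.
  - move=> e0 _; have [U [oU Ue0 oV cU [s' [cs' s'K]]]] := source_local_homeo e0.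
    have [u [cu _ u1 [D [cD DU uD]]]] := bump_nbhd R lchE oU Ue0.
    exists [set e | u e = 1] => //; exists u; split=> // z cz zK.
    move=> [w0 q0].
    have Ds : closed (@source_map E @` D).
      apply: compact_closed; first exact: vertex_hausdorff.
      by apply: compact_image => //; exact: ct_source.
    have [Vw|nVw] := pselect ((@source_map E @` U) w0); last first.
      have near0 : \forall p \near (w0, q0), 0 = fibre_sum (fun e => u e * z (e, p.2)) p.1.
        have : \forall w \near w0, (~` (@source_map E @` D)) w.
          apply: open_nbhs_nbhs; split; first exact: closed_openC.
          by move=> [e De se]; apply: nVw; exists e => //; exact: DU.
        move=> H; have H' : \forall p \near (w0, q0), (~` (@source_map E @` D)) p.1.
          exact: (@ct_fst (vertex E) Q (w0, q0) _ H).
        apply: filterS H' => -[w q] /= nw; rewrite -(fibre_sum0 _ w).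
        apply: eq_fibre_sum => e se; rewrite uD ?mul0r// => De.
        by apply: nw; exists e.
      have e0' := nbhs_singleton near0; rewrite /continuous_at -e0'.
      by apply: cvg_near_cst; apply: filterS near0.
    have cs'w : {for w0, continuous s'}.
      move: cs'; rewrite continuous_open_subspace// => /(_ w0); apply.
      by rewrite inE.
    have near1 : \forall p \near (w0, q0),
        u (s' p.1) * z (s' p.1, p.2) = fibre_sum (fun e => u e * z (e, p.2)) p.1.
      have : \forall w \near w0, (@source_map E @` U) w by exact: open_nbhs_nbhs.
      move=> H; have H' : \forall p \near (w0, q0), (@source_map E @` U) p.1.
        exact: (@ct_fst (vertex E) Q (w0, q0) _ H).
      apply: filterS H' => -[w q] /= [e Ue <-]; rewrite s'K ?inE//.
      rewrite /fibre_sum -(fsbig_widen [set e]).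
      + by rewrite fsbig_set1.
      + by move=> e' ->.
      + move=> e' /= [se' ne']; rewrite uD ?mul0r// => De'; apply: ne'.
        by rewrite /= -(s'K e) ?inE// -(s'K e') ?inE// ?se'//; exact: DU.
    have c1 : {for (w0, q0), continuous (fun p : vertex E * Q => s' p.1)}.
      apply: continuous_comp; first exact: ct_fst.
      exact: cs'w.
    have c2 : {for (w0, q0), continuous (fun p : vertex E * Q => u (s' p.1) * z (s' p.1, p.2))}.
      apply: cvgM.
        by apply: (@continuous_comp _ _ _ (fun p : vertex E * Q => s' p.1) u) => //; exact: cu.
      apply: (@continuous_comp _ _ _ (fun p : vertex E * Q => (s' p.1, p.2)) z); last exact: cz.
      have c3 := @ct_snd (vertex E) Q (w0, q0).
      exact: (cvg_pair c1 c3).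
    rewrite /continuous_at -(nbhs_singleton near1).
    move: c2; rewrite /continuous_at /=; apply: cvg_trans.
    by apply: near_eq_cvg; apply: filterS near1 => p ->.
move=> cz zK; apply: ct_ext (Hu z0 cz zK) _ => p /=.
apply: eq_fibre_sum => e _; have [Ke|nK] := pselect (K e); first by rewrite uK// mul1r.
by rewrite zK// mulr0.
Qed.
End FibreSum.

Section FibreFunctional.
Variables (R : realType) (G : topologicalGroupType).
Hypotheses (hausG : hausdorff_space G) (lcG : locally_compact [set: G]).
Variables (mu : {measure set (borel G) -> \bar R}) (haar : left_haar mu).
Variables (Delta : G -> R) (modular : modular_function mu Delta).
Variables (E : topologicalGraph) (a : graphAction G E).

Let lG : lch G. Proof. by []. Qed.
Let lchV : lch (vertex E).
Proof. by split; [exact: vertex_locally_compact|exact: vertex_hausdorff]. Qed.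
Let lchE : lch (edge E).
Proof. by split; [exact: edge_locally_compact|exact: edge_hausdorff]. Qed.
Let hintP := hint_posfun hausG haar.

Lemma ct_act (X Y : topologicalType) (act : continuousAction G X) (f : Y -> G) (g : Y -> X) :
  continuous f -> continuous g -> continuous (fun y => act (f y) (g y)).
Proof.
move=> cf cg; apply: (@ct_comp _ _ _ (fun y => (f y, g y)) (fun p : G * X => act p.1 p.2)).
  exact: gact_continuous.
exact: ct_pair.
Qed.

Lemma gactVK (X : topologicalType) (act : continuousAction G X) g : cancel (act g) (act (g^-1)%g).
Proof. by move=> x; rewrite -gactM mulVg gact1. Qed.

Lemma gactKV (X : topologicalType) (act : continuousAction G X) g : cancel (act (g^-1)%g) (act g).
Proof. by move=> x; rewrite -gactM mulgV gact1. Qed.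

(** The integrand of [y_inner] and of [fibre_int]. *)
Lemma ct_fibre_param (Q : topologicalType) (K : set (edge E)) (H : edge E * (G * Q) -> R) :
  compact K -> continuous H -> (forall e p, ~ K e -> H (e, p) = 0) ->
  continuous (fun p : (vertex E * Q) * G =>
    fibre_sum (fun e => H (e, (p.2, p.1.2))) (vact a p.2 p.1.1)).
Proof.
move=> cK cH HK.
apply: (@ct_comp _ _ _
  (fun p : (vertex E * Q) * G => (vact a p.2 p.1.1, (p.2, p.1.2)))
  (fun p : vertex E * (G * Q) => fibre_sum (fun e => H (e, p.2)) p.1)).
  exact: ct_fibre_sum cK cH HK.
by apply: ct_pair; [apply: ct_act; ct|ct].
Qed.

Lemma ct_fibre_int (Q : topologicalType) (K : set (edge E)) (L : set G)
    (H : edge E * (G * Q) -> R) :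
  compact K -> compact L -> continuous H ->
  (forall e h q, ~ (K e /\ L h) -> H (e, (h, q)) = 0) ->
  continuous (fun p : vertex E * Q =>
    hint mu (fun h => fibre_sum (fun e => H (e, (h, p.2))) (vact a h p.1))).
Proof.
move=> cK cL cH HKL.
apply: (pf_param (F := fun p h => fibre_sum (fun e => H (e, (h, p.2))) (vact a h p.1)) lG hintP).
  by apply: (ct_fibre_param cK) => // e [h q] nK; apply: HKL => -[].
move=> p0; exists L => //; near=> p => h nL.
rewrite -(fibre_sum0 R (vact a h p.1)); apply: eq_fibre_sum => e _.
by apply: HKL => -[].
Unshelve. all: by end_near. Qed.

(** The projection to [G] of the set of pairs [(e, h)] with [s(e) = h v] is a local
    homeomorphism, as a pullback of [s]; this is integration against the lift of
    Haar measure. *)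
Definition fibre_int (v : vertex E) (H : edge E * G -> R) : R :=
  hint mu (fun h => fibre_sum (fun e => H (e, h)) (vact a h v)).

Lemma ccr_fibre (H : edge E * G -> R) v : ccr H ->
  ccr (fun h => fibre_sum (fun e => H (e, h)) (vact a h v)).
Proof.
move=> [cH [K cK HK]]; split.
  have cKe : compact (fst @` K) by apply: compact_image => //; exact: ct_fst.
  have := ct_fibre_sum cKe cH (fun e q n => HK _ (fun k => n (ex_intro2 _ _ (e, q) k erefl))).
  move=> /(ct_comp (f := fun h : G => (vact a h v, h))) /=; apply.
  by apply: ct_pair; [apply: ct_act; ct|ct].
exists (snd @` K); first by apply: compact_image => //; exact: ct_snd.
move=> h nh; rewrite -(fibre_sum0 R (vact a h v)); apply: eq_fibre_sum => e _.
by apply: HK => Keh; apply: nh; exists (e, h).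
Qed.

Lemma supp_slice (H : edge E * G -> R) (K : set (edge E * G)) h :
  supp_in H K -> supp_in (fun e => H (e, h)) (fst @` K).
Proof. by move=> HK e ne; apply: HK => Keh; apply: ne; exists (e, h). Qed.

Lemma fibre_int_posfun v : posfun (fibre_int v).
Proof.
split.
- move=> H H' cH cH'; rewrite /fibre_int -(pfD hintP); [|exact: ccr_fibre..].
  congr hint; apply/funext => h.
  have [_ [K cK HK]] := cH; have [_ [K' cK' HK']] := cH'.
  apply: (@fibre_sumD _ _ (fst @` K `|` fst @` K')).
  + by apply: compactU; apply: compact_image => //; exact: ct_fst.
  + by move=> e /not_orP[n _]; exact: (@supp_slice H K h HK e n).
  + by move=> e /not_orP[_ n]; exact: (@supp_slice H' K' h HK' e n).
- move=> c H cH; rewrite /fibre_int -(pfZ hintP); last exact: ccr_fibre.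
  congr hint; apply/funext => h; have [_ [K cK HK]] := cH.
  apply: (@fibre_sumZ _ _ (fst @` K)); last exact: supp_slice.
  by apply: compact_image => //; exact: ct_fst.
- move=> H cH H0; apply: (pf_ge0 hintP); first exact: ccr_fibre.
  move=> h; have [_ [K cK HK]] := cH; apply: (@fibre_sum_ge0 _ _ (fst @` K)) => //.
    by apply: compact_image => //; exact: ct_fst.
  exact: supp_slice.
Qed.

Lemma ct_fibre_int_base (H : edge E * G -> R) : ccr H -> continuous (fun v => fibre_int v H).
Proof.
move=> [cH [K cK HK]].
have cKe : compact (fst @` K) by apply: compact_image => //; exact: ct_fst.
have cKg : compact (snd @` K) by apply: compact_image => //; exact: ct_snd.
have := @ct_fibre_int (vertex E) (fst @` K) (snd @` K) (fun p => H (p.1, p.2.1)) cKe cKg.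
move=> /(_ _ _)/(ct_comp (f := fun v => (v, v))); apply; [| |by ct].
  by apply: ct_comp => //; ct.
move=> e h q n; apply: HK => k; apply: n; split; [by exists (e, h)|by exists (e, h)].
Qed.

(** Replacing [h] by [h x^-1] turns the condition [s(e) = h v] into
    [s(e) = h (x^-1 v)]. *)
Lemma fibre_int_right x v (H : edge E * G -> R) : ccr H ->
  fibre_int v (fun p => H (p.1, (p.2 * x)%g)) = (Delta x)^-1 * fibre_int (vact a (x^-1)%g v) H.
Proof.
move=> cH; rewrite /fibre_int -(hint_right hausG haar modular x); last exact: ccr_fibre.
congr hint; apply/funext => h /=.
by rewrite -gactM -mulgA mulgV mulg1.
Qed.

Lemma eq_fibre_int v (H H' : edge E * G -> R) :
  (forall e h, source_map e = vact a h v -> H (e, h) = H' (e, h)) ->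
  fibre_int v H = fibre_int v H'.
Proof.
move=> HH'; congr hint; apply/funext => h; apply: eq_fibre_sum => e se.
exact: HH'.
Qed.

Lemma fibre_int_gt0 v (H : edge E * G -> R) e h : ccr H -> (forall p, 0 <= H p) ->
  source_map e = vact a h v -> 0 < H (e, h) -> 0 < fibre_int v H.
Proof.
move=> cH H0 se Heh.
have [_ [K cK HK]] := cH.
have cKe : compact (fst @` K) by apply: compact_image => //; exact: ct_fst.
apply: (hint_gt0 hausG haar (x := h)); first exact: ccr_fibre.
  move=> h'; apply: (fibre_sum_ge0 cKe) => //; exact: supp_slice.
apply: (lt_le_trans Heh); rewrite -se.
apply: (@fibre_sum_ge _ _ _ cKe (fun e => H (e, h))) => //.
exact: supp_slice.
Qed.
End FibreFunctional.

(** * A functional carried by a stabilizer *)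

Section StabilizerFunctional.
Variables (R : realType) (G : topologicalGroupType).
Hypotheses (hausG : hausdorff_space G) (lcG : locally_compact [set: G]).
Variables (mu : {measure set (borel G) -> \bar R}) (haar : left_haar mu).
Variables (Delta : G -> R) (modular : modular_function mu Delta).
Variables (X : topologicalType) (act : continuousAction G X) (v : X).
Hypothesis lX : lch X.

Let lG : lch G. Proof. by []. Qed.
Let hintP := hint_posfun hausG haar.

Implicit Types (A : X -> R) (f g : G -> R).

Let S := [set s : G | act s v = v].

Definition orbit_int (A : X -> R) (f : G -> R) := hint mu (fun h => A (act h v) * f h).

Let ctorb : continuous (fun h : G => act h v). Proof. by apply: ct_act; ct. Qed.

Let ccA A f : continuous A -> ccr f -> ccr (fun h => A (act h v) * f h).
Proof. by move=> cA; apply: ccr_mull; exact: ct_comp. Qed.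

Let bumpA (N : set X) (A : X -> R) :=
  [/\ continuous A, forall x, 0 <= A x, 0 < A v & supp_in A N].

Let orbitP A : continuous A -> (forall x, 0 <= A x) -> posfun (orbit_int A).
Proof.
move=> cA A0; split.
- move=> f g cf cg; rewrite /orbit_int -(pfD hintP); [|exact: ccA..].
  by congr hint; apply/funext => h; rewrite mulrDr.
- move=> c f cf; rewrite /orbit_int -(pfZ hintP); last exact: ccA.
  by congr hint; apply/funext => h; rewrite mulrCA.
- by move=> f cf f0; apply: (pf_ge0 hintP); [exact: ccA|move=> h; exact: mulr_ge0].
Qed.

Let orbit_right A f s : continuous A -> ccr f -> S s ->
  orbit_int A (fun h => f (h * s)%g) = (Delta s)^-1 * orbit_int A f.
Proof.
move=> cA cf Ss; rewrite /orbit_int -(hint_right hausG haar modular s); last exact: ccA.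
by congr hint; apply/funext => h; rewrite gactM Ss.
Qed.

Let closedS : closed S.
Proof.
apply: (@preimage_closed _ _ (fun h : G => act h v) [set v]) => [h _|].
  exact: ctorb.
by apply: compact_closed; [exact: lX.2|exact: compact_set1].
Qed.

(** Compact sets of group elements missing the stabilizer move [v] out of some
    neighbourhood of [v]. *)
Let away (L : set G) : compact L -> L `&` S = set0 ->
  exists N : set X, [/\ open N, N v & forall h, L h -> ~ N (act h v)].
Proof.
move=> cL LS; exists (~` ((fun h : G => act h v) @` L)); split.
- apply: closed_openC; apply: compact_closed; first exact: lX.2.
  exact: compact_image.
- by move=> [h Lh hv]; have : (L `&` S) h by []; rewrite LS.
- by move=> h Lh; apply; exists h.
Qed.

(** A positive function that does not vanish on the stabilizer dominates, near
    the stabilizer, any other one up to right translations by stabilizer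
    elements, which merely scale the functional. *)
Let compare f g s0 : ccr f -> (forall h, 0 <= f h) -> S s0 -> 0 < f s0 -> ccr g ->
  exists C N, [/\ 0 <= C, open N, N v &
    forall A, bumpA N A -> `|orbit_int A g| <= C * orbit_int A f].
Proof.
move=> cf f0 Ss0 fs0 cg; have [ctg [L cL gL]] := cg.
pose P (B : set G) := exists (Q : G -> R) (W : set G) (c : R),
  [/\ ccr Q, forall h, 0 <= Q h, open W /\ B `<=` W, forall h, W h -> 1 <= Q h
    & 0 <= c /\ forall A, continuous A -> (forall x, 0 <= A x) ->
        orbit_int A Q = c * orbit_int A f].
have [Q [W [c [cQ Q0 [oO LO] OQ [c0 Qf]]]]] : P (L `&` S).
  apply: compact_ind.
  - by apply: compact_closedI.
  - exists (fun=> 0), set0, 0; split=> //.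
    + by split; [exact: ct_cst|exists set0 => //; exact: compact0].
    + by split=> //; exact: open0.
    + split=> // A cA A0; rewrite mul0r /orbit_int -[RHS](pf0 hintP); congr hint.
      by apply/funext => h; rewrite mulr0.
  - move=> B B' [Q [W [c [cQ Q0 [oO BO] OQ [c0 Qf]]]]] [Q' [W' [c' [cQ' Q0' [oO' BO'] OQ' [c0' Qf']]]]].
    exists (fun h => Q h + Q' h), (W `|` W'), (c + c'); split=> //.
    + exact: ccr_add.
    + by move=> h; exact: addr_ge0.
    + by split; [exact: openU|exact: setUSS].
    + by move=> h [/OQ|/OQ'] k; apply: (le_trans k); rewrite ?lerDl ?lerDr.
    + split; first exact: addr_ge0.
      by move=> A cA A0; rewrite (pfD (orbitP cA A0))// Qf// Qf'// mulrDl.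
  - by move=> B B' BB [Q [W [c [cQ Q0 [oO BO] OQ [c0 Qf]]]]]; exists Q, W, c; split=> //; split=> // h /BB/BO.
  - move=> s [Ls Ss].
    have cf' := ccr_transr (s^-1 * s0)%g cf.
    pose Q h := (2 / f s0) * f (h * (s^-1 * s0))%g.
    have cQ : ccr Q by exact: ccr_scale.
    have Qs : Q s = 2 by rewrite /Q mulgA mulgV mul1g divfK// gt_eqF.
    have oQ : open [set h | 1 < Q h] by apply: open_gtf; exact: cQ.1.
    exists [set h | 1 < Q h].
      by apply: open_nbhs_nbhs; split=> //; rewrite /= Qs ltr1n.
    exists Q, [set h | 1 < Q h], (2 / f s0 * (Delta (s^-1 * s0)%g)^-1); split=> //.
    + by move=> h; rewrite /Q mulr_ge0// divr_ge0// ltW.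
    + by split.
    + by move=> h /= /ltW.
    + split; first by rewrite !mulr_ge0// invr_ge0 ltW// (Delta_gt0 modular).
      move=> A cA A0; rewrite /Q (pfZ (orbitP cA A0))// orbit_right ?mulrA//.
      by rewrite /S /= gactM Ss0 -{1}Ss -gactM mulVg gact1.
have [N [oN Nv HN]] : exists N : set X, [/\ open N, N v & forall h, (L `\` W) h -> ~ N (act h v)].
  apply: away; first by rewrite setDE; apply: compact_closedI => //; exact: open_closedC.
  by rewrite -subset0 => h [[Lh nO] Sh]; apply: nO; apply: LO.
have [M M0 gM] := ccr_bounded cg.
exists (M * c), N; split=> //; first exact: mulr_ge0.
move=> A [cA A0 Av AN]; rewrite -mulrA -Qf// -(pfZ (orbitP cA A0))//.
apply: (pf_abs hintP); [exact: ccA|by apply: ccA => //; exact: ccr_scale|].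
move=> h; rewrite normrM (ger0_norm (A0 _)).
have [Lh|/gL ->] := pselect (L h); last by rewrite normr0 mulr0 !mulr_ge0.
have [Oh|nO] := pselect (W h); last first.
  by rewrite (AN (act h v)) ?mul0r//; apply: HN; split.
apply: ler_wpM2l => //; apply: (le_trans (gM h)).
by rewrite -{1}(mulr1 M); apply: ler_wpM2l => //; exact: OQ.
Qed.

(** A substitute for Haar measure on the stabilizer of [v]: a cluster point of
    the normalised functionals [f |-> \int A(h v) f(h) dh] as [A] concentrates
    at [v]. *)
Lemma stabilizer_functional : exists m : (G -> R) -> R, [/\ posfun m,
  forall f, ccr f -> (forall s, act s v = v -> f s = 0) -> m f = 0,
  forall f s, ccr f -> act s v = v -> m (fun h => f (h * s)%g) = (Delta s)^-1 * m f &
  forall f s, ccr f -> (forall h, 0 <= f h) -> act s v = v -> 0 < f s -> 0 < m f].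
Proof.
have S1 : S 1%g by exact: gact1.
have [k [ck k01 k1]] := ccr_bump R lG (@compact_set1 _ (1%g : G)).
have k0 h : 0 <= k h by have /andP[] := k01 h.
have k1' : k 1%g = 1 by exact: k1.
have k1p : 0 < k 1%g by rewrite k1'.
have kpos N A : bumpA N A -> 0 < orbit_int A k.
  move=> [cA A0 Av _]; apply: (hint_gt0 hausG haar (x := 1%g)); first exact: ccA.
    by move=> h; exact: mulr_ge0.
  by rewrite gact1 k1' mulr1.
(* Bump functions at [v] with smaller and smaller supports. *)
pose F : set_system (X -> R) := [set D | exists N, [/\ open N, N v & forall A, bumpA N A -> D A]].
have PF : ProperFilter F.
  split.
  - move=> [N [oN Nv HN]].
    have [A [cA A01 Av [K [cK KN AK]]]] := bump_pt R lX oN Nv.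
    apply: (HN A); split=> //; first by move=> x; have /andP[] := A01 x.
      by rewrite Av.
    by move=> x nN; apply: AK => /KN.
  - split.
    + by exists setT; split=> //; exact: openT.
    + move=> D D' [N [oN Nv HN]] [N' [oN' Nv' HN']]; exists (N `&` N'); split=> //.
        exact: openI.
      move=> A [cA A0 Av AN]; split; [apply: HN|apply: HN']; split=> // x nN;
        by apply: AN => -[].
    + by move=> D D' DD' [N [oN Nv HN]]; exists N; split=> // A /HN/DD'.
have [U [UU FU]] := ultraFilterLemma PF.
pose r f A := orbit_int A f / orbit_int A k.
pose isl f a := forall e, 0 < e -> U [set A | `|r f A - a| <= e].
have FN N D : open N -> N v -> (forall A, bumpA N A -> D A) -> U D.
  by move=> oN Nv H; apply: FU; exists N.
have isl_ex f : ccr f -> exists a, isl f a.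
  move=> cf; have [C [N [C0 oN Nv HC]]] := compare ck k0 S1 (s0 := 1%g) k1p cf.
  have UC : U [set A | `|r f A| <= C].
    apply: (FN N) => // A bA; have := HC A bA; have kp := kpos _ _ bA.
    by rewrite /r /= normrM normfV (gtr0_norm kp) ler_pdivrMr.
  have [a [_ Ha]] : exists a, (`[- C, C]%classic `&` cluster (r f @ U)) a.
    apply: (@segment_compact R (- C) C).
    have HU : U (r f @^-1` `[- C, C]).
      by apply: filterS UC => A /= h; rewrite /preimage /= in_itv /= -ler_norml.
    exact: HU.
  exists a => e e0.
  have [//|nU] := in_ultra_setVsetC [set A | `|r f A - a| <= e] UU.
  have [] := Ha (~` [set x | `|x - a| <= e]) [set x | `|x - a| < e] nU.
    by have := nbhsx_ballx a e e0; apply: filterS => x; rewrite /ball /= distrC.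
  by move=> x [/= nx /ltW].
have isl_uniq f a b : isl f a -> isl f b -> a = b.
  move=> ha hb; apply/eqP; rewrite -subr_eq0 -normr_le0; apply/ler_addgt0Pl => e e0.
  rewrite addr0; have e20 : 0 < e / 2 by rewrite divr_gt0.
  have [A [/= h1 h2]] := filter_ex (filterI (ha _ e20) (hb _ e20)).
  have -> : a - b = (r f A - b) - (r f A - a) by ring.
  by rewrite (splitr e) (le_trans (ler_normB _ _))// lerD.
(* Along the ultrafilter every ratio has a unique limit. *)
pose m f := xget 0 [set a | isl f a].
have mP f : ccr f -> isl f (m f).
  by move=> /isl_ex [a ha]; rewrite /m; case: xgetP => [b -> //|/(_ a)].
have mE f a : ccr f -> isl f a -> m f = a by move=> /mP; exact: isl_uniq.
have bumpU : U [set A | exists N, bumpA N A].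
  by apply: (FN setT) => //; [exact: openT|move=> A bA; exists setT].
exists m; split.
- split.
  + move=> f g cf cg; apply: mE; first exact: ccr_add.
    move=> e e0; have e20 : 0 < e / 2 by rewrite divr_gt0.
    apply: filterS (filterI bumpU (filterI (mP f cf _ e20) (mP g cg _ e20))).
    move=> A [[N [cA A0 _ _]] [/= h1 h2]].
    have -> : r (fun x => f x + g x) A - (m f + m g) = (r f A - m f) + (r g A - m g).
      by rewrite /r (pfD (orbitP cA A0))// mulrDl; ring.
    by rewrite (splitr e) (le_trans (ler_normD _ _))// lerD.
  + move=> c f cf; apply: mE; first exact: ccr_scale.
    move=> e e0; have e20 : 0 < e / (`|c| + 1) by rewrite divr_gt0// ltr_wpDl.
    apply: filterS (filterI bumpU (mP f cf _ e20)).
    move=> A [[N [cA A0 _ _]] /= h1].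
    have -> : r (fun x => c * f x) A - c * m f = c * (r f A - m f).
      by rewrite /r (pfZ (orbitP cA A0))//; ring.
    rewrite normrM; apply: (le_trans (ler_wpM2l (normr_ge0 c) h1)).
    rewrite mulrCA; apply: ler_piMr; first exact: ltW.
    by rewrite ler_pdivrMr ?ltr_wpDl// mul1r lerDl ler01.
  + move=> f cf f0; rewrite leNgt; apply/negP => mf.
    have e0 : 0 < - m f / 2 by rewrite divr_gt0// oppr_gt0.
    have [A [[N bA] /= h]] := filter_ex (filterI bumpU (mP f cf _ e0)).
    have kp := kpos _ _ bA; have [cA A0 _ _] := bA.
    have : 0 <= r f A by apply: divr_ge0; [exact: (pf_ge0 (orbitP cA A0))|exact: ltW].
    move: h; rewrite ler_norml => /andP[_]; lra.
- move=> f cf fS; apply: mE => // e e0.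
  have [ctf [L cL fL]] := cf.
  have [g [cg g01 gL]] := ccr_bump R lG cL.
  have g0 h : 0 <= g h by have /andP[] := g01 h.
  have [C [N [C0 oN Nv HC]]] := compare ck k0 S1 (s0 := 1%g) k1p cg.
  have C1 : 0 < C + 1 by rewrite ltr_wpDl.
  pose e' := e / (C + 1).
  have e'0 : 0 < e' by rewrite divr_gt0.
  have [N' [oN' Nv' HN']] : exists N, [/\ open N, N v &
      forall h, (L `&` [set h | e' <= `|f h|]) h -> ~ N (act h v)].
    apply: away; first by apply: compact_closedI => //; apply: closed_gef; exact: ct_abs.
    rewrite -subset0 => h [[_ /= h1] Sh]; move: h1; rewrite fS// normr0 leNgt.
    by rewrite e'0.
  apply: (FN (N `&` N')) => //; first exact: openI.
  move=> A bA; have kp := kpos _ _ bA; have [cA A0 Av AN] := bA.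
  rewrite /= subr0 /r normrM normfV (gtr0_norm kp) ler_pdivrMr//.
  apply: (@le_trans _ _ (e' * orbit_int A g)).
    rewrite -(pfZ (orbitP cA A0))//; apply: (pf_abs hintP).
    - exact: ccA.
    - by apply: ccA => //; exact: ccr_scale.
    move=> h; rewrite normrM (ger0_norm (A0 _)).
    have [Lh|/fL ->] := pselect (L h); last first.
      by rewrite normr0 mulr0 mulr_ge0// mulr_ge0//; exact: ltW.
    have [fe|fe] := leP e' `|f h|.
      rewrite (AN (act h v)) ?mul0r// => -[_]; exact: HN'.
    by apply: ler_wpM2l => //; rewrite gL// mulr1 ltW.
  have : orbit_int A g <= C * orbit_int A k.
    apply: (le_trans (ler_norm _)); apply: HC; split=> // x nN.
    by apply: AN => -[].
  move=> h; apply: (le_trans (ler_wpM2l (ltW e'0) h)).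
  rewrite mulrA; apply: ler_wpM2r; first exact: ltW.
  rewrite /e' mulrAC ler_pdivrMr// ler_pM2l// lerDl ler01 //.
- move=> f s cf Ss; apply: mE; first exact: ccr_transr.
  have Ds := Delta_gt0 modular s.
  move=> e e0; have e20 : 0 < Delta s * e by rewrite mulr_gt0.
  apply: filterS (filterI bumpU (mP f cf _ e20)) => A [[N [cA A0 _ _]] /= h].
  rewrite /r orbit_right// -mulrA -mulrBr normrM normfV (gtr0_norm Ds).
  by rewrite mulrC ler_pdivrMr// (mulrC e).
- move=> f s cf f0 Ss fs.
  have [C [N [C0 oN Nv HC]]] := compare cf f0 Ss fs ck.
  have C1 : 0 < C + 1 by rewrite ltr_wpDl.
  apply: (@lt_le_trans _ _ (1 / (C + 1))); first by rewrite divr_gt0.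
  apply/ler_addgt0Pr => e e0.
  have UN : U [set A | bumpA N A] by exact: (FN N).
  have [A [/= bA h]] := filter_ex (filterI UN (mP f cf _ e0)).
  have kp := kpos _ _ bA; have [cA A0 _ _] := bA.
  have h2 := HC A bA; rewrite (gtr0_norm kp) in h2.
  have fA : 0 <= orbit_int A f by exact: (pf_ge0 (orbitP cA A0)).
  have : 1 / (C + 1) <= r f A.
    rewrite /r ler_pdivrMr// mulrAC ler_pdivlMr// mul1r (le_trans h2)//.
    by rewrite mulrC ler_wpM2l// lerDl ler01.
  move: h; rewrite ler_norml => /andP[_]; lra.
Qed.
End StabilizerFunctional.

(** * The Jacobian of a fibrewise translation *)

Section Jacobian.
Variables (R : realType) (G : topologicalGroupType).
Hypotheses (hausG : hausdorff_space G) (lcG : locally_compact [set: G]).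
Variables (mu : {measure set (borel G) -> \bar R}) (haar : left_haar mu).
Variables (Delta : G -> R) (modular : modular_function mu Delta).
Variables (E : topologicalGraph) (a : graphAction G E).

Let lG : lch G. Proof. by []. Qed.
Let lchV : lch (vertex E).
Proof. by split; [exact: vertex_locally_compact|exact: vertex_hausdorff]. Qed.
Let lchE : lch (edge E).
Proof. by split; [exact: edge_locally_compact|exact: edge_hausdorff]. Qed.
Let hintP := hint_posfun hausG haar.

Let P := (edge E * G)%type.
Let lP : lch P. Proof. exact: lch_prod. Qed.
Let L v (H : P -> R) := fibre_int mu a v H.
Let LP v : posfun (L v). Proof. exact: fibre_int_posfun. Qed.

Implicit Types (H F w : P -> R) (v : vertex E) (e : edge E).

(** Weil's formula for the right action of the stabilizer of [v]. *)
Section Weil.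
Variables (v : vertex E) (m : (G -> R) -> R).
Hypotheses (mP : posfun m)
  (m1 : forall f, ccr f -> (forall s, vact a s v = v -> f s = 0) -> m f = 0)
  (mr : forall f s, ccr f -> vact a s v = v ->
     m (fun h => f (h * s)%g) = (Delta s)^-1 * m f).

Let K1 F w (p : P * G) := F p.1 * w (p.1.1, (p.1.2 * p.2)%g).
Let K2 F w (p : P * G) := w p.1 * (F (p.1.1, (p.1.2 * p.2^-1)%g) * (Delta p.2)^-1).

(** [K1] and [K2] are the integrands of the two sides of Weil's formula, before and
    after the substitution of [h s^-1] for [h]. *)
Let ccK1 F w : ccr F -> ccr w -> ccr (K1 F w).
Proof.
move=> [cF [KF cKF FK]] [cw [Kw cKw wK]]; split.
  apply: ct_mul; first by apply: ct_comp => //; ct.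
  by apply: ct_comp => //; ct.
exists (KF `*` ((fun p : G * G => (p.1^-1 * p.2)%g) @` ((snd @` KF) `*` (snd @` Kw)))).
  apply: compact_setX => //; apply: compact_image; first by ct.
  by apply: compact_setX; apply: compact_image => //; exact: ct_snd.
move=> [[e h] s] /= n; rewrite /K1 /=.
have [KFp|/FK ->] := pselect (KF (e, h)); last by rewrite mul0r.
have [Kwp|/wK ->] := pselect (Kw (e, (h * s)%g)); last by rewrite mulr0.
exfalso; apply: n; split => //=; exists (h, (h * s)%g) => /=.
  by split; [exists (e, h)|exists (e, (h * s)%g)].
by rewrite mulgA mulVg mul1g.
Qed.

Let ccK2 F w : ccr F -> ccr w -> ccr (K2 F w).
Proof.
move=> [cF [KF cKF FK]] [cw [Kw cKw wK]]; split.
  apply: ct_mul; first by apply: ct_comp => //; ct.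
  apply: ct_mul; first by apply: ct_comp => //; ct.
  by apply: (ct_comp (f := fun p : P * G => p.2) (ct_DeltaV hausG haar modular)); ct.
exists (Kw `*` ((fun p : G * G => (p.1^-1 * p.2)%g) @` ((snd @` KF) `*` (snd @` Kw)))).
  apply: compact_setX => //; apply: compact_image; first by ct.
  by apply: compact_setX; apply: compact_image => //; exact: ct_snd.
move=> [[e h] s] /= n; rewrite /K2 /=.
have [Kwp|/wK ->] := pselect (Kw (e, h)); last by rewrite mul0r.
have [KFp|/FK ->] := pselect (KF (e, (h * s^-1)%g)); last by rewrite mul0r mulr0.
exfalso; apply: n; split => //=; exists ((h * s^-1)%g, h) => /=.
  by split; [exists (e, (h * s^-1)%g)|exists (e, h)].
by rewrite invgM invgK -mulgA mulVg mulg1.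
Qed.

Let ccr_orb F e h : ccr F -> ccr (fun s => F (e, (h * s)%g)).
Proof. by move=> cF; exact: (ccr_transl h (ccr_slice e cF)). Qed.

Let ccr_orbV F e h : ccr F -> ccr (fun s => F (e, (h * s^-1)%g) * (Delta s)^-1).
Proof.
move=> cF; apply: ccr_mulr; first exact: (ct_DeltaV hausG haar modular).
exact: (ccr_inv (ccr_orb e h cF)).
Qed.

Let weil F w : ccr F -> ccr w ->
  L v (fun p => F p * m (fun s => w (p.1, (p.2 * s)%g))) =
  L v (fun p => w p * m (fun s => F (p.1, (p.2 * s^-1)%g) * (Delta s)^-1)).
Proof.
move=> cF cw.
have -> : (fun p => F p * m (fun s => w (p.1, (p.2 * s)%g))) =
    (fun p => m (fun s => K1 F w (p, s))).
  by apply/funext => -[e h]; rewrite -(pfZ mP)//; exact: ccr_orb.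
have -> : (fun p => w p * m (fun s => F (p.1, (p.2 * s^-1)%g) * (Delta s)^-1)) =
    (fun p => m (fun s => K2 F w (p, s))).
  by apply/funext => -[e h]; rewrite -(pfZ mP)//; exact: ccr_orbV.
rewrite (pf_fubini lP lG (LP v) mP (ccK1 cF cw)).
rewrite (pf_fubini lP lG (LP v) mP (ccK2 cF cw)).
have c1 := ccr_pfl lP (LP v) (ccK1 cF cw).
have c2 := ccr_pfl lP (LP v) (ccK2 cF cw).
apply/eqP; rewrite -subr_eq0 -(pfB mP)//; apply/eqP; apply: m1.
  exact: ccr_sub.
move=> s sv.
have cc3 : ccr (fun p : P => F (p.1, (p.2 * s^-1)%g) * w p).
  apply: ccr_mull => //; apply: ct_comp; first exact: cF.1.
  by ct.
have := @fibre_int_right R G hausG mu haar Delta modular E a s v _ cc3.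
have -> : vact a (s^-1)%g v = v by rewrite -{1}sv -gactM mulVg gact1.
have -> : (fun p : P => F ((p.1, (p.2 * s)%g).1, ((p.1, (p.2 * s)%g).2 * s^-1)%g) *
   w (p.1, (p.2 * s)%g)) = (fun p => K1 F w (p, s)).
  by apply/funext => -[e h]; rewrite /K1 /= -mulgA mulgV mulg1.
rewrite -/(L v _) => ->; apply/eqP; rewrite subr_eq0; apply/eqP.
rewrite -(pfZ (LP v))//; congr (L v _); apply/funext => -[e h].
by rewrite /K2 /=; ring.
Qed.

Variable t : edge E -> G.
Hypotheses (ctt : continuous t)
  (tS : forall e, vact a (t e) (source_map e) = source_map e).

(** On the fibre over [v] the element [t(e) h] equals [h k] with [k = h^-1 t(e) h] in
    the stabilizer of [v], and the inner integral of [F] provided by Weil's formula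
    is invariant under such translations. *)
Lemma weil_twist F w : ccr F -> ccr w ->
  L v (fun p => F (p.1, (t p.1 * p.2)%g) * m (fun s => w (p.1, (p.2 * s)%g))) =
  L v (fun p => F p * m (fun s => w (p.1, (p.2 * s)%g))).
Proof.
move=> cF cw.
have cFT : ccr (fun p : P => F (p.1, (t p.1 * p.2)%g)).
  have ctp : continuous (fun p : P => t p.1) by apply: ct_comp => //; ct.
  apply: (@ccr_homeo R P P (fun p => (p.1, (t p.1 * p.2)%g)) (fun p => (p.1, ((t p.1)^-1 * p.2)%g))) => //.
  - by ct.
  - by ct.
  - by move=> [e h] /=; rewrite mulgA mulVg mul1g.
  - by move=> [e h] /=; rewrite mulgA mulgV mul1g.
rewrite (weil cFT cw) (weil cF cw); apply: eq_fibre_int => e h seh /=.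
congr (_ * _).
pose k := (h^-1 * t e * h)%g.
have Sk : vact a k v = v.
  by rewrite /k !gactM -seh tS seh -gactM mulVg gact1.
have SkV : vact a (k^-1)%g v = v by rewrite -{1}Sk -gactM mulVg gact1.
have Dk := Delta_gt0 modular k.
have cq := ccr_orbV e h cF.
have := mr cq SkV; rewrite (DeltaV hausG haar modular) invrK => H.
apply: (mulfI (lt0r_neq0 Dk)); rewrite -H -(pfZ mP); last first.
  by have := ccr_orbV e h cFT.
congr m; apply/funext => s /=.
rewrite (DeltaM hausG haar modular) (DeltaV hausG haar modular) invfM invrK invgM invgK.
have -> : (h * (k * s^-1))%g = (t e * (h * s^-1))%g.
  by rewrite /k !mulgA mulgV mul1g.
by ring.
Qed.
End Weil.

Variable t : edge E -> G.
Hypotheses (ctt : continuous t)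
  (tS : forall e, vact a (t e) (source_map e) = source_map e).

Let T (p : P) : P := (p.1, (t p.1 * p.2)%g).
Let T' (p : P) : P := (p.1, ((t p.1)^-1 * p.2)%g).

Let ctp : continuous (fun p : P => t p.1). Proof. by apply: ct_comp => //; ct. Qed.
Let ctT : continuous T. Proof. by rewrite /T; ct. Qed.
Let ctT' : continuous T'. Proof. by rewrite /T'; ct. Qed.
Let TK : cancel T T'. Proof. by move=> [e h]; rewrite /T /T' /= mulgA mulVg mul1g. Qed.
Let T'K : cancel T' T. Proof. by move=> [e h]; rewrite /T /T' /= mulgA mulgV mul1g. Qed.
Let ccrT H : ccr H -> ccr (fun p => H (T p)).
Proof. exact: (ccr_homeo ctT ctT' TK T'K). Qed.

(* [W / (W \o T^-1)] is a density; the maximum with a lower bound [c] of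
   the denominator on [K] makes it globally continuous. *)
Let density_ex v (K : set P) : compact K -> exists q : P -> R, [/\ continuous q,
  forall p, K p -> 0 < q p &
  forall H, ccr H -> supp_in H K -> L v (fun p => H (T p)) = L v (fun p => H p * q p)].
Proof.
move=> cK.
have [m [mP m1 mr m2]] := stabilizer_functional hausG lcG haar modular (vact a) v lchV.
have cKT : compact (K `|` T' @` K) by apply: compactU => //; exact: compact_image.
have [w [cw w01 wK]] := ccr_bump R lP cKT.
have w0 p : 0 <= w p by have /andP[] := w01 p.
pose W p := m (fun s => w (p.1, (p.2 * s)%g)).
have ccw e h : ccr (fun s => w (e, (h * s)%g)) by exact: (ccr_transl h (ccr_slice e cw)).
have W0 p : 0 <= W p by apply: (pf_ge0 mP) => //; exact: ccw.
have Wpos p : (K `|` T' @` K) p -> 0 < W p.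
  case: p => e h Kp; apply: (m2 _ 1%g); [exact: ccw|by []|exact: gact1|].
  by rewrite mulg1 wK.
have cW : continuous W.
  have [ctw [Kw cKw wKw]] := cw.
  apply: (pf_param (F := fun p s => w (p.1, (p.2 * s)%g)) lG mP).
    by apply: (ct_comp (f := fun q : P * G => (q.1.1, (q.1.2 * q.2)%g)) ctw); ct.
  move=> p0; have [N [cN _ pN]] := lch_nbhs p0.2 lG.
  exists ((fun p : G * G => (p.1^-1 * p.2)%g) @` (N `*` (snd @` Kw))).
    apply: compact_image; first by ct.
    by apply: compact_setX => //; apply: compact_image => //; exact: ct_snd.
  have : \forall p \near p0, N p.2 by exact: (@ct_snd (edge E) G p0 _ pN).
  apply: filterS => p Np s n; apply: wKw => Kws; apply: n.
  exists (p.2, (p.2 * s)%g); last by rewrite /= mulgA mulVg mul1g.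
  by split=> //=; exists (p.1, (p.2 * s)%g).
have cWT : continuous (fun p => W (T' p)) by exact: ct_comp.
have [c c0 Kc] : exists2 c, 0 < c & forall p, K p -> c <= W (T' p).
  apply: (@compact_ind P K (fun B => exists2 c, 0 < c & forall p, B p -> c <= W (T' p))) => //.
  - by exists 1.
  - move=> B B' [c c0 Bc] [c' c0' Bc']; exists (Num.min c c'); first by rewrite lt_min c0.
    by move=> p [/Bc|/Bc'] k; rewrite ge_min k ?orbT.
  - by move=> B B' BB [c c0 Bc]; exists c => // p /BB/Bc.
  - move=> p Kp; have Wp : 0 < W (T' p) by apply: Wpos; right; exists p.
    exists [set p' | W (T' p) / 2 < W (T' p')].
      apply: open_nbhs_nbhs; split; first exact: open_gtf.
      by rewrite /= ltr_pdivrMr// ltr_pMr// ltr1n.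
    exists (W (T' p) / 2); first by rewrite divr_gt0.
    by move=> p' /= /ltW.
pose g p := Num.max (W (T' p)) c.
have g0 p : 0 < g p by rewrite /g lt_max c0 orbT.
have cg : continuous g by apply: ct_max => //; exact: ct_cst.
have cgV : continuous (fun p => (g p)^-1).
  move=> p; apply: cvgV; first by rewrite gt_eqF.
  exact: cg.
exists (fun p => W p / g p); split.
- exact: ct_mul.
- by move=> p Kp; rewrite divr_gt0//; apply: Wpos; left.
move=> H cH HK.
have cF : ccr (fun p => H p / g p) by exact: ccr_mulr.
have := weil_twist mP m1 mr ctt tS cF cw.
have -> : (fun p => H (p.1, (t p.1 * p.2)%g) / g (p.1, (t p.1 * p.2)%g) *
   m (fun s => w (p.1, (p.2 * s)%g))) = (fun p => H (T p)).
  apply/funext => p; rewrite -/(T p) -/(W p).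
  have [KTp|nK] := pselect (K (T p)); last by rewrite HK// !mul0r.
  have : g (T p) = W p.
    by have := Kc _ KTp; rewrite /g TK => /max_l.
  move=> gE; rewrite -gE divfK// gt_eqF//.
by move=> ->; congr (L v _); apply/funext => p; rewrite -/(W p); ring.
Qed.

Let over v (p : P) := source_map p.1 = vact a p.2 v.

(** [dens v p x] says that [x] is the value at [p] of the local density of the
    image of [fibre_int v] under [T]. *)
Let dens v (p : P) (x : R) := exists (q : P -> R) (U : set P),
  [/\ continuous q, open U, U p, q p = x &
    forall H, ccr H -> supp_in H U -> L v (fun p => H (T p)) = L v (fun p => H p * q p)].

(** Test both densities against a bump function times their difference. *)
Let dens_uniq v p x y : over v p -> dens v p x -> dens v p y -> x = y.
Proof.
move=> vp [q [U [cq oU Up <- qL]]] [r [V [cr oV Vp <- rL]]].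
have [b [cb b01 bp [K [cK KUV bK]]]] := bump_pt R lP (openI oU oV) (conj Up Vp).
have cqr : continuous (fun p => q p - r p) by exact: ct_sub.
have cH : ccr (fun p => b p * (q p - r p)).
  by apply: ccr_mulr => //; split=> //; exists K.
have HU : supp_in (fun p => b p * (q p - r p)) U.
  by move=> p' n; rewrite bK ?mul0r// => /KUV[].
have HV : supp_in (fun p => b p * (q p - r p)) V.
  by move=> p' n; rewrite bK ?mul0r// => /KUV[].
apply: contrapT => nqr.
have : 0 < L v (fun p => b p * (q p - r p) * (q p - r p)).
  apply: (fibre_int_gt0 hausG haar (e := p.1) (h := p.2)) => //.
  - exact: ccr_mulr.
  - by move=> p'; rewrite -mulrA mulr_ge0//; [have /andP[] := b01 p'|rewrite -expr2 sqr_ge0].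
  - rewrite -surjective_pairing bp mul1r -expr2 exprn_even_gt0//= subr_eq0.
    exact/eqP.
have -> : (fun p => b p * (q p - r p) * (q p - r p)) =
    (fun p => b p * (q p - r p) * q p - b p * (q p - r p) * r p).
  by apply/funext => p'; ring.
by rewrite (pfB (LP v)) ?qL -?qL -?rL// ?subrr ?ltxx//; exact: ccr_mulr.
Qed.

Let dens_ex v p : exists2 x, 0 < x & dens v p x.
Proof.
have [K [cK _ pK]] := lch_nbhs p lP.
have [q [cq q0 qL]] := density_ex v cK.
exists (q p); first by apply: q0; exact: nbhs_singleton.
exists q, K^°; split=> //; first exact: open_interior.
by move=> H cH HK; apply: qL => // p' nK; apply: HK => /interior_subset.
Qed.

Let ccr_right H x : ccr H -> ccr (fun p : P => H (p.1, (p.2 * x)%g)).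
Proof.
apply: (@ccr_homeo R P P (fun p => (p.1, (p.2 * x)%g)) (fun p => (p.1, (p.2 * x^-1)%g))).
- by ct.
- by ct.
- by move=> [e h] /=; rewrite -mulgA mulgV mulg1.
- by move=> [e h] /=; rewrite -mulgA mulVg mulg1.
Qed.

(** Right translations of [G] commute with [T]. *)
Let dens_right v e h x d : dens v (e, h) d -> dens (vact a x v) (e, (h * x^-1)%g) d.
Proof.
move=> [q [U [cq oU Up <- qL]]].
have cx : continuous (fun p : P => (p.1, (p.2 * x)%g)) by ct.
exists (fun p => q (p.1, (p.2 * x)%g)), ((fun p : P => (p.1, (p.2 * x)%g)) @^-1` U); split.
- exact: ct_comp.
- by apply: open_comp => // p _; exact: cx.
- by rewrite /= -mulgA mulVg mulg1.
- by rewrite /= -mulgA mulVg mulg1.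
move=> H cH HU.
pose H' (p : P) := H (p.1, (p.2 * x^-1)%g).
have cH' : ccr H' by exact: ccr_right.
have HE p : H p = H' (p.1, (p.2 * x)%g).
  by rewrite /H' /= -mulgA mulgV mulg1 -surjective_pairing.
have HU' : supp_in H' U.
  by move=> p n; apply: HU => /=; rewrite -mulgA mulVg mulg1 -surjective_pairing.
have vE : vact a (x^-1)%g (vact a x v) = v by rewrite -gactM mulVg gact1.
have cHq : ccr (fun p => H' p * q p) by exact: ccr_mulr.
have := @fibre_int_right R G hausG mu haar Delta modular E a x (vact a x v) _ (ccrT cH').
have := @fibre_int_right R G hausG mu haar Delta modular E a x (vact a x v) _ cHq.
rewrite vE -!/(L _ _) qL// => <- {}qL.
rewrite [LHS](_ : _ = L (vact a x v) (fun p => H' (T (p.1, (p.2 * x)%g)))).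
  rewrite qL; congr (L _ _); apply/funext => p; by rewrite HE.
by congr (L _ _); apply/funext => p; rewrite HE /T /= mulgA.
Qed.

Let d_ex : exists d : edge E -> R, forall e, 0 < d e /\ dens (source_map e) (e, 1%g) (d e).
Proof.
have /choice[d Hd] : forall e, exists x, 0 < x /\ dens (source_map e) (e, 1%g) x.
  by move=> e; have [x x0 xd] := dens_ex (source_map e) (e, 1%g); exists x.
by exists d.
Qed.

Variables (phi phi' : G -> edge E -> G).
Hypotheses (cphi : is_cocycle a phi) (cphi' : is_cocycle a phi').

Lemma cocycle1 (f : G -> edge E -> G) e : is_cocycle a f -> f 1%g e = 1%g.
Proof.
move=> cf; have := cocycleM cf 1%g 1%g e; rewrite mulg1 gact1 => H.
by apply: (@mulgI _ (f 1%g e)); rewrite -H mulg1.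
Qed.

Definition cocycle_act (f : G -> edge E -> G) (y : G) (p : edge E * G) : edge E * G :=
  (eact a y p.1, (f y p.1 * p.2)%g).

Lemma ct_cocycle_act f y : is_cocycle a f -> continuous (cocycle_act f y).
Proof.
move=> cf; have cc := cocycle_continuous cf.
have c1 : continuous (fun p : P => f y p.1).
  by apply: (ct_comp (f := fun p : P => (y, p.1)) cc); ct.
have c2 : continuous (fun p : P => eact a y p.1) by apply: ct_act; ct.
by rewrite /cocycle_act; ct.
Qed.

Lemma cocycle_actK f y : is_cocycle a f -> cancel (cocycle_act f y) (cocycle_act f (y^-1)%g).
Proof.
move=> cf [e h]; rewrite /cocycle_act /= -gactM mulVg gact1 mulgA -(cocycleM cf).
by rewrite mulVg cocycle1// mul1g.
Qed.

Lemma cocycle_actKV f y : is_cocycle a f -> cancel (cocycle_act f (y^-1)%g) (cocycle_act f y).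
Proof. by move=> cf; have := cocycle_actK (y^-1)%g cf; rewrite invgK. Qed.

Lemma ccr_cocycle_act f y H : is_cocycle a f -> ccr H -> ccr (fun p => H (cocycle_act f y p)).
Proof.
move=> cf cH.
apply: (@ccr_homeo R P P (cocycle_act f y) (cocycle_act f (y^-1)%g) H) => //.
- exact: ct_cocycle_act.
- exact: ct_cocycle_act.
- exact: cocycle_actK.
- exact: cocycle_actKV.
Qed.

Hypotheses
  (inv : forall v y H, ccr H -> fibre_int mu a v (fun p => H (cocycle_act phi y p)) = fibre_int mu a v H)
  (inv' : forall v y H, ccr H -> fibre_int mu a v (fun p => H (cocycle_act phi' y p)) = fibre_int mu a v H)
  (conj : forall y e, (phi' y e * t e)%g = (t (eact a y e) * phi y e)%g).

Let TA y p : cocycle_act phi' y (T p) = T (cocycle_act phi y p).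
Proof. by rewrite /cocycle_act /T /= !mulgA conj. Qed.

(** [T] intertwines the two cocycle actions, under which fibre integrals are
    invariant. *)
Let dens_act v p x y : dens v p x -> dens v (cocycle_act phi' (y^-1)%g p) x.
Proof.
move=> [q [U [cq oU Up <- qL]]].
exists (fun p => q (cocycle_act phi' y p)), (cocycle_act phi' y @^-1` U); split.
- by apply: ct_comp => //; exact: ct_cocycle_act.
- by apply: open_comp => // p' _; exact: ct_cocycle_act.
- by rewrite /= cocycle_actKV.
- by rewrite /= cocycle_actKV.
move=> H cH HU.
pose H' p := H (cocycle_act phi' (y^-1)%g p).
have cH' : ccr H' by exact: ccr_cocycle_act.
have HE p0 : H p0 = H' (cocycle_act phi' y p0) by rewrite /H' cocycle_actK.
have HU' : supp_in H' U by move=> p' n; apply: HU; rewrite /= cocycle_actKV.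
rewrite [LHS](_ : _ = L v (fun p => H' (T (cocycle_act phi y p)))).
  rewrite /L (inv v y (ccrT cH')) -/(L v _) qL// /L -(inv' v y (ccr_mulr cq cH')).
  by congr (fibre_int _ _ _ _); apply/funext => p'; rewrite HE.
by congr (L v _); apply/funext => p'; rewrite HE TA.
Qed.

(** The Jacobian of [T].  On the fibre over [v] the twist [T] translates each
    coset of the stabilizer of [v], so it rescales Haar measure by a factor that
    depends on the edge only (the quotient of the modular functions of [G] and
    of the stabilizer of [s(e)], at [t(e)]).  Invariance of the fibre integrals
    under both cocycle actions makes this factor [G]-invariant, and then
    continuous, since locally it is a quotient of two integrals. *)
Theorem fibre_jacobian : exists d : edge E -> R, [/\ continuous d, forall e, 0 < d e,
  forall y e, d (eact a y e) = d e &
  forall v H, ccr H -> fibre_int mu a v (fun p => H (p.1, (t p.1 * p.2)%g)) =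
    fibre_int mu a v (fun p => H p * d p.1)].
Proof.
have [d Hd] := d_ex.
have d0 e : 0 < d e by have [] := Hd e.
have dE v e h x : source_map e = vact a h v -> dens v (e, h) x -> x = d e.
  move=> se /(dens_right h); rewrite -se mulgV => Hx.
  by apply: (dens_uniq (v := source_map e) (p := (e, 1%g))) => //;
    [rewrite /over /= gact1|have [] := Hd e].
have dL v H : ccr H -> L v (fun p => H (T p)) = L v (fun p => H p * d p.1).
  move=> cH; have [_ [K cK HK]] := cH.
  have [C cC [U oU [KU UC]]] := ccr_nbhs lP cK.
  have [q [cq q0 qL]] := density_ex v cC.
  rewrite qL//; last by move=> p n; apply: HK => /KU/UC.
  apply: eq_fibre_int => e h seh /=.
  have [Up|nU] := pselect (U (e, h)); last by rewrite HK ?mul0r// => /KU.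
  congr (_ * _); apply: (dE v e h) => //.
  exists q, U; split=> // H' cH' HU'; apply: qL => // p n; apply: HU' => /UC.
  by [].
have dinv y e : d (eact a y e) = d e.
  have [_ /(dens_act (y^-1)%g)] := Hd e; rewrite /cocycle_act invgK /= mulg1 => /dE -> //.
  by rewrite (source_equivariant a) (cocycle_source cphi').
exists d; split=> //.
move=> e0.
have [U [oU Ue0 _ _ [s' [_ s'K]]]] := source_local_homeo e0.
have cact : continuous (fun p : G * edge E => eact a p.1 p.2) by exact: gact_continuous.
have : nbhs (1%g, e0) ((fun p : G * edge E => eact a p.1 p.2) @^-1` U).
  by apply: cact; rewrite /= gact1; exact: open_nbhs_nbhs.
case=> -[A B] [/= A1 Be0] AB.
have [b [cb b01 be0 [Kb [cKb KbU bK]]]] := bump_pt R lchE oU Ue0.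
have [k [ck k01 k1 [Kk [cKk KkA kK]]]] := bump_pt R lG (open_interior A) A1.
pose H (p : P) := b p.1 * k p.2.
have cH : ccr H by apply: ccr_tensor; [split=> //; exists Kb|split=> //; exists Kk].
have H0 p : 0 <= H p by rewrite mulr_ge0//; [have /andP[] := b01 p.1|have /andP[] := k01 p.2].
have Npos : \forall e \near e0, 0 < b e.
  by apply: open_nbhs_nbhs; split; [exact: open_gtf|rewrite /= be0].
have Lpos e : 0 < b e -> 0 < L (source_map e) H.
  move=> be; apply: (fibre_int_gt0 hausG haar (e := e) (h := 1%g)) => //.
    by rewrite gact1.
  by rewrite /H /= k1 mulr1.
have near_d : \forall e \near e0,
    L (source_map e) (fun p => H (T p)) / L (source_map e) H = d e.
  apply: filterS2 Be0 Npos => e Be be.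
  rewrite dL// [X in X / _](_ : _ = d e * L (source_map e) H).
    by rewrite mulfK// gt_eqF// Lpos.
  rewrite -(pfZ (LP _))//; apply: eq_fibre_int => e1 h se1 /=.
  rewrite mulrC; have [Kb1|/bK b1] := pselect (Kb e1); last by rewrite /H /= b1 mul0r !mulr0.
  have [Kk1|/kK k1'] := pselect (Kk h); last by rewrite /H /= k1' mulr0 !mulr0.
  have Uhe : U (eact a h e) by apply: (AB (h, e)); split=> //=; apply: interior_subset; exact: KkA.
  have -> : e1 = eact a h e; last by rewrite dinv.
  rewrite -(s'K e1) ?inE; last exact: KbU.
  by rewrite se1 -(source_equivariant a) s'K// inE.
rewrite /continuous_at -(nbhs_singleton near_d).
have c1 := ct_comp (ct_fibre_int_base hausG lcG haar (ccrT cH)) (@ct_source E).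
have c2 := ct_comp (ct_fibre_int_base hausG lcG haar cH) (@ct_source E).
have : (fun e => L (source_map e) (fun p => H (T p)) / L (source_map e) H) @ e0 -->
    L (source_map e0) (fun p => H (T p)) / L (source_map e0) H.
  apply: cvgM; first exact: c1.
  apply: cvgV; last exact: c2.
  by rewrite gt_eqF// Lpos// be0.
by apply: cvg_trans; apply: near_eq_cvg; apply: filterS near_d => e ->.
Qed.
End Jacobian.

(** * Compactly supported complex functions *)

Section ComplexValues.
Variable R : realType.
Notation Re := complex.Re.
Notation Im := complex.Im.
Section Algebra.
Implicit Types x y z : R[i].

Lemma ReD x y : Re (x + y) = Re x + Re y. Proof. by case: x; case: y. Qed.
Lemma ImD x y : Im (x + y) = Im x + Im y. Proof. by case: x; case: y. Qed.
Lemma ReN x : Re (- x) = - Re x. Proof. by case: x. Qed.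
Lemma ImN x : Im (- x) = - Im x. Proof. by case: x. Qed.
Lemma ReM x y : Re (x * y) = Re x * Re y - Im x * Im y. Proof. by case: x; case: y. Qed.
Lemma ImM x y : Im (x * y) = Re x * Im y + Im x * Re y. Proof. by case: x; case: y. Qed.
Lemma ReJ x : Re (conjc x) = Re x. Proof. by case: x. Qed.
Lemma ImJ x : Im (conjc x) = - Im x. Proof. by case: x. Qed.

Lemma complex_eq x y : Re x = Re y -> Im x = Im y -> x = y.
Proof. by case: x => a b; case: y => c d /= -> ->. Qed.

(** Norms take values in the nonnegative reals inside the complex numbers;
    [rnorm] is the same number as an element of [R]. *)
Definition rnorm (V : normedZmodType R[i]) (v : V) : R := Re `|v|.

Lemma rnormE (V : normedZmodType R[i]) (v : V) : `|v| = (rnorm v)%:C.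
Proof. by rewrite /rnorm RRe_real// ger0_real. Qed.

Lemma rnorm_ge0 (V : normedZmodType R[i]) (v : V) : 0 <= rnorm v.
Proof. by have := normr_ge0 v; rewrite rnormE ler0c. Qed.

Lemma rnormC x : rnorm x = Num.sqrt (Re x ^+ 2 + Im x ^+ 2).
Proof. by rewrite /rnorm normc_def. Qed.

Lemma ReX2_le x : `|Re x| <= rnorm x.
Proof. by rewrite rnormC -sqrtr_sqr ler_wsqrtr// lerDl sqr_ge0. Qed.

Lemma ImX2_le x : `|Im x| <= rnorm x.
Proof. by rewrite rnormC -sqrtr_sqr ler_wsqrtr// lerDr sqr_ge0. Qed.

Lemma rnorm_le x : rnorm x <= `|Re x| + `|Im x|.
Proof.
rewrite rnormC -(ger0_norm (addr_ge0 (normr_ge0 (Re x)) (normr_ge0 (Im x)))).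
rewrite -sqrtr_sqr ler_wsqrtr// sqrrD !real_normK ?num_real//.
by rewrite -addrA lerD2l lerDr mulrn_wge0// mulr_ge0.
Qed.

Lemma pos_complex (e : R[i]) : 0 < e -> exists2 r : R, 0 < r & e = r%:C.
Proof.
move=> e0; exists (Re e); last by rewrite RRe_real// gtr0_real.
by move: e0; rewrite ltcE => /andP[].
Qed.

End Algebra.

Section Topology.
Variable X : topologicalType.
Implicit Types f g : X -> R[i]^o.

Lemma ctC_epsP f : continuous f <->
  forall x (e : R), 0 < e -> \forall y \near x, rnorm (f x - f y) <= e.
Proof.
split=> [cf x e e0|H x].
  have /(@cvgrPdist_le R[i] R[i]^o) /(_ e%:C) := cf x.
  rewrite ltcR => /(_ e0); apply: filterS => y.
  by rewrite rnormE lecR.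
apply/(@cvgrPdist_le R[i] R[i]^o) => e /pos_complex[r r0 ->].
by apply: filterS (H x r r0) => y h; rewrite rnormE lecR.
Qed.

Lemma ctC_P f : continuous f <->
  continuous (fun x => Re (f x)) /\ continuous (fun x => Im (f x)).
Proof.
split=> [/ctC_epsP cf|[c1 c2]].
  split; apply: continuous_eps => x e e0; apply: filterS (cf x e e0) => y;
    apply: le_trans; rewrite distrC.
  - by rewrite -ReN -ReD; exact: ReX2_le.
  - by rewrite -ImN -ImD; exact: ImX2_le.
apply/ctC_epsP => x e e0; have e20 : 0 < e / 2 by rewrite divr_gt0.
apply: filterS2 (@continuous_near _ _ _ x _ c1 e20) (@continuous_near _ _ _ x _ c2 e20) => y.
rewrite distrC (distrC (Im _)) => h1 h2.
rewrite (le_trans (rnorm_le _))// ReD ReN ImD ImN (splitr e) lerD// ltW//.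
Qed.

Lemma ctC_mul f g : continuous f -> continuous g -> continuous (fun x => f x * g x : R[i]^o).
Proof.
move=> /ctC_P[f1 f2] /ctC_P[g1 g2]; apply/ctC_P; split.
- apply: (ct_ext (f := fun x => Re (f x) * Re (g x) - Im (f x) * Im (g x))).
    by apply: ct_sub; apply: ct_mul.
  by move=> x; rewrite ReM.
- apply: (ct_ext (f := fun x => Re (f x) * Im (g x) + Im (f x) * Re (g x))).
    by apply: ct_add; apply: ct_mul.
  by move=> x; rewrite ImM.
Qed.

Lemma ctC_conj f : continuous f -> continuous (fun x => conjc (f x) : R[i]^o).
Proof.
move=> /ctC_P[f1 f2]; apply/ctC_P; split.
- by apply: (ct_ext f1) => x; rewrite ReJ.
- by apply: (ct_ext (ct_opp f2)) => x; rewrite ImJ.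
Qed.

Lemma ctC_real (u : X -> R) : continuous u -> continuous (fun x => (u x)%:C : R[i]^o).
Proof. by move=> cu; apply/ctC_P; split => //=; exact: ct_cst. Qed.

Definition csupp_in (f : X -> R[i]) (K : set X) := forall x, ~ K x -> f x = 0.

Lemma Cc_supp f : Cc f -> exists2 K, compact K & csupp_in f K.
Proof.
move=> [cf cK]; exists (closure [set x | f x != 0]) => // x nK.
apply: contrapT => /eqP fx; apply: nK; exact: subset_closure.
Qed.

Lemma CcI f (K : set X) : hausdorff_space X -> continuous f -> compact K ->
  csupp_in f K -> Cc f.
Proof.
move=> hX cf cK fK; split=> //.
have clK := compact_closed hX cK.
apply: (subclosed_compact _ cK); first exact: closed_closure.
rewrite (closure_id K).1//; apply: closure_subset => x /= fx.
by apply: contrapT => /fK fx0; move: fx; rewrite fx0 eqxx.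
Qed.

Lemma Cc_Re f : Cc f -> ccr (fun x => Re (f x)).
Proof.
move=> cf; have [K cK fK] := Cc_supp cf; split; first by have /ctC_P[] := cf.1.
by exists K => // x /fK ->.
Qed.

Lemma Cc_Im f : Cc f -> ccr (fun x => Im (f x)).
Proof.
move=> cf; have [K cK fK] := Cc_supp cf; split; first by have /ctC_P[] := cf.1.
by exists K => // x /fK ->.
Qed.

Lemma Cc_parts f : hausdorff_space X -> ccr (fun x => Re (f x)) ->
  ccr (fun x => Im (f x)) -> Cc f.
Proof.
move=> hX [c1 [K cK fK]] [c2 [L cL fL]].
apply: (CcI (K := K `|` L)) => //; [by apply/ctC_P|exact: compactU|].
by move=> x /not_orP[/fK h1 /fL h2]; apply: complex_eq; rewrite ?h1 ?h2.
Qed.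

Lemma Cc_real (u : X -> R) : hausdorff_space X -> ccr u -> Cc (fun x => (u x)%:C : R[i]^o).
Proof.
move=> hX cu; apply: Cc_parts => //=; split; first exact: ct_cst.
by exists set0 => //; exact: compact0.
Qed.
End Topology.
End ComplexValues.

Section CcClosure.
Variables (R : realType) (G : topologicalGroupType).
Hypotheses (hausG : hausdorff_space G) (lcG : locally_compact [set: G]).
Variables (mu : {measure set (borel G) -> \bar R}) (haar : left_haar mu).
Variables (Delta : G -> R) (modular : modular_function mu Delta).
Notation Re := complex.Re.
Notation Im := complex.Im.

Let lG : lch G. Proof. by []. Qed.
Let hintP := hint_posfun hausG haar.

Lemma Cc_cintegral (X : topologicalType) (F : X -> G -> R[i]^o) (K : set X) (L : set G) :
  hausdorff_space X -> compact K -> compact L ->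
  continuous (fun p : X * G => F p.1 p.2) ->
  (forall x h, ~ L h -> F x h = 0) -> (forall x h, ~ K x -> F x h = 0) ->
  Cc (fun x => cintegral mu (F x) : R[i]^o).
Proof.
move=> hX cK cL /ctC_P[c1 c2] FL FK; apply: Cc_parts => //; split.
- apply: (pf_param (F := fun x h => Re (F x h)) lG hintP) => // x0.
  by exists L => //; near=> x => h /(FL x) ->.
- exists K => // x nK; rewrite /= -[RHS](pf0 hintP) /hint; congr Rintegral.
  by apply/funext => h; rewrite FK.
- apply: (pf_param (F := fun x h => Im (F x h)) lG hintP) => // x0.
  by exists L => //; near=> x => h /(FL x) ->.
- exists K => // x nK; rewrite /= -[RHS](pf0 hintP) /hint; congr Rintegral.
  by apply/funext => h; rewrite FK.
Unshelve. all: by end_near. Qed.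

Lemma cp_star_Cc (X : topologicalType) (act : continuousAction G X) (b : X * G -> R[i]^o) :
  hausdorff_space X -> Cc b -> Cc (cp_star Delta act b).
Proof.
move=> hX cb; have [K cK bK] := Cc_supp cb.
pose ph (p : X * G) := (act (p.2^-1)%g p.1, (p.2^-1)%g).
have cph : continuous ph by apply: ct_pair; [apply: ct_act; ct|ct].
have phK : cancel ph ph.
  by move=> [v g]; rewrite /ph /= -gactM invgK mulgV gact1.
have hXG : hausdorff_space (X * G)%type.
  move=> [x y] [x' y'] H; congr pair.
  + apply: hX => A B xA xB; have [] := H (A `*` setT) (B `*` setT).
    * by exists (A, setT); [split=> //; exact: filterT|].
    * by exists (B, setT); [split=> //; exact: filterT|].
    by move=> [a b'] [[Aa _] [Ba _]]; exists a.
  + apply: hausG => A B xA xB; have [] := H (setT `*` A) (setT `*` B).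
    * by exists (setT, A); [split=> //; exact: filterT|].
    * by exists (setT, B); [split=> //; exact: filterT|].
    by move=> [a b'] [[_ Aa] [_ Ba]]; exists b'.
apply: (CcI (K := ph @` K)) => //.
- apply: ctC_mul.
    apply: ctC_real; apply: (ct_comp (f := fun p : X * G => (p.2^-1)%g)); last by ct.
    exact: (ct_Delta hausG haar modular).
  by apply: ctC_conj; apply: (ct_comp (f := ph)) => //; exact: cb.1.
- exact: compact_image.
- move=> p n; rewrite /cp_star -/(ph p) bK ?conjc0 ?mulr0// => Kp.
  by apply: n; exists (ph p).
Qed.

Section Convolution.
Variables (X Z : topologicalType) (act : continuousAction G X) (f : Z -> X).
Hypothesis (cf : continuous f) (hZ : lch Z).

(** [cp_mul] and [y_ract] are the cases [f = id] and [f = s]. *)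
Lemma Cc_convolution (b : Z * G -> R[i]^o) (c : X * G -> R[i]^o) : Cc b -> Cc c ->
  Cc (fun p : Z * G => cintegral mu (fun h =>
    b (p.1, h) * c (act (h^-1)%g (f p.1), (h^-1 * p.2)%g)) : R[i]^o).
Proof.
move=> cb cc; have [K cK bK] := Cc_supp cb; have [K' cK' cK'0] := Cc_supp cc.
have c1 : compact (fst @` K) by apply: compact_image => //; exact: ct_fst.
have c2 : compact (snd @` K) by apply: compact_image => //; exact: ct_snd.
have c3 : compact (snd @` K') by apply: compact_image => //; exact: ct_snd.
apply: (@Cc_cintegral _ _ ((fst @` K) `*`
   ((fun q : G * G => (q.1 * q.2)%g) @` ((snd @` K) `*` (snd @` K')))) (snd @` K)).
- exact: (lch_prod hZ lG).2.
- by apply: compact_setX => //; apply: compact_image; [ct|exact: compact_setX].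
- exact: c2.
- apply: ctC_mul.
    by apply: (ct_comp (f := fun p : Z * G * G => (p.1.1, p.2)) cb.1); ct.
  apply: (ct_comp (f := fun p : Z * G * G =>
    (act (p.2^-1)%g (f p.1.1), (p.2^-1 * p.1.2)%g)) cc.1).
  by apply: ct_pair; [apply: ct_act; [ct|apply: ct_comp => //; ct]|ct].
- by move=> [z g] h n /=; rewrite bK ?mul0r// => Kz; apply: n; exists (z, h).
- move=> [z g] h n /=; have [Kz|/bK ->] := pselect (K (z, h)); last by rewrite mul0r.
  rewrite cK'0 ?mulr0// => Kx; apply: n; split => /=; first by exists (z, h).
  exists (h, (h^-1 * g)%g) => /=; last by rewrite mulgA mulgV mul1g.
  by split; [exists (z, h)|eexists; [exact: Kx|]].
Qed.
End Convolution.

Lemma cp_mul_Cc (X : topologicalType) (act : continuousAction G X) (b c : X * G -> R[i]^o) :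
  lch X -> Cc b -> Cc c -> Cc (cp_mul mu act b c).
Proof. by move=> lX; apply: (Cc_convolution act (f := id)) => //; exact: ct_id. Qed.

Variables (E : topologicalGraph) (a : graphAction G E).

Lemma lch_vertex : lch (vertex E).
Proof. by split; [exact: vertex_locally_compact|exact: vertex_hausdorff]. Qed.
Lemma lch_edge : lch (edge E).
Proof. by split; [exact: edge_locally_compact|exact: edge_hausdorff]. Qed.

Lemma y_ract_Cc (xi : edge E * G -> R[i]^o) b : Cc xi -> Cc b -> Cc (y_ract mu a xi b).
Proof.
apply: (Cc_convolution (vact a) (f := @source_map E)); last exact: lch_edge.
exact: ct_source.
Qed.

Lemma y_lact_Cc phi (b : vertex E * G -> R[i]^o) xi : is_cocycle a phi ->
  Cc b -> Cc xi -> Cc (y_lact mu a phi b xi).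
Proof.
move=> cphi cb cx; have [K cK bK] := Cc_supp cb; have [K' cK' xK'] := Cc_supp cx.
have ctphi := cocycle_continuous cphi.
have c1 : compact (fst @` K') by apply: compact_image => //; exact: ct_fst.
have c2 : compact (snd @` K) by apply: compact_image => //; exact: ct_snd.
have c3 : compact (snd @` K') by apply: compact_image => //; exact: ct_snd.
pose K1 := (fun q : G * edge E => eact a q.1 q.2) @` ((snd @` K) `*` (fst @` K')).
have cK1 : compact K1.
  by apply: compact_image; [exact: gact_continuous|exact: compact_setX].
pose th (q : (G * edge E) * G) := ((phi (q.1.1^-1)%g q.1.2)^-1 * q.2)%g.
have cth : continuous th.
  rewrite /th; apply: ct_mulg; last by ct.
  apply: ct_invg; apply: (ct_comp (f := fun q : (G * edge E) * G => ((q.1.1^-1)%g, q.1.2)) ctphi).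
  by ct.
have cK2 : compact (th @` ((snd @` K) `*` K1 `*` (snd @` K'))).
  by apply: compact_image => //; apply: compact_setX => //; exact: compact_setX.
apply: (@Cc_cintegral _ _ (K1 `*` (th @` ((snd @` K) `*` K1 `*` (snd @` K')))) (snd @` K)).
- exact: (lch_prod lch_edge lG).2.
- exact: compact_setX.
- exact: c2.
- apply: ctC_mul.
    apply: (ct_comp (f := fun p : edge E * G * G => (range_map p.1.1, p.2)) cb.1).
    by apply: ct_pair; [apply: (ct_comp (@range_continuous E)); ct|ct].
  apply: (ct_comp (f := fun p : edge E * G * G =>
    (eact a (p.2^-1)%g p.1.1, (phi (p.2^-1)%g p.1.1 * p.1.2)%g)) cx.1).
  apply: ct_pair; first by apply: ct_act; ct.
  apply: ct_mulg; last by ct.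
  by apply: (ct_comp (f := fun q : edge E * G * G => ((q.2^-1)%g, q.1.1)) ctphi); ct.
- by move=> [e g] h n /=; rewrite bK ?mul0r// => Kz; apply: n; exists (range_map e, h).
- move=> [e g] h n /=; have [Kz|/bK ->] := pselect (K (range_map e, h)); last by rewrite mul0r.
  rewrite xK' ?mulr0// => Kx; apply: n.
  have K1e : K1 e.
    exists (h, eact a (h^-1)%g e) => /=; last by rewrite gactKV.
    by split; [exists (range_map e, h)|eexists; [exact: Kx|]].
  split => //=; exists ((h, e), (phi (h^-1)%g e * g)%g); last first.
    by rewrite /th /= mulgA mulVg mul1g.
  by split; [split=> //; exists (range_map e, h)|eexists; [exact: Kx|]].
Qed.

(** Real and imaginary parts pass through the finite sums over fibres, which
    reduces continuity to the case of real functions. *)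
Lemma y_inner_Cc (xi eta : edge E * G -> R[i]^o) : Cc xi -> Cc eta ->
  Cc (y_inner mu a xi eta).
Proof.
move=> cx ce; have [K cK xK] := Cc_supp cx; have [K' cK' eK'] := Cc_supp ce.
have c1 : compact (fst @` K) by apply: compact_image => //; exact: ct_fst.
have c2 : compact (snd @` K) by apply: compact_image => //; exact: ct_snd.
have c3 : compact (snd @` K') by apply: compact_image => //; exact: ct_snd.
pose Z (e : edge E) (p : G * G) : R[i]^o := conjc (xi (e, p.1)) * eta (e, (p.1 * p.2)%g).
have ZK e p : ~ (fst @` K) e -> Z e p = 0.
  move=> n; rewrite /Z xK ?conjc0 ?mul0r// => k; apply: n; by eexists; [exact: k|].
have cZ : continuous (fun q : edge E * (G * G) => Z q.1 q.2).
  apply: ctC_mul.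
    by apply: ctC_conj; apply: (ct_comp (f := fun q : edge E * (G * G) => (q.1, q.2.1)) cx.1); ct.
  by apply: (ct_comp (f := fun q : edge E * (G * G) => (q.1, (q.2.1 * q.2.2)%g)) ce.1); ct.
pose F (p : vertex E * G) h : R[i]^o := fibre_sum (fun e => Z e (h, p.2)) (vact a h p.1).
have ReF p h : Re (F p h) = fibre_sum (fun e => Re (Z e (h, p.2))) (vact a h p.1).
  by apply: (fibre_sum_morph (f := @complex.Re R) _ c1) => // [e /ZK//|]; exact: ReD.
have ImF p h : Im (F p h) = fibre_sum (fun e => Im (Z e (h, p.2))) (vact a h p.1).
  by apply: (fibre_sum_morph (f := @complex.Im R) _ c1) => // [e /ZK//|]; exact: ImD.
have := @Cc_cintegral (vertex E * G)%type F.
apply => //.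
- exact: (lch_prod lch_vertex lG).2.
- apply: (@compact_setX _ _ ((fun q : G * edge E => vact a (q.1^-1)%g (source_map q.2)) @`
     ((snd @` K) `*` (fst @` K))) ((fun q : G * G => (q.1^-1 * q.2)%g) @` ((snd @` K) `*` (snd @` K')))).
    apply: compact_image; last exact: compact_setX.
    by apply: ct_act; [ct|apply: ct_comp; [exact: ct_source|ct]].
  by apply: compact_image; [ct|exact: compact_setX].
- exact: c2.
- have /ctC_P[cZ1 cZ2] := cZ.
  apply/ctC_P; split.
    have H := ct_fibre_param (a := a) c1 cZ1 (fun e q n => congr1 (@complex.Re R) (ZK e q n)).
    apply: (ct_ext H); by move=> [[v g] h] /=; rewrite ReF.
  have H := ct_fibre_param (a := a) c1 cZ2 (fun e q n => congr1 (@complex.Im R) (ZK e q n)).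
  apply: (ct_ext H); by move=> [[v g] h] /=; rewrite ImF.
- move=> [v g] h n; rewrite /F -(fibre_sum0 (R[i]) (vact a h v)); apply: eq_fibre_sum => e _.
  rewrite /Z xK ?conjc0 ?mul0r// => k; apply: n; by eexists; [exact: k|].
- move=> [v g] h n; rewrite /F -(fibre_sum0 (R[i]) (vact a h v)); apply: eq_fibre_sum => e se.
  rewrite /Z /=; have [Kx|/xK ->] := pselect (K (e, h)); last by rewrite conjc0 mul0r.
  rewrite eK' ?mulr0// => Ke; apply: n; split => /=.
    exists (h, e) => /=; last by rewrite se gactVK.
    by split; [exists (e, h)|exists (e, h)].
  exists (h, (h * g)%g) => /=; last by rewrite mulgA mulVg mul1g.
  by split; [exists (e, h)|exists (e, (h * g)%g)].
Qed.
End CcClosure.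

(** * Completion of a semidefinite inner product space *)

Section Rnorm.
Variable R : realType.
Notation Re := complex.Re.
Notation Im := complex.Im.

Section NormedZmod.
Variable V : normedZmodType R[i].
Implicit Types v w : V.

Lemma rnormD v w : rnorm (v + w) <= rnorm v + rnorm w.
Proof. by have := ler_normD v w; rewrite !rnormE -rmorphD /= lecR. Qed.

Lemma rnormN v : rnorm (- v) = rnorm v.
Proof. by rewrite /rnorm normrN. Qed.

Lemma rnormB v w : rnorm (v - w) <= rnorm v + rnorm w.
Proof. by rewrite -(rnormN w) rnormD. Qed.

Lemma rdistC v w : rnorm (v - w) = rnorm (w - v).
Proof. by rewrite /rnorm distrC. Qed.

Lemma rnorm0 : rnorm (0 : V) = 0.
Proof. by rewrite /rnorm normr0. Qed.

Lemma rnorm_eq0 v : rnorm v = 0 -> v = 0.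
Proof. by move=> h; apply: normr0_eq0; rewrite rnormE h. Qed.
End NormedZmod.

Lemma rnormM (x y : R[i]) : rnorm (x * y) = rnorm x * rnorm y.
Proof. by rewrite /rnorm normrM !rnormE -rmorphM. Qed.

Lemma rnormZ (V : normedModType R[i]) (k : R[i]) (v : V) : rnorm (k *: v) = rnorm k * rnorm v.
Proof. by rewrite /rnorm normrZ !rnormE -rmorphM. Qed.

Lemma rnorm_real (r : R) : rnorm (r%:C) = `|r|.
Proof. by rewrite rnormC /= expr0n addr0 sqrtr_sqr. Qed.

Lemma rnormJ (x : R[i]) : rnorm (conjc x) = rnorm x.
Proof. by rewrite /rnorm normcJ. Qed.

Lemma rnorm_sqr (x : R[i]) : x * conjc x = ((rnorm x) ^+ 2)%:C.
Proof. by rewrite -sqr_normc rnormE rmorphXn. Qed.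

Lemma rnorm_eps0 (V : normedZmodType R[i]) (v : V) : (forall e, 0 < e -> rnorm v <= e) -> v = 0.
Proof.
move=> H; apply: rnorm_eq0; apply/le_anti; rewrite rnorm_ge0 andbT.
by apply/ler_addgt0Pl => e e0; rewrite addr0; exact: H.
Qed.

Lemma rball (V : normedModType R[i]) (v w : V) (e : R) : ball v e%:C w <-> rnorm (v - w) < e.
Proof. by rewrite -ball_normE /ball_ /= rnormE ltcR. Qed.

Lemma nbhs_rnorm (V : normedModType R[i]) (v : V) (A : set V) :
  nbhs v A <-> exists2 e : R, 0 < e & forall w, rnorm (v - w) < e -> A w.
Proof.
rewrite -nbhs_ballE; split.
  move=> [_ /= /pos_complex[e e0 ->] H]; exists e => // w h; apply: H; exact/rball.
by move=> [e e0 H]; exists e%:C; rewrite /= ?ltcR// => w /rball /H.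
Qed.
End Rnorm.

(** A vector of the completion of [V] is encoded as the conjugate-linear functional that it induces on
    [V], so that an operator with an adjoint on [V] acts by precomposition. *)
Record preHilbert (R : realType) := PreHilbert {
  ph_sort :> lmodType R[i] ;
  ip : ph_sort -> ph_sort -> R[i] ;
  ip_linear : forall x (k : R[i]) y z, ip x (k *: y + z) = k * ip x y + ip x z ;
  ipC : forall x y, ip y x = conjc (ip x y) ;
  ip_ge0 : forall x, 0 <= complex.Re (ip x x)
}.

Section Completion.
Variables (R : realType) (V : preHilbert R).
Notation Re := complex.Re.
Notation Im := complex.Im.
Implicit Types (x y z w : V) (k : R[i]).

Lemma ip_real x : ip x x = (Re (ip x x))%:C.
Proof.
have := ipC x x; case: (ip x x) => a b /= [e]; apply: complex_eq => //=.
by apply/eqP; rewrite -[b == 0](mulrn_eq0 b 2) mulr2n {1}e addNr.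
Qed.

Lemma ipDr x y z : ip x (y + z) = ip x y + ip x z.
Proof. by rewrite -{1}(scale1r y) ip_linear mul1r. Qed.

Lemma ip0r x : ip x 0 = 0.
Proof. by apply: (addrI (ip x 0)); rewrite -ipDr !addr0. Qed.

Lemma ipZr x k y : ip x (k *: y) = k * ip x y.
Proof. by rewrite -[k *: y]addr0 ip_linear ip0r addr0. Qed.

Lemma ipBr x y z : ip x (y - z) = ip x y - ip x z.
Proof. by rewrite ipDr -scaleN1r ipZr mulN1r. Qed.

Lemma ipDl x y z : ip (x + y) z = ip x z + ip y z.
Proof. by rewrite ipC ipDr rmorphD /= -!ipC. Qed.

Lemma ipZl x k y : ip (k *: x) y = conjc k * ip x y.
Proof. by rewrite ipC ipZr rmorphM /= -ipC. Qed.

Definition sn x : R := Num.sqrt (Re (ip x x)).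

Lemma sn_ge0 x : 0 <= sn x. Proof. exact: sqrtr_ge0. Qed.

Lemma sn_sqr x : sn x ^+ 2 = Re (ip x x).
Proof. by rewrite sqr_sqrtr// ip_ge0. Qed.

Lemma ip_CS x y : rnorm (ip x y) <= sn x * sn y.
Proof.
pose p := rnorm (ip x y) ^+ 2; set a := Re (ip x x); set b := Re (ip y y).
have Q (t : R) : 0 <= b - 2 * t * p + t ^+ 2 * p * a.
  have := ip_ge0 (y + (- t%:C * ip x y) *: x); rewrite ipDr !ipDl ipZr !ipZl ipZr.
  rewrite (ipC x y) (ip_real x) -/a (ip_real y) -/b.
  have -> : p = Re (ip x y) ^+ 2 + Im (ip x y) ^+ 2.
    by rewrite /p rnormC sqr_sqrtr// addr_ge0 ?sqr_ge0.
  case: (ip x y) => c d /=; move=> h; apply: (le_trans h); rewrite le_eqVlt; apply/orP; left.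
  by apply/eqP; ring.
have p0 : 0 <= p by exact: sqr_ge0.
have a0 : 0 <= a by exact: ip_ge0.
have b0 : 0 <= b by exact: ip_ge0.
suff : p <= a * b.
  move=> h; rewrite -(ger0_norm (rnorm_ge0 (ip x y))) -sqrtr_sqr /sn -sqrtrM//.
  by rewrite ler_wsqrtr.
have [a_eq|a_neq] := eqVneq a 0; last first.
  have a1 : 0 < a by rewrite lt_def a_neq.
  have := Q a^-1; rewrite -(ler_pM2l a1) mulr0.
  have -> : a * (b - 2 * a^-1 * p + a^-1 ^+ 2 * p * a) = a * b - p by field.
  by rewrite subr_ge0.
rewrite a_eq mul0r leNgt; apply/negP => p1.
have := Q ((b + 1) / (2 * p)); rewrite a_eq mulr0 addr0.
have -> : b - 2 * ((b + 1) / (2 * p)) * p = -1 by field; rewrite gt_eqF.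
by rewrite oppr_ge0 ler10.
Qed.

(** Conjugate-linear functionals that are limits, in the dual norm, of the
    functionals [fun w => ip w f].  The quotient by null vectors is implicit: two
    vectors at distance zero give the same functional. *)
Definition hpred : {pred (V -> R[i]^o)} := mem [set F : V -> R[i]^o |
  forall e : R, 0 < e -> exists f : V, forall w, rnorm (F w - ip w f) <= e * sn w].

Lemma hpred_submod : submod_closed hpred.
Proof.
split.
  rewrite inE => e e0; exists 0 => w; rewrite ip0r subr0 /= rnorm0.
  by rewrite mulr_ge0 ?sn_ge0// ltW.
move=> k F F'; rewrite !inE => HF HF' e e0.
have k1 : 0 < 2 * (rnorm k + 1) by rewrite mulr_gt0// ltr_wpDl// rnorm_ge0.
have [f Hf] := HF _ (divr_gt0 e0 k1).
have [f' Hf'] := HF' (e / 2) (divr_gt0 e0 (ltr0Sn _ 1)).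
exists (k *: f + f') => w; rewrite ip_linear.
have -> : (k *: F + F') w - (k * ip w f + ip w f') = k * (F w - ip w f) + (F' w - ip w f').
  by rewrite /= mulrBr opprD addrACA.
rewrite (le_trans (rnormD _ _))// rnormM (splitr e) mulrDl lerD//.
apply: (le_trans (ler_wpM2l (rnorm_ge0 k) (Hf w))).
rewrite mulrA; apply: ler_wpM2r; first exact: sn_ge0.
have kn : 0 < rnorm k + 1 by rewrite ltr_wpDl// rnorm_ge0.
have -> : rnorm k * (e / (2 * (rnorm k + 1))) = (e / 2) * (rnorm k / (rnorm k + 1)).
  by field; rewrite gt_eqF.
apply: ler_piMr; first by rewrite ltW// divr_gt0.
by rewrite ler_pdivrMr// mul1r lerDl ler01.
Qed.

HB.instance Definition _ := GRing.isSubmodClosed.Build _ _ hpred hpred_submod.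

Record hcompl := HCompl { hval :> V -> R[i]^o ; hvalP : hval \in hpred }.

HB.instance Definition _ := [isSub for hval].
HB.instance Definition _ := [Choice of hcompl by <:].
HB.instance Definition _ := [SubChoice_isSubLmodule of hcompl by <:].

Implicit Types F : hcompl.

Lemma hvalD F F' w : (F + F') w = F w + F' w. Proof. by []. Qed.
Lemma hvalZ k F w : (k *: F) w = k * F w. Proof. by []. Qed.
Lemma hvalN F w : (- F) w = - F w. Proof. by []. Qed.
Lemma hval0 w : (0 : hcompl) w = 0. Proof. by []. Qed.

Lemma hcompl_eq F F' : (forall w, F w = F' w) -> F = F'.
Proof. by move=> h; apply: val_inj; apply/funext. Qed.

Lemma happrox F (e : R) : 0 < e -> exists f : V, forall w, rnorm (F w - ip w f) <= e * sn w.
Proof. by have := hvalP F; rewrite inE; apply. Qed.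

Let hS F := [set C : R | 0 <= C /\ forall w, rnorm (F w) <= C * sn w].

Definition hn F : R := inf (hS F).

Let hS_inf F : has_inf (hS F).
Proof.
split; last by exists 0 => C [].
have [f Hf] := happrox F ltr01; exists (1 + sn f); split; first by rewrite addr_ge0// sn_ge0.
move=> w; rewrite -(subrK (ip w f) (F w)) (le_trans (rnormD _ _))// mulrDl lerD//.
by rewrite mulrC ip_CS.
Qed.

Lemma hn_ge0 F : 0 <= hn F.
Proof. by apply: lb_le_inf; [exact: (hS_inf F).1|move=> C []]. Qed.

Lemma hn_le F C : 0 <= C -> (forall w, rnorm (F w) <= C * sn w) -> hn F <= C.
Proof. by move=> C0 H; apply: ge_inf; [exact: (hS_inf F).2|split]. Qed.

Lemma hn_bound F w : rnorm (F w) <= hn F * sn w.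
Proof.
have [s0|s0] := eqVneq (sn w) 0.
  have [C [C0 HC]] := (hS_inf F).1.
  by have := HC w; rewrite s0 !mulr0.
have s1 : 0 < sn w by rewrite lt_def s0 sn_ge0.
rewrite -ler_pdivrMr//; apply: lb_le_inf; first exact: (hS_inf F).1.
by move=> C [C0 HC]; rewrite ler_pdivrMr.
Qed.

Let hnorm F : R[i] := (hn F)%:C.

Let hnormD F F' : hnorm (F + F') <= hnorm F + hnorm F'.
Proof.
rewrite /hnorm -rmorphD lecR; apply: hn_le; first by rewrite addr_ge0 ?hn_ge0.
by move=> w; rewrite hvalD (le_trans (rnormD _ _))// mulrDl lerD// hn_bound.
Qed.

Let hn0 : hn 0 = 0.
Proof.
apply/le_anti; rewrite hn_ge0 andbT; apply: hn_le => // w.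
by rewrite hval0 rnorm0 mul0r.
Qed.

Let hnZ_le k F : hn (k *: F) <= rnorm k * hn F.
Proof.
apply: hn_le; first by rewrite mulr_ge0 ?rnorm_ge0 ?hn_ge0.
by move=> w; rewrite hvalZ rnormM -mulrA ler_wpM2l ?rnorm_ge0 ?hn_bound.
Qed.

Let hnormZ k F : hnorm (k *: F) = `|k| * hnorm F.
Proof.
rewrite /hnorm rnormE -rmorphM; congr (_%:C); apply/le_anti/andP; split; first exact: hnZ_le.
have [->|k0] := eqVneq k 0; first by rewrite rnorm0 mul0r scale0r hn0.
have kn : 0 < rnorm k.
  by rewrite lt_def rnorm_ge0 andbT; apply: contra_neq k0 => /rnorm_eq0.
rewrite -{1}(scale1r F) -(mulVf k0) -scalerA.
apply: (le_trans (ler_wpM2l (ltW kn) (hnZ_le _ _))).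
by rewrite mulrA -rnormM mulfV// rnorm_real normr1 mul1r.
Qed.

Let hnorm_eq0 F : hnorm F = 0 -> F = 0.
Proof.
move=> [h]; apply: hcompl_eq => w; apply: rnorm_eq0; apply/le_anti.
by rewrite rnorm_ge0 andbT; have := hn_bound F w; rewrite h mul0r.
Qed.

HB.instance Definition _ := Lmodule_isNormed.Build R[i] hcompl hnormD hnormZ hnorm_eq0.

Lemma hcompl_rnorm F : rnorm F = hn F.
Proof. by []. Qed.

Lemma happrox_rnorm F w : rnorm (F w) <= rnorm F * sn w.
Proof. exact: hn_bound. Qed.

Let cauchy_fct (FF : set_system hcompl) : ProperFilter FF -> cauchy FF ->
  forall (u : hcompl -> R) (M : R), (forall F F', `|u F - u F'| <= M * rnorm (F - F')) -> 0 <= M ->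
  exists a : R, forall e, 0 < e -> FF [set F | `|u F - a| <= e].
Proof.
move=> PF /(cauchy_ballP FF) cF u M Hu M0.
have : cvg (u @ FF).
  apply: (cauchy_cvg (u @ FF)); apply/(cauchy_ballP (u @ FF)) => e e0.
  have e1 : 0 < e / (M + 1) by rewrite divr_gt0// ltr_wpDl.
  have := cF (e / (M + 1))%:C; rewrite ltcR => /(_ e1).
  case=> -[A B] [/= FA FB] AB; exists (u @` A, u @` B) => /=.
    by split; [apply: filterS FA => x Ax; exists x|apply: filterS FB => x Bx; exists x].
  move=> [_ _] [/= [F AF <-] [F' BF' <-]].
  have /rball h : ball F (e / (M + 1))%:C F' by exact: (AB (F, F')).
  rewrite /ball /=; apply: (le_lt_trans (Hu F F')).
  apply: (@le_lt_trans _ _ (M * (e / (M + 1)))); first by apply: ler_wpM2l => //; exact: ltW.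
  rewrite mulrCA gtr_pMr// ltr_pdivrMr ?ltr_wpDl// mul1r ltrDl ltr01 //.
move=> /cvg_ex[/= a Ha]; exists a => e e0.
have /(@cvgrPdist_le R R^o) /(_ e e0) := Ha.
by apply: filterS => F; rewrite distrC.
Qed.

Lemma hcompl_complete (FF : set_system hcompl) : ProperFilter FF -> cauchy FF -> cvg FF.
Proof.
move=> PF cF.
have /choice[L HL] : forall w, exists a : R[i], forall e : R, 0 < e -> FF [set F | rnorm (F w - a) <= e].
  move=> w.
  have [a Ha] := cauchy_fct PF cF (u := fun F => Re (F w)) (M := sn w) 
    (fun F F' => ltac:(by rewrite mulrC -ReN -ReD; apply: (le_trans (ReX2_le _)); exact: (hn_bound (F - F') w)))
    (sn_ge0 w).
  have [b Hb] := cauchy_fct PF cF (u := fun F => Im (F w)) (M := sn w) 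
    (fun F F' => ltac:(by rewrite mulrC -ImN -ImD; apply: (le_trans (ImX2_le _)); exact: (hn_bound (F - F') w)))
    (sn_ge0 w).
  exists (a +i* b) => e e0; have e2 : 0 < e / 2 by rewrite divr_gt0.
  apply: filterS2 (Ha _ e2) (Hb _ e2) => F /= h1 h2.
  rewrite (le_trans (rnorm_le _))// (splitr e).
  by rewrite ReD ImD ReN ImN lerD.
have cB (e : R) : 0 < e -> exists2 F, FF [set F' | rnorm (F - F') <= e] &
    forall w, rnorm (L w - F w) <= e * sn w.
  move=> e0; have /(cauchy_ballP FF) := cF; move=> /(_ e%:C); rewrite ltcR => /(_ e0).
  case=> -[A B] [/= FA FB] AB; have [F AF] := filter_ex FA.
  have FF' : FF [set F' | rnorm (F - F') <= e].
    by apply: filterS FB => F' BF'; have /rball/ltW := AB (F, F') (conj AF BF').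
  exists F => // w; apply/ler_addgt0Pl => e' e'0.
  have [F' [/= h1 h2]] := filter_ex (filterI (HL w e' e'0) FF').
  have -> : L w - F w = (F' - F) w - (F' w - L w) by rewrite hvalD hvalN; ring.
  rewrite (le_trans (rnormB _ _))// addrC lerD//.
  apply: (le_trans (hn_bound _ _)); apply: ler_wpM2r; first exact: sn_ge0.
  by rewrite -hcompl_rnorm rdistC.
have LP : (L : V -> R[i]^o) \in hpred.
  rewrite inE => e e0; have e2 : 0 < e / 2 by rewrite divr_gt0.
  have [F _ LF] := cB _ e2; have [f Ff] := happrox F e2.
  exists f => w; have -> : L w - ip w f = (L w - F w) + (F w - ip w f) by ring.
  by rewrite (le_trans (rnormD _ _))// (splitr e) mulrDl lerD.
apply/cvg_ex; exists (HCompl LP) => A /nbhs_rnorm[e e0 HA].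
have e3 : 0 < e / 3 by rewrite divr_gt0.
have [F FF' LF] := cB _ e3; apply: filterS FF' => F' /= h; apply: HA.
have h' : rnorm (HCompl LP - F) <= e / 3 by rewrite hcompl_rnorm; apply: hn_le; [exact: ltW|].
have -> : HCompl LP - F' = (HCompl LP - F) + (F - F') by rewrite addrA subrK.
rewrite (le_lt_trans (rnormD _ _))//; apply: (le_lt_trans (lerD h' h)); lra.
Qed.

HB.instance Definition _ := isPointed.Build hcompl 0.
HB.instance Definition _ := Uniform_isComplete.Build hcompl hcompl_complete.

Lemma ip_hpred (f : V) : ((fun w => ip w f) : V -> R[i]^o) \in hpred.
Proof.
rewrite inE => e e0; exists f => w; rewrite subrr rnorm0 mulr_ge0 ?sn_ge0//; exact: ltW.
Qed.

Definition hemb (f : V) : hcompl := HCompl (ip_hpred f).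

Lemma hembD k f g : hemb (k *: f + g) = k *: hemb f + hemb g.
Proof. by apply: hcompl_eq => w; exact: ip_linear. Qed.

Lemma hemb_rnorm f : rnorm (hemb f) = sn f.
Proof.
apply/le_anti/andP; split.
  by apply: hn_le; [exact: sn_ge0|move=> w; rewrite mulrC; exact: ip_CS].
have [s0|s0] := eqVneq (sn f) 0; first by rewrite s0 rnorm_ge0.
have s1 : 0 < sn f by rewrite lt_def s0 sn_ge0.
have := hn_bound (hemb f) f; rewrite /= ip_real rnorm_real ger0_norm ?ip_ge0//.
by rewrite -sn_sqr expr2 ler_pM2r.
Qed.

Lemma hemb_dense F (e : R) : 0 < e -> exists f, rnorm (F - hemb f) <= e.
Proof.
move=> e0; have [f Hf] := happrox F e0; exists f; apply: hn_le; first exact: ltW.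
by move=> w; rewrite hvalD hvalN; exact: Hf.
Qed.
End Completion.

(** * The completed Hilbert space and its operators *)

Lemma ctC_add (R : realType) (X : topologicalType) (f g : X -> R[i]^o) :
  continuous f -> continuous g -> continuous (fun x => f x + g x : R[i]^o).
Proof.
move=> /ctC_P[f1 f2] /ctC_P[g1 g2]; apply/ctC_P; split.
- by apply: (ct_ext (ct_add f1 g1)) => x; rewrite ReD.
- by apply: (ct_ext (ct_add f2 g2)) => x; rewrite ImD.
Qed.

Lemma ctC_opp (R : realType) (X : topologicalType) (f : X -> R[i]^o) :
  continuous f -> continuous (fun x => - f x : R[i]^o).
Proof.
move=> /ctC_P[f1 f2]; apply/ctC_P; split.
- by apply: (ct_ext (ct_opp f1)) => x; rewrite ReN.
- by apply: (ct_ext (ct_opp f2)) => x; rewrite ImN.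
Qed.

Lemma ct_lip (R : realType) (V W : normedModType R[i]) (f : V -> W) (M : R) :
  (forall x y, rnorm (f x - f y) <= M * rnorm (x - y)) -> continuous f.
Proof.
move=> H x A /nbhs_rnorm[e e0 HA]; apply/nbhs_rnorm.
have M1 : 0 < `|M| + 1 by rewrite ltr_wpDl.
exists (e / (`|M| + 1)); first by rewrite divr_gt0.
move=> y h; apply: HA; apply: (le_lt_trans (H x y)).
apply: (@le_lt_trans _ _ (`|M| * rnorm (x - y))).
  by apply: ler_wpM2r; [exact: rnorm_ge0|exact: ler_norm].
apply: (@le_lt_trans _ _ (`|M| * (e / (`|M| + 1)))); first by apply: ler_wpM2l => //; exact: ltW.
by rewrite mulrCA gtr_pMr// ltr_pdivrMr// mul1r ltrDl ltr01.
Qed.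

Lemma ct_rnorm (R : realType) (V : normedModType R[i]) : continuous (fun x : V => rnorm x).
Proof.
apply: continuous_eps => x e e0; apply/nbhs_rnorm; exists e => // y h.
apply: le_trans (ltW h); rewrite ler_norml; apply/andP; split.
  by rewrite lerNl opprB lerBlDr -{1}(subrK y x) rnormD.
by rewrite rdistC lerBlDr -{1}(subrK x y) rnormD.
Qed.

Section HilbertCompletion.
Variables (R : realType) (V : preHilbert R).
Implicit Types (F : hcompl V) (f g w : V).

Let q F : R[i] := ((rnorm F) ^+ 2)%:C.

(** The inner product of the completion, recovered from its norm by polarization. *)
Definition hd F F' : R[i] := (4^-1 : R)%:C *
  (q (F + F') - q (F - F') - 'i%C * q (F + 'i%C *: F') + 'i%C * q (F - 'i%C *: F')).

Let q_emb f : q (hemb f) = ip f f.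
Proof. by rewrite /q hemb_rnorm sn_sqr -ip_real. Qed.

Lemma hembZD (k : R[i]) f g : hemb f + k *: hemb g = hemb (f + k *: g).
Proof. by rewrite addrC (addrC f) hembD. Qed.

Lemma hd_emb f g : hd (hemb f) (hemb g) = ip f g.
Proof.
have qE k : q (hemb f + k *: hemb g) =
    ip f f + k * ip f g + conjc k * ip g f + conjc k * k * ip g g.
  by rewrite hembZD q_emb ipDl !ipDr ipZl !ipZr ipZl; ring.
have q1 : q (hemb f + hemb g) = ip f f + ip f g + ip g f + ip g g.
  by rewrite -{1}(scale1r (hemb g)) qE conjc1 !mul1r.
have q2 : q (hemb f - hemb g) = ip f f - ip f g - ip g f + ip g g.
  have cm1 : conjc (-1 : R[i]) = -1 by apply: complex_eq => /=; rewrite ?oppr0.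
  by rewrite -scaleN1r qE cm1; ring.
rewrite /hd q1 q2 -(scaleNr 'i%C) !qE (ipC f g) (ip_real f) (ip_real g).
case: (ip f g) => a b; move: (complex.Re _) (complex.Re _) => c d.
by apply: complex_eq => /=; field.
Qed.

Let ct_q k F : continuous (fun x => q (x + k *: F) : R[i]^o).
Proof.
apply: ctC_real; rewrite (_ : (fun x => _) = (fun x => rnorm (x + k *: F) * rnorm (x + k *: F))); last first.
  by apply/funext => x; rewrite expr2.
have c1 : continuous (fun x : hcompl V => rnorm (x + k *: F)).
  apply: (ct_comp (f := fun x : hcompl V => x + k *: F) (@ct_rnorm R (hcompl V))).
  apply: (@ct_lip _ _ _ _ 1) => x y; rewrite mul1r.
  by rewrite opprD addrACA subrr addr0.
exact: ct_mul.
Qed.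

Lemma ct_hdl F : continuous (fun x => hd x F : R[i]^o).
Proof.
have E x : hd x F = (4^-1 : R)%:C * (q (x + 1 *: F) - q (x + (-1) *: F)
    - 'i%C * q (x + 'i%C *: F) + 'i%C * q (x + (- 'i%C) *: F)).
  by rewrite /hd scale1r scaleN1r scaleNr.
apply: (ct_ext (f := fun x => ((4^-1 : R)%:C * (q (x + 1 *: F) - q (x + (-1) *: F)
    - 'i%C * q (x + 'i%C *: F) + 'i%C * q (x + (- 'i%C) *: F)) : R[i]^o))); last by move=> x; rewrite E.
apply: ctC_mul; first exact: ct_cst.
apply: ctC_add.
  apply: ctC_add.
    by apply: ctC_add; [exact: ct_q|apply: ctC_opp; exact: ct_q].
  by apply: ctC_opp; apply: ctC_mul; [exact: ct_cst|exact: ct_q].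
by apply: ctC_mul; [exact: ct_cst|exact: ct_q].
Qed.

Let rnormi F : rnorm ('i%C *: F) = rnorm F.
Proof. by rewrite rnormZ rnormC /= expr0n add0r expr1n sqrtr1 mul1r. Qed.

Let sqi : 'i%C * 'i%C = -1 :> R[i]. Proof. by rewrite -expr2 sqr_i. Qed.

Lemma hdC F F' : hd F' F = conjc (hd F F').
Proof.
have -> : hd F' F = (4^-1 : R)%:C *
  (q (F + F') - q (F - F') - 'i%C * q (F - 'i%C *: F') + 'i%C * q (F + 'i%C *: F')).
  rewrite /hd (addrC F') /q (rdistC F').
  have -> : rnorm (F' + 'i%C *: F) = rnorm (F - 'i%C *: F').
    by rewrite -(rnormi (F - _)) scalerBr scalerA sqi scaleN1r opprK addrC.
  have -> // : rnorm (F' - 'i%C *: F) = rnorm (F + 'i%C *: F').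
    rewrite -(rnormi (F + _)) scalerDr scalerA sqi scaleN1r -(rnormN (F' - _)).
    by rewrite opprB.
rewrite /hd /q; set a := _ ^+ 2; set b := _ ^+ 2; set c := _ ^+ 2; set d := _ ^+ 2.
by apply: complex_eq => /=; ring.
Qed.

Lemma hd_norm F : `|F| ^+ 2 = hd F F :> R[i].
Proof.
have r1 : rnorm (F + 'i%C *: F) = Num.sqrt 2 * rnorm F.
  rewrite -{1}(scale1r F) -scalerDl rnormZ rnormC /=.
  by rewrite addr0 add0r !expr1n.
have r2 : rnorm (F - 'i%C *: F) = Num.sqrt 2 * rnorm F.
  rewrite -{1}(scale1r F) -scalerBl rnormZ rnormC /=.
  by rewrite oppr0 addr0 add0r sqrrN !expr1n.
have r3 : rnorm (F + F) = 2 * rnorm F.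
  rewrite -{1 2}(scale1r F) -scalerDl rnormZ -[1 + 1]/(2%:R).
  by rewrite -(rmorph_nat (real_complex R)) rnorm_real normr_nat.
rewrite /hd /q r1 r2 r3 subrr rnorm0 !exprMn sqr_sqrtr ?ler0n// rnormE -rmorphXn.
move: (rnorm F) => r.
by apply: complex_eq => /=; field.
Qed.

Lemma ct_hdr F : continuous (fun x => hd F x : R[i]^o).
Proof.
apply: (ct_ext (f := fun x => (conjc (hd x F) : R[i]^o))); last by move=> x; rewrite -hdC.
by apply: ctC_conj; exact: ct_hdl.
Qed.

(** The image of [V] is dense, so identities between continuous functions may be
    checked there. *)
Lemma hcompl_ext (u v : hcompl V -> R[i]^o) : continuous u -> continuous v ->
  (forall f, u (hemb f) = v (hemb f)) -> forall F, u F = v F.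
Proof.
move=> cu cv uv F; apply/eqP; rewrite -subr_eq0; apply/eqP; apply: rnorm_eps0 => e e0.
have e2 : 0 < e / 2 by rewrite divr_gt0.
have /ctC_epsP cu' := cu; have /ctC_epsP cv' := cv.
have /nbhs_rnorm[d d0 Hd] : nbhs F [set x | rnorm (u F - u x) <= e / 2 /\ rnorm (v F - v x) <= e / 2].
  by apply: filterS2 (cu' F _ e2) (cv' F _ e2).
have d2 : 0 < d / 2 by rewrite divr_gt0.
have [f Hf] := hemb_dense F d2.
have [] := Hd (hemb f); first by apply: (le_lt_trans Hf); rewrite ltr_pdivrMr// ltr_pMr// ltr1n.
rewrite uv => h1 h2.
have -> : u F - v F = (u F - v (hemb f)) - (v F - v (hemb f)) by ring.
by rewrite (splitr e) (le_trans (rnormB _ _))// lerD.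
Qed.

Let ct_aff k F : continuous (fun x => k *: x + F).
Proof.
apply: (@ct_lip _ _ _ _ (rnorm k)) => x y.
by rewrite opprD addrACA subrr addr0 -scalerBr rnormZ.
Qed.

Lemma hd_linear F k F1 F2 : hd F (k *: F1 + F2) = k * hd F F1 + hd F F2.
Proof.
move: F; apply: hcompl_ext; [exact: ct_hdl|
  by apply: ctC_add; [apply: ctC_mul; [exact: ct_cst|exact: ct_hdl]|exact: ct_hdl]|move=> f].
move: F1; apply: hcompl_ext => [||f1].
- apply: (@ct_comp (hcompl V) (hcompl V) _ (fun x => k *: x + F2) (fun x => (hd (hemb f) x : R[i]^o))).
    exact: ct_hdr.
  exact: ct_aff.
- by apply: ctC_add; [apply: ctC_mul; [exact: ct_cst|exact: ct_hdr]|exact: ct_cst].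
move: F2; apply: hcompl_ext => [||f2].
- apply: (@ct_comp (hcompl V) (hcompl V) _ (fun x => k *: hemb f1 + x) (fun x => (hd (hemb f) x : R[i]^o))).
    exact: ct_hdr.
  by apply: (@ct_lip _ _ _ _ 1) => x y; rewrite mul1r opprD addrACA subrr add0r.
- by apply: ctC_add; [exact: ct_cst|exact: ct_hdr].
by rewrite -hembD !hd_emb ip_linear.
Qed.

Definition hilbert_completion : hilbertSpace R := HilbertSpace hd_linear hdC hd_norm.

Lemma hd_hemb f F : hd (hemb f) F = F f.
Proof.
move: F; apply: hcompl_ext => [||g]; [exact: ct_hdr| |by rewrite hd_emb].
apply/ctC_epsP => F e e0; apply/nbhs_rnorm.
have s1 : 0 < sn f + 1 by rewrite ltr_wpDl// sn_ge0.
exists (e / (sn f + 1)); first by rewrite divr_gt0.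
move=> F' h; apply: (le_trans (happrox_rnorm (F - F') f)).
apply: (@le_trans _ _ (e / (sn f + 1) * sn f)).
  by apply: ler_wpM2r; [exact: sn_ge0|exact: ltW].
rewrite mulrAC ler_pdivrMr// ler_pM2l// lerDl ler01 //.
Qed.

Lemma hval_antilinear F k f g : F (k *: f + g) = conjc k * F f + F g.
Proof.
rewrite -(hd_hemb (k *: f + g)) -(hd_hemb f) -(hd_hemb g) hembD !(hdC F) hd_linear.
by rewrite rmorphD rmorphM.
Qed.

(** The bound is put on the adjoint because [A] acts on functionals by
    precomposition with [A']. *)
Definition adjointable (A A' : V -> V) (M : R) :=
  [/\ 0 <= M, forall f g, ip (A f) g = ip f (A' g) & forall f, sn (A' f) <= M * sn f].

(** An operator with an adjoint on [V] extends to the completion through its adjoint;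
    the default value of [insubd] never occurs for adjointable operators. *)
Definition hop (A' : V -> V) F : hcompl V := insubd (0 : hcompl V) (fun w => F (A' w)).

Section Operators.
Variables (A A' : V -> V) (M : R).
Hypothesis AA : adjointable A A' M.

Lemma hopE F w : hop A' F w = F (A' w).
Proof.
have [M0 adj bnd] := AA; rewrite /hop insubdK// unfold_in /= inE => e e0.
have M1 : 0 < M + 1 by rewrite ltr_wpDl.
have [f Hf] := happrox F (divr_gt0 e0 M1); exists (A f) => x.
have -> : ip x (A f) = ip (A' x) f by rewrite ipC adj -ipC.
apply: (le_trans (Hf _)); rewrite mulrAC ler_pdivrMr//.
rewrite -mulrA; apply: ler_wpM2l; first exact: ltW.
apply: (le_trans (bnd x)); rewrite mulrC; apply: ler_wpM2l; first exact: sn_ge0.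
by rewrite lerDl ler01.
Qed.

Lemma hop_linear k F1 F2 : hop A' (k *: F1 + F2) = k *: hop A' F1 + hop A' F2.
Proof. by apply: hcompl_eq => w; rewrite hopE !hvalD !hvalZ !hopE. Qed.

Lemma hop_emb f : hop A' (hemb f) = hemb (A f).
Proof.
have [_ adj _] := AA; apply: hcompl_eq => w; rewrite hopE /=.
by rewrite ipC -adj -ipC.
Qed.

Lemma hop_bound F : rnorm (hop A' F) <= M * rnorm F.
Proof.
have [M0 adj bnd] := AA; apply: hn_le; first by rewrite mulr_ge0// rnorm_ge0.
move=> w; rewrite hopE (le_trans (happrox_rnorm _ _))// mulrAC mulrC.
by apply: ler_wpM2r => //; exact: rnorm_ge0.
Qed.

Lemma hopB F1 F2 : hop A' F1 - hop A' F2 = hop A' (F1 - F2).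
Proof. by apply: hcompl_eq => w; rewrite !hvalD !hvalN !hopE !hvalD !hvalN. Qed.

Lemma ct_hop : continuous (hop A').
Proof. by apply: (@ct_lip _ _ _ _ M) => x y; rewrite hopB hop_bound. Qed.
End Operators.

Lemma hop_adj A A' M M' : adjointable A A' M -> adjointable A' A M' ->
  forall F F', hd (hop A' F) F' = hd F (hop A F').
Proof.
move=> AA AA' F F'; move: F; apply: hcompl_ext => [||f].
- apply: (@ct_comp (hcompl V) (hcompl V) _ (hop A') (fun x => (hd x F' : R[i]^o))).
    exact: ct_hdl.
  exact: ct_hop AA.
- exact: ct_hdl.
by rewrite (hop_emb AA) !hd_hemb (hopE AA').
Qed.
End HilbertCompletion.

(** * Contractivity of covariant representations *)

Section CcModule.
Variables (R : realType) (X : topologicalType).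
Implicit Types f g : X -> R[i]^o.

Lemma Cc_lin (k : R[i]) f g : Cc f -> Cc g -> Cc (fun x => k * f x + g x : R[i]^o).
Proof.
move=> [cf Kf] [cg Kg]; split.
  by apply: ctC_add; [apply: ctC_mul; [exact: ct_cst|exact: cf]|exact: cg].
apply: (subclosed_compact _ (compactU Kf Kg)); first exact: closed_closure.
rewrite -closureU; apply: closure_subset => x /= h.
have [fx|fx] := eqVneq (f x) 0; last by left.
by right; move: h; rewrite fx mulr0 add0r.
Qed.

Lemma Cc_0 : Cc (fun _ : X => 0 : R[i]^o).
Proof.
split; first exact: ct_cst.
rewrite [X in closure X](_ : _ = set0); first by rewrite closure0; exact: compact0.
by rewrite -subset0 => x /=; rewrite eqxx.
Qed.

Lemma Cc_mull f g : continuous f -> Cc g -> Cc (fun x => f x * g x : R[i]^o).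
Proof.
move=> cf [cg Kg]; split; first exact: ctC_mul.
apply: (subclosed_compact _ Kg); first exact: closed_closure.
by apply: closure_subset => x /=; apply: contra_neq => ->; rewrite mulr0.
Qed.

Lemma Cc_conj f : Cc f -> Cc (fun x => conjc (f x) : R[i]^o).
Proof.
move=> [cf Kf]; split; first exact: ctC_conj.
apply: (subclosed_compact _ Kf); first exact: closed_closure.
by apply: closure_subset => x /=; apply: contra_neq => ->; rewrite conjc0.
Qed.

Definition ccpred : {pred (X -> R[i]^o)} := mem [set f : X -> R[i]^o | Cc f].

Lemma ccpred_submod : submod_closed ccpred.
Proof.
split; first by rewrite inE; exact: Cc_0.
by move=> k f g; rewrite !inE => cf cg; exact: Cc_lin.
Qed.

HB.instance Definition _ := GRing.isSubmodClosed.Build _ _ ccpred ccpred_submod.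

Record ccfun := CcFun { ccval :> X -> R[i]^o ; ccvalP : ccval \in ccpred }.

HB.instance Definition _ := [isSub for ccval].
HB.instance Definition _ := [Choice of ccfun by <:].
HB.instance Definition _ := [SubChoice_isSubLmodule of ccfun by <:].

Lemma ccfunP (f : ccfun) : Cc (f : X -> R[i]^o).
Proof. by have := ccvalP f; rewrite inE. Qed.

Definition mkcc f : ccfun := insubd (0 : ccfun) f.

Lemma mkccE f : Cc f -> mkcc f = f :> (X -> R[i]^o).
Proof. by move=> cf; rewrite /mkcc insubdK// unfold_in /= inE. Qed.

Lemma ccfun_eq (f g : ccfun) : (forall x, f x = g x) -> f = g.
Proof. by move=> h; apply: val_inj; apply/funext. Qed.

Lemma Cc_C0 f : Cc f -> C0 f.
Proof.
move=> [cf Kf]; split=> // e e0; apply: (subclosed_compact _ Kf).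
  rewrite (_ : [set x | _] = [set x | e <= rnorm (f x)]).
    by apply: closed_gef; apply: (@ct_comp X _ _ f (fun z : R[i]^o => rnorm z)); [exact: ct_rnorm|exact: cf].
  by apply/seteqP; split=> x /=; rewrite rnormE lecR.
move=> x /= h; apply: subset_closure => /=; apply/eqP => fx.
by move: h; rewrite fx normr0 lecR leNgt e0.
Qed.

Lemma C0_bounded f : C0 f -> exists2 M : R, 0 < M & forall x, rnorm (f x) <= M.
Proof.
move=> [cf /(_ 1 ltr01) cK].
have crf : continuous (fun x => rnorm (f x)).
  by apply: (@ct_comp X _ _ f (fun z : R[i]^o => rnorm z)); [exact: ct_rnorm|exact: cf].
have [M M0 HM] : exists2 M : R, 0 < M & forall x, (1 : R)%:C <= `|f x| -> rnorm (f x) <= M.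
  apply: (@compact_ind X _ (fun A => exists2 M : R, 0 < M & forall x, A x -> rnorm (f x) <= M) cK) => //.
  - by exists 1.
  - move=> A B [M M0 HM] [N N0 HN]; exists (M + N); first exact: addr_gt0.
    by move=> x [/HM|/HN] h; apply: (le_trans h); rewrite ?lerDl ?lerDr ltW.
  - by move=> A B AB [M M0 HM]; exists M => // x /AB/HM.
  - move=> x _; exists [set y | rnorm (f y) < rnorm (f x) + 1].
      have := continuous_near x crf ltr01; apply: filterS => y /=.
      by rewrite ltr_norml => /andP[_]; rewrite ltrBlDr addrC.
    by exists (rnorm (f x) + 1); [rewrite ltr_wpDl// rnorm_ge0|move=> y /= /ltW].
exists (M + 1); first by rewrite addr_gt0.
move=> x; have [h|h] := leP 1 (rnorm (f x)).
  by apply: (le_trans (HM x _)); [rewrite rnormE lecR|rewrite lerDl ler01].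
by apply: ltW; apply: (lt_le_trans h); rewrite lerDr ltW.
Qed.
End CcModule.

Section HilbertFacts.
Variables (R : realType) (H : hilbertSpace R).
Implicit Types (x y z : H).

Let hilbert_ge0 x : 0 <= complex.Re (hdot x x).
Proof. by rewrite -hnormE rnormE -rmorphXn /= sqr_ge0. Qed.

Definition hilbert_pre : preHilbert R :=
  PreHilbert (@hdot_linear R H) (@hdotC R H) hilbert_ge0.

Lemma hilbert_sn x : @sn R hilbert_pre x = rnorm x.
Proof.
rewrite /sn /= -hnormE rnormE -rmorphXn /=.
by rewrite sqrtr_sqr ger0_norm// rnorm_ge0.
Qed.

Lemma hdot_CS x y : rnorm (hdot x y) <= rnorm x * rnorm y.
Proof. by rewrite -!hilbert_sn; exact: (@ip_CS R hilbert_pre). Qed.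

Lemma hdotBr x y z : hdot x (y - z) = hdot x y - hdot x z.
Proof. exact: (@ipBr R hilbert_pre). Qed.

Lemma hdotBl x y z : hdot (x - y) z = hdot x z - hdot y z.
Proof. by rewrite hdotC hdotBr rmorphB /= -!hdotC. Qed.

Lemma hdotZr x k y : hdot x (k *: y) = k * hdot x y.
Proof. exact: (@ipZr R hilbert_pre). Qed.

Lemma hdotZl x k y : hdot (k *: x) y = conjc k * hdot x y.
Proof. exact: (@ipZl R hilbert_pre). Qed.

Lemma hdot0r x : hdot x 0 = 0.
Proof. exact: (@ip0r R hilbert_pre). Qed.

Lemma hdot_rnorm x : hdot x x = ((rnorm x) ^+ 2)%:C.
Proof. by rewrite -hnormE rnormE -rmorphXn. Qed.
End HilbertFacts.

Section Contractive.
Variables (R : realType) (G : topologicalGroupType) (X : topologicalType).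
Variables (act : continuousAction G X) (H : hilbertSpace R).
Variables (pi : (X -> R[i]^o) -> H -> H) (U : G -> H -> H).
Hypothesis rep : covariant_rep act pi U.

(** Representations of [C_0(X)] are contractive: with [q = 1 - sqrt(1 - |f|^2)],
    which again vanishes at infinity, [|x|^2 - |pi(f) x|^2 = |x - pi(q) x|^2]. *)
Lemma crep_contractive (f : X -> R[i]^o) (M : R) : Cc f -> 0 < M ->
  (forall v, rnorm (f v) <= M) -> forall x, rnorm (pi f x) <= M * rnorm x.
Proof.
move=> cf M0 fM x.
pose u v : R := 1 - Num.sqrt (1 - (rnorm (f v) / M) ^+ 2).
have fr v : 0 <= rnorm (f v) / M <= 1.
  apply/andP; split; [by apply: divr_ge0; [exact: rnorm_ge0|exact: ltW]|by rewrite ler_pdivrMr// mul1r].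
have f2 v : 0 <= 1 - (rnorm (f v) / M) ^+ 2.
  by rewrite subr_ge0; have /andP[h1 h2] := fr v; rewrite exprn_ile1.
have uE v : 2 * u v - u v ^+ 2 = (rnorm (f v) / M) ^+ 2.
  rewrite /u; have := sqr_sqrtr (f2 v); set s := Num.sqrt _ => hs.
  by rewrite (_ : 2 * (1 - s) - (1 - s) ^+ 2 = 1 - s ^+ 2); [rewrite hs; ring|ring].
pose cu v : R[i]^o := (u v)%:C.
have crf : continuous (fun v => rnorm (f v)).
  by apply: (@ct_comp X _ _ f (fun z : R[i]^o => rnorm z)); [exact: ct_rnorm|exact: cf.1].
have ctu : continuous u.
  apply: ct_sub; first exact: ct_cst.
  apply: (@ct_comp X _ _ (fun v => 1 - (rnorm (f v) / M) ^+ 2) (fun r : R => Num.sqrt r)); first exact: sqrt_continuous.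
  apply: ct_sub; first exact: ct_cst.
  apply: (ct_ext (f := fun v => (rnorm (f v) * M^-1) * (rnorm (f v) * M^-1))); last by [].
  by apply: ct_mul; apply: ct_mul => //; exact: ct_cst.
have cCu : Cc cu.
  split; first exact: ctC_real.
  apply: (subclosed_compact _ cf.2); first exact: closed_closure.
  apply: closure_subset => v /=; apply: contra_neq => fv.
  by rewrite /cu /u fv rnorm0 mul0r expr0n subr0 sqrtr1 subrr.
have C0u := Cc_C0 cCu.
have C0uu : C0 (fun v => cu v * cu v : R[i]^o) by apply: Cc_C0; exact: Cc_mull cCu.1 cCu.
have C0f := Cc_C0 cf; have C0fb := Cc_C0 (Cc_conj cf).
have uadj y z : hdot (pi cu y) z = hdot y (pi cu z).
  rewrite (crep_star rep C0u); congr (hdot y (pi _ z)); apply/funext => v.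
  by rewrite /cu conjc_real.
have E1 : hdot (pi f x) (pi f x) = (M ^+ 2)%:C * (2 * hdot x (pi cu x) - hdot x (pi (fun v => cu v * cu v) x)).
  rewrite (crep_star rep C0f) -(crep_mul rep C0fb C0f).
  have -> : (fun v => conjc (f v) * f v : R[i]^o) =
     (fun v => (2 * M ^+ 2)%:C * cu v + (- (M ^+ 2))%:C * (cu v * cu v)).
    apply/funext => v; rewrite mulrC rnorm_sqr /cu -!rmorphM -rmorphD; congr (_%:C).
    have := uE v; move: (rnorm (f v)) (u v) => r w h.
    have -> : r ^+ 2 = M ^+ 2 * (r / M) ^+ 2 by field; rewrite gt_eqF.
    by rewrite -h; ring.
  have C0z : C0 (fun v => (- (M ^+ 2))%:C * (cu v * cu v) : R[i]^o).
    by apply: Cc_C0; apply: Cc_mull; [exact: ct_cst|exact: Cc_mull cCu.1 cCu].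
  rewrite (crep_linear rep _ C0u C0z) hdot_linear.
  have C00 := Cc_C0 (@Cc_0 R X).
  have pi0 y : pi (fun=> 0) y = 0.
    have := crep_linear rep (-1) C00 C00 y.
    rewrite (_ : (fun v => -1 * 0 + 0) = (fun=> 0)); last first.
      by apply/funext => v; rewrite mulr0 addr0.
    by rewrite scaleN1r addNr.
  have -> : pi (fun v => (- (M ^+ 2))%:C * (cu v * cu v)) x =
      (- (M ^+ 2))%:C *: pi (fun v => cu v * cu v) x.
    have := crep_linear rep (- (M ^+ 2))%:C C0uu C00 x; rewrite pi0 addr0 => <-.
    by congr (pi _ x); apply/funext => v; rewrite addr0.
  rewrite hdotZr; move: (hdot x _) (hdot x _) => a b.
  by case: a => a1 a2; case: b => b1 b2; apply: complex_eq => /=; ring.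
have E2 : hdot (x - pi cu x) (x - pi cu x) =
    hdot x x - 2 * hdot x (pi cu x) + hdot x (pi (fun v => cu v * cu v) x).
  rewrite !hdotBr !hdotBl (crep_mul rep C0u C0u) -uadj uadj.
  by rewrite (uadj x (pi cu x)); ring.
have E : (rnorm (pi f x) ^+ 2)%:C = (M ^+ 2 * (rnorm x ^+ 2 - rnorm (x - pi cu x) ^+ 2))%:C :> R[i].
  rewrite -hdot_rnorm E1; transitivity ((M ^+ 2)%:C * ((rnorm x ^+ 2)%:C - (rnorm (x - pi cu x) ^+ 2)%:C) : R[i]).
    by rewrite -!hdot_rnorm E2; ring.
  by apply: complex_eq => /=; ring.
have {}E := complexI E.
have : rnorm (pi f x) ^+ 2 <= (M * rnorm x) ^+ 2.
  rewrite E exprMn ler_wpM2l ?sqr_ge0// lerBlDr lerDl sqr_ge0 //.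
by rewrite ler_sqr// nnegrE ?mulr_ge0 ?rnorm_ge0// ltW.
Qed.
End Contractive.

(** * Coefficients of integrated representations *)

Section CIntegral.
Variables (R : realType) (G : topologicalGroupType).
Hypotheses (hausG : hausdorff_space G) (lcG : locally_compact [set: G]).
Variables (mu : {measure set (borel G) -> \bar R}) (haar : left_haar mu).
Implicit Types f g : G -> R[i]^o.
Notation Re := complex.Re.
Notation Im := complex.Im.

Let hintP := hint_posfun hausG haar.

Lemma cint_lin (k : R[i]) f g : Cc f -> Cc g ->
  cintegral mu (fun h => k * f h + g h) = k * cintegral mu f + cintegral mu g.
Proof.
move=> cf cg; have f1 := Cc_Re cf; have f2 := Cc_Im cf; have g1 := Cc_Re cg; have g2 := Cc_Im cg.
case: k => p q.
apply: complex_eq => /=.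
  rewrite -/(hint mu (fun h => Re ((p +i* q) * f h + g h))).
  rewrite [X in hint mu X](_ : _ = (fun h => (p * Re (f h) - q * Im (f h)) + Re (g h))); last first.
    by apply/funext => h; case: (f h) => ? ?; case: (g h) => ? ?.
  rewrite (pfD hintP)//; last by apply: ccr_sub; exact: ccr_scale.
  by rewrite (pfB hintP) ?(pfZ hintP)//; exact: ccr_scale.
rewrite -/(hint mu (fun h => Im ((p +i* q) * f h + g h))).
rewrite [X in hint mu X](_ : _ = (fun h => (p * Im (f h) + q * Re (f h)) + Im (g h))); last first.
  by apply/funext => h; case: (f h) => ? ?; case: (g h) => ? ?.
rewrite (pfD hintP)//; last by apply: ccr_add; exact: ccr_scale.
by rewrite (pfD hintP) ?(pfZ hintP)//; exact: ccr_scale.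
Qed.

Lemma cint0 : cintegral mu (fun=> 0) = 0.
Proof. by apply: complex_eq; rewrite /= -?/(hint mu _) (pf0 hintP). Qed.

Lemma cint_scale (k : R[i]) f : Cc f -> cintegral mu (fun h => k * f h) = k * cintegral mu f.
Proof.
move=> cf; have := cint_lin k cf (@Cc_0 R G); rewrite cint0 addr0 => <-.
by congr cintegral; apply/funext => h; rewrite addr0.
Qed.

Lemma cint_conj f : Cc f -> cintegral mu (fun h => conjc (f h)) = conjc (cintegral mu f).
Proof.
move=> cf; apply: complex_eq => /=.
  by congr Rintegral; apply/funext => h; rewrite ReJ.
rewrite -/(hint mu (fun h => Im (f h))) -(pfN hintP (Cc_Im cf)).
by congr Rintegral; apply/funext => h; rewrite ImJ.
Qed.

Lemma cint_left x f : Cc f -> cintegral mu (fun h => f (x * h)%g) = cintegral mu f.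
Proof.
move=> cf; apply: complex_eq => /=.
  exact: (hint_left hausG haar x (Cc_Re cf)).
exact: (hint_left hausG haar x (Cc_Im cf)).
Qed.

Lemma cint_bound f (k : G -> R) : Cc f -> ccr k -> (forall h, rnorm (f h) <= k h) ->
  rnorm (cintegral mu f) <= 2 * hint mu k.
Proof.
move=> cf ck fk; rewrite mulr_natl mulr2n.
apply: (le_trans (rnorm_le _)); apply: lerD => /=.
  apply: (pf_abs hintP (Cc_Re cf) ck) => h; apply: le_trans (fk h); exact: ReX2_le.
apply: (pf_abs hintP (Cc_Im cf) ck) => h; apply: le_trans (fk h); exact: ImX2_le.
Qed.
End CIntegral.

Section Coefficients.
Variables (R : realType) (G : topologicalGroupType) (X : topologicalType).
Hypotheses (hausG : hausdorff_space G) (lcG : locally_compact [set: G]).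
Variables (mu : {measure set (borel G) -> \bar R}) (haar : left_haar mu).
Variable act : continuousAction G X.

Lemma Cc_slice (b : X * G -> R[i]^o) g : hausdorff_space X -> Cc b -> Cc (fun v => b (v, g) : R[i]^o).
Proof.
move=> hX cb; have [K cK bK] := Cc_supp cb.
apply: (CcI (K := fst @` K)) => //.
- by apply: (ct_comp (f := fun v => (v, g)) cb.1); apply: ct_pair; [exact: ct_id|exact: ct_cst].
- by apply: compact_image => //; exact: ct_fst.
- by move=> v n; apply: bK => k; apply: n; exists (v, g).
Qed.

Lemma Cc_unif (b : X * G -> R[i]^o) g (e : R) : Cc b -> 0 < e ->
  \forall g' \near g, forall v, rnorm (b (v, g) - b (v, g')) <= e.
Proof.
move=> cb e0; have [K cK bK] := Cc_supp cb.
have e2 : 0 < e / 2 by rewrite divr_gt0.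
have := @compact_ind X (fst @` K)
  (fun A => \forall g' \near g, forall v, A v -> rnorm (b (v, g) - b (v, g')) <= e).
have H1 : compact (fst @` K) by apply: compact_image => //; exact: ct_fst.
move=> /(_ H1) H.
suff : \forall g' \near g, forall v, (fst @` K) v -> rnorm (b (v, g) - b (v, g')) <= e.
  apply: filterS => g' Hg v; have [Kv|nK] := pselect ((fst @` K) v); first exact: Hg.
  by rewrite !bK ?subrr ?rnorm0 ?(ltW e0)// => k; apply: nK; [exists (v, g')|exists (v, g)].
apply: H.
- by near=> g'.
- by move=> A B hA hB; apply: filterS2 hA hB => g' h1 h2 v [/h1|/h2].
- by move=> A B AB; apply: filterS => g' h v /AB/h.
- move=> v _; have /ctC_epsP /(_ (v, g) _ e2) [[A B] [/= Av Bg] AB] := cb.1.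
  exists A => //; apply: filterS (Bg) => g' Bg' w Aw.
  have h1 := AB (w, g') (conj Aw Bg'); have h2 := AB (w, g) (conj Aw (nbhs_singleton Bg)).
  have -> : b (w, g) - b (w, g') = (b (v, g) - b (w, g')) - (b (v, g) - b (w, g)) by ring.
  by rewrite (splitr e) (le_trans (rnormB _ _))// lerD.
Unshelve. all: by end_near. Qed.

Lemma Cc_bounded (Z : topologicalType) (f : Z -> R[i]^o) : Cc f ->
  exists2 M : R, 0 < M & forall x, rnorm (f x) <= M.
Proof. by move=> cf; apply: C0_bounded; exact: Cc_C0. Qed.

Section Rep.
Variables (H : hilbertSpace R) (pi : (X -> R[i]^o) -> H -> H) (U : G -> H -> H).
Hypotheses (hX : hausdorff_space X) (rep : covariant_rep act pi U).

Lemma crep_pi0 y : pi (fun=> 0) y = 0.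
Proof.
have C00 := Cc_C0 (@Cc_0 R X).
have := crep_linear rep (-1) C00 C00 y.
rewrite (_ : (fun v => -1 * 0 + 0) = (fun=> 0)); last first.
  by apply/funext => v; rewrite mulr0 addr0.
by rewrite scaleN1r addNr.
Qed.

Lemma crep_piB f f' y : C0 f -> C0 f' -> pi (fun v => f v - f' v) y = pi f y - pi f' y.
Proof.
move=> cf cf'; rewrite addrC -scaleN1r -(crep_linear rep (-1) cf' cf).
by congr (pi _ y); apply/funext => v; rewrite mulN1r addrC.
Qed.

Lemma crep_opB f x y : C0 f -> pi f (x - y) = pi f x - pi f y.
Proof. by move=> cf; rewrite addrC -scaleN1r (crep_op_linear rep cf) scaleN1r addrC. Qed.

Lemma crep_U_rnorm g x : rnorm (U g x) = rnorm x.
Proof.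
have := crep_U_isometry rep g x x; rewrite !hdot_rnorm => /complexI h.
by apply/eqP; rewrite -(@eqrXn2 _ 2)// ?rnorm_ge0// h.
Qed.

Definition coefficient (b : X * G -> R[i]^o) x y : G -> R[i]^o :=
  fun g => hdot x (pi (fun v => b (v, g)) (U g y)).

Lemma coefficient_le b M x y : Cc b -> 0 < M -> (forall p, rnorm (b p) <= M) ->
  forall g, rnorm (coefficient b x y g) <= M * (rnorm x * rnorm y).
Proof.
move=> cb M0 bM g; apply: (le_trans (hdot_CS _ _)).
rewrite mulrCA; apply: ler_wpM2l; first exact: rnorm_ge0.
rewrite -(crep_U_rnorm g y); apply: (crep_contractive rep) => //.
exact: Cc_slice.
Qed.

(** Continuity combines uniform continuity of the slices of [b] with strong
    continuity of [U]. *)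
Lemma coefficient_Cc b x y : Cc b -> Cc (coefficient b x y).
Proof.
move=> cb; have [K cK bK] := Cc_supp cb; have [M M0 bM] := Cc_bounded cb.
apply: (CcI (K := snd @` K)) => //; first last.
- move=> g n; rewrite /coefficient (_ : (fun v => b (v, g)) = (fun=> 0)).
    by rewrite crep_pi0 hdot0r.
  by apply/funext => v; apply: bK => k; apply: n; exists (v, g).
- by apply: compact_image => //; exact: ct_snd.
apply/ctC_epsP => g e e0.
set N := rnorm x * (rnorm y + M) + 1.
have N0 : 0 < N by rewrite ltr_wpDl// mulr_ge0 ?rnorm_ge0// addr_ge0 ?rnorm_ge0 ?(ltW M0).
have d0 : 0 < e / N by rewrite divr_gt0.
have cU : nbhs g [set g' | rnorm (U g y - U g' y) < e / N].
  have HU : {for g, continuous (fun g => U g y)} by exact: (crep_U_continuous rep).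
  apply: (HU [set z | rnorm (U g y - z) < e / N]).
  by apply/nbhs_rnorm; exists (e / N).
apply: filterS2 (Cc_unif g cb d0) cU => g' h1 h2.
rewrite /coefficient -hdotBr.
have C1 := Cc_slice g hX cb; have C2 := Cc_slice g' hX cb.
have -> : pi (fun v => b (v, g)) (U g y) - pi (fun v => b (v, g')) (U g' y) =
    pi (fun v => b (v, g) - b (v, g')) (U g y) + pi (fun v => b (v, g')) (U g y - U g' y).
  rewrite crep_piB ?crep_opB; [|exact: Cc_C0..].
  by rewrite addrA subrK.
apply: (le_trans (hdot_CS _ _)).
apply: (@le_trans _ _ (rnorm x * (e / N * rnorm y + M * (e / N)))).
  apply: ler_wpM2l; first exact: rnorm_ge0.
  apply: (le_trans (rnormD _ _)); apply: lerD.
    rewrite -(crep_U_rnorm g y); apply: (crep_contractive rep) => //.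
    have := Cc_lin (-1) C2 C1; congr Cc; apply/funext => v.
    by rewrite mulN1r addrC.
  apply: (le_trans (crep_contractive rep C2 M0 _ _)) => //.
  by apply: ler_wpM2l; exact: ltW.
have -> : rnorm x * (e / N * rnorm y + M * (e / N)) = e * (rnorm x * (rnorm y + M)) / N.
  by field; rewrite gt_eqF.
rewrite ler_pdivrMr//; apply: ler_wpM2l; first exact: ltW.
by rewrite /N lerDl ler01.
Qed.
End Rep.

(** At unit vectors the coefficients are at most [sup |b|] by contractivity, and they
    vanish off the projection to [G] of the support of [b].  The resulting bound is
    the same for all representations, so the full norm is a genuine supremum. *)
Lemma coefficients_bounded b : hausdorff_space X -> Cc b ->
  has_ubound (integrated_coefficients mu act b).
Proof.
move=> hX cb; have [M M0 bM] := Cc_bounded cb; have [K cK bK] := Cc_supp cb.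
have cK2 : compact (snd @` K) by apply: compact_image => //; exact: ct_snd.
have [k [ck k01 k1]] := @ccr_bump R G (snd @` K) (conj lcG hausG) cK2.
exists (2 * hint mu (fun h => M * k h)) => r [H [pi [U [x [y [rep x1 y1 rE]]]]]].
have {}rE : r = rnorm (cintegral mu (coefficient pi U b x y)).
  by apply: complexI; rewrite rE rnormE.
rewrite rE; apply: (@cint_bound R G hausG mu haar (coefficient pi U b x y) (fun h => M * k h)).
- exact: (coefficient_Cc hX rep).
- exact: ccr_scale.
move=> g; have [Kg|nK] := pselect ((snd @` K) g).
  rewrite k1// mulr1 (le_trans (coefficient_le hX rep _ _ cb M0 bM _))//.
  apply: ler_piMr; first exact: ltW.
  by apply: mulr_ile1; rewrite ?rnorm_ge0//; move: x1 y1; rewrite !rnormE !lecR.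
rewrite /coefficient (_ : (fun v => b (v, g)) = (fun=> 0)).
  rewrite (crep_pi0 rep) hdot0r rnorm0 mulr_ge0 ?(ltW M0)//.
  by have /andP[] := k01 g.
by apply/funext => v; apply: bK => kk; apply: nK; exists (v, g).
Qed.

(** Coefficients against unit vectors are bounded by the full norm; general vectors
    are rescaled. *)
Lemma full_norm0_coefficient b (H : hilbertSpace R) pi U : hausdorff_space X -> Cc b ->
  @covariant_rep R G X act H pi U -> full_norm mu act b = 0 ->
  forall x y, cintegral mu (coefficient pi U b x y) = 0.
Proof.
move=> hX cb rep b0.
have unit x y : rnorm x <= 1 -> rnorm y <= 1 -> cintegral mu (coefficient pi U b x y) = 0.
  move=> x1 y1; apply: rnorm_eq0; apply/le_anti; rewrite rnorm_ge0 andbT -b0.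
  apply: ub_le_sup; first exact: coefficients_bounded.
  by exists H, pi, U, x, y; split; rewrite ?rnormE ?lecR.
have pos (z : H) : 0 < rnorm z + 1 by rewrite ltr_wpDl// rnorm_ge0.
move=> x y; pose sc (z : H) := ((rnorm z + 1)^-1)%:C *: z.
have sc1 z : rnorm (sc z) <= 1.
  rewrite /sc rnormZ rnorm_real ger0_norm ?invr_ge0 ?(ltW (pos z))// mulrC ler_pdivrMr//.
  by rewrite mul1r lerDl ler01.
have := unit _ _ (sc1 x) (sc1 y).
rewrite (_ : coefficient pi U b (sc x) (sc y) = fun g =>
    (((rnorm x + 1)^-1)%:C * ((rnorm y + 1)^-1)%:C) * coefficient pi U b x y g).
  rewrite (cint_scale hausG haar) => [/eqP|]; last exact: (coefficient_Cc hX rep).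
  rewrite !mulf_eq0 => /orP[/orP[]|/eqP//] /eqP /(congr1 (@complex.Re R)) /= /eqP;
  by rewrite invr_eq0 gt_eqF.
apply/funext => g; rewrite /coefficient /sc.
have C1 := Cc_C0 (Cc_slice g hX cb).
have UZ k z : U g (k *: z) = k *: U g z.
  have U0 : U g 0 = 0 by apply: rnorm_eq0; rewrite (crep_U_rnorm rep) rnorm0.
  by have := crep_U_linear rep g k z 0; rewrite U0 !addr0.
have piZ k z : pi (fun v => b (v, g)) (k *: z) = k *: pi (fun v => b (v, g)) z.
  have pi0 : pi (fun v => b (v, g)) 0 = 0 by have := crep_opB rep 0 0 C1; rewrite !subrr.
  by have := crep_op_linear rep C1 k z 0; rewrite pi0 !addr0.
rewrite UZ piZ hdotZr hdotZl mulrA.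
by congr (_ * _); rewrite conjc_real mulrC.
Qed.
End Coefficients.

(** * Regular representations *)

Lemma sub_telescope (V : zmodType) (p q r s : V) : p - s = (p - q) + ((q - r) + (r - s)).
Proof. by rewrite subrKA subrKA. Qed.

(** The representation of [C_0(X) x G] on the completion of [C_c(G)] induced
    from evaluation at a point [v]. *)
Section Regular.
Variables (R : realType) (G : topologicalGroupType) (X : topologicalType).
Hypotheses (hausG : hausdorff_space G) (lcG : locally_compact [set: G]).
Variables (mu : {measure set (borel G) -> \bar R}) (haar : left_haar mu).
Variables (act : continuousAction G X) (v : X).
Notation Re := complex.Re.
Notation Im := complex.Im.

Let hintP := hint_posfun hausG haar.
Let lG : lch G. Proof. by []. Qed.
Notation CcG := (ccfun R G).

Lemma ccfun_linE (k : R[i]) (f g : CcG) h : (k *: f + g : CcG) h = k * f h + g h.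
Proof. by []. Qed.

Lemma Re_cintegral (f : G -> R[i]) : Re (cintegral mu f) = hint mu (fun h => Re (f h)).
Proof. by []. Qed.

Let dot (f g : CcG) : R[i] := cintegral mu (fun h => conjc (f h) * g h).

Lemma Cc_mulcc (f g : CcG) : Cc (fun h => conjc (f h) * g h : R[i]^o).
Proof. exact: Cc_mull (Cc_conj (ccfunP f)).1 (ccfunP g). Qed.

Let dot_linear f (k : R[i]) g g' : dot f (k *: g + g') = k * dot f g + dot f g'.
Proof.
rewrite /dot -(cint_lin hausG haar k (Cc_mulcc f g) (Cc_mulcc f g')).
by congr cintegral; apply/funext => h; rewrite ccfun_linE; ring.
Qed.

Let dotC f g : dot g f = conjc (dot f g).
Proof.
rewrite /dot -(cint_conj hausG haar (Cc_mulcc f g)); congr cintegral; apply/funext => h.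
by rewrite rmorphM /= conjcK mulrC.
Qed.

Let dot_ge0 f : 0 <= Re (dot f f).
Proof.
apply: (pf_ge0 hintP (Cc_Re (Cc_mulcc f f))) => h.
by rewrite mulrC rnorm_sqr /= sqr_ge0.
Qed.

Definition L2pre : preHilbert R := PreHilbert dot_linear dotC dot_ge0.

Lemma L2_ip (f g : L2pre) : ip f g = cintegral mu (fun h => conjc ((f : CcG) h) * (g : CcG) h).
Proof. by []. Qed.

Definition translate (x : G) (f : L2pre) : L2pre :=
  mkcc (fun h => (f : CcG) (x^-1 * h)%g : R[i]^o).

Lemma translateE x f h : (translate x f : CcG) h = (f : CcG) (x^-1 * h)%g.
Proof.
rewrite mkccE//; have [K cK fK] := Cc_supp (ccfunP (f : CcG)).
apply: (CcI (K := (fun k => (x * k)%g) @` K)) => //.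
- by apply: (ct_comp (f := fun h => (x^-1 * h)%g) (ccfunP (f : CcG)).1); ct.
- by apply: compact_image => //; ct.
- by move=> h' n; apply: fK => k; apply: n; exists (x^-1 * h')%g => //; rewrite mulgA mulgV mul1g.
Qed.

Lemma translateM x y f : translate (x * y)%g f = translate x (translate y f).
Proof. by apply: (@ccfun_eq R G) => h; rewrite !translateE invgM mulgA. Qed.

Lemma translate1 f : translate 1%g f = f.
Proof. by apply: (@ccfun_eq R G) => h; rewrite translateE invg1 mul1g. Qed.

Lemma ip_translate x f g : ip (translate x f) (translate x g) = ip f g.
Proof.
rewrite !L2_ip -(cint_left hausG haar (x^-1)%g (Cc_mulcc f g)); congr cintegral.
by apply/funext => h; rewrite !translateE.
Qed.

Lemma translate_adj x : adjointable (translate x) (translate (x^-1)%g) 1.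
Proof.
split=> [//|f g|f]; last by rewrite mul1r /sn ip_translate.
by rewrite -(ip_translate (x^-1)%g) -translateM mulVg translate1.
Qed.

Lemma translate_adjV x : adjointable (translate (x^-1)%g) (translate x) 1.
Proof. by have := translate_adj (x^-1)%g; rewrite invgK. Qed.

Definition multiply (c : X -> R[i]^o) (f : L2pre) : L2pre :=
  mkcc (fun h => c (act h v) * (f : CcG) h : R[i]^o).

Lemma multiplyE c f h : continuous c -> (multiply c f : CcG) h = c (act h v) * (f : CcG) h.
Proof.
move=> cc; rewrite mkccE//; apply: Cc_mull; last exact: ccfunP.
by apply: (ct_comp (f := fun h => act h v) cc); apply: ct_act; ct.
Qed.

Lemma multiply_lin (k : R[i]) (c c' : X -> R[i]^o) w : continuous c -> continuous c' ->
  multiply (fun x => k * c x + c' x) w = k *: multiply c w + multiply c' w.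
Proof.
move=> cc cc'; apply: (@ccfun_eq R G) => h.
transitivity (k * (multiply c w : CcG) h + (multiply c' w : CcG) h).
  have cs : continuous (fun x => k * c x + c' x : R[i]^o).
    by apply: ctC_add; [apply: ctC_mul; [exact: ct_cst|exact: cc]|exact: cc'].
  rewrite (multiplyE _ _ cs) (multiplyE _ _ cc) (multiplyE _ _ cc').
  move: (c _) (c' _) ((w : CcG) h) => p q r; ring.
exact: esym (ccfun_linE _ _ _ _).
Qed.

Lemma multiply_mul (c c' : X -> R[i]^o) w : continuous c -> continuous c' ->
  multiply (fun x => c x * c' x) w = multiply c (multiply c' w).
Proof.
move=> cc cc'; apply: (@ccfun_eq R G) => h.
by rewrite (multiplyE _ _ (ctC_mul cc cc')) (multiplyE _ _ cc) (multiplyE _ _ cc') mulrA.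
Qed.

Lemma C0_conj c : @C0 R X c -> C0 (fun x => conjc (c x) : R[i]^o).
Proof.
move=> [cc Kc]; split; first exact: ctC_conj.
by move=> e /Kc; congr compact; apply/funext => x /=; rewrite !rnormE rnormJ.
Qed.

Lemma multiply_adj c : C0 c ->
  exists M, adjointable (multiply c) (multiply (fun x => conjc (c x))) M.
Proof.
move=> C0c; have [M M0 cM] := C0_bounded C0c; exists M.
have cc := C0c.1; have cc' := ctC_conj cc.
split=> [|f g|f]; first exact: ltW.
  rewrite !L2_ip; congr cintegral; apply/funext => h.
  rewrite (multiplyE _ _ cc) (multiplyE _ _ cc') rmorphM /=.
  by rewrite -mulrA mulrCA.
rewrite /sn -(ler_sqr _ _) ?nnegrE ?sqrtr_ge0 ?mulr_ge0 ?sqrtr_ge0 ?(ltW M0)//.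
rewrite exprMn !sqr_sqrtr; [|exact: ip_ge0..].
rewrite !L2_ip !Re_cintegral -(pfZ hintP _ (Cc_Re (Cc_mulcc f f))).
apply: (pf_le hintP (Cc_Re (Cc_mulcc _ _)) (ccr_scale _ (Cc_Re (Cc_mulcc f f)))) => h.
rewrite (multiplyE _ _ cc') !(mulrC (conjc _)) !rnorm_sqr /= rnormM rnormJ exprMn.
rewrite mulrC; apply: ler_wpM2r; first exact: sqr_ge0.
by rewrite ler_sqr ?nnegrE ?rnorm_ge0// (ltW M0).
Qed.

Definition regH : hilbertSpace R := hilbert_completion L2pre.
Definition regU (x : G) : regH -> regH := hop (translate (x^-1)%g).
Definition regpi (c : X -> R[i]^o) : regH -> regH := hop (multiply (fun x => conjc (c x))).

Lemma regUE x (F : hcompl L2pre) w : (regU x F : hcompl L2pre) w = F (translate (x^-1)%g w).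
Proof. exact: hopE (translate_adj x) _ _. Qed.

Lemma regpiE c (F : hcompl L2pre) w : C0 c ->
  (regpi c F : hcompl L2pre) w = F (multiply (fun x => conjc (c x)) w).
Proof. by move=> /multiply_adj[M A]; exact: hopE A _ _. Qed.

Lemma regU_emb x f : regU x (hemb f) = hemb (translate x f).
Proof. exact: hop_emb (translate_adj x) f. Qed.

Lemma regpi_emb c f : C0 c -> regpi c (hemb f) = hemb (multiply c f).
Proof. by move=> /multiply_adj[M A]; exact: hop_emb A f. Qed.

Lemma regUM x y F : regU (x * y)%g F = regU x (regU y F).
Proof. by apply: hcompl_eq => w; rewrite !regUE invgM translateM. Qed.

Lemma regU1 F : regU 1%g F = F.
Proof. by apply: hcompl_eq => w; rewrite regUE invg1 translate1. Qed.

Lemma regU_isometry x F F' : hdot (regU x F) (regU x F') = hdot F F'.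
Proof.
rewrite /= (hop_adj (translate_adj x) (translate_adjV x)).
congr (hd F _); transitivity (regU (x^-1)%g (regU x F')).
  by rewrite /regU invgK.
by rewrite -regUM mulVg regU1.
Qed.

Lemma regU_rnorm x F : rnorm (regU x F) = rnorm F.
Proof.
have := regU_isometry x F F; rewrite !hdot_rnorm => /complexI h.
by apply/eqP; rewrite -(@eqrXn2 _ 2)// ?rnorm_ge0// h.
Qed.

Lemma regU_linear x (k : R[i]) F F' : regU x (k *: F + F') = k *: regU x F + regU x F'.
Proof. exact: hop_linear (translate_adj x) _ _ _. Qed.

(** Strong continuity of translations is derived from this weak form, as they are
    isometric. *)
Lemma ct_ip_translate (f w : L2pre) : continuous (fun x => ip (translate x f) w : R[i]^o).
Proof.
have [K cK fK] := Cc_supp (ccfunP (w : CcG)).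
pose F x h : R[i]^o := conjc ((f : CcG) (x^-1 * h)%g) * (w : CcG) h.
have cF : continuous (fun p : G * G => F p.1 p.2).
  apply: ctC_mul.
    apply: ctC_conj.
    by apply: (ct_comp (f := fun p : G * G => (p.1^-1 * p.2)%g) (ccfunP (f : CcG)).1); ct.
  by apply: (ct_comp (f := fun p : G * G => p.2) (ccfunP (w : CcG)).1); ct.
have [c1 c2] := (ctC_P _).1 cF.
have FE x : ip (translate x f) w = cintegral mu (F x).
  by rewrite L2_ip; congr cintegral; apply/funext => h; rewrite translateE.
have F0 x h : ~ K h -> F x h = 0 by move=> /fK wh; rewrite /F wh mulr0.
apply/ctC_P; split.
  apply: (ct_ext (f := fun x => hint mu (fun h => Re (F x h)))); last by move=> x; rewrite FE.
  apply: (pf_param (F := fun x h => Re (F x h)) lG hintP) => // x0.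
  by exists K => //; near=> x => h /(F0 x) ->.
apply: (ct_ext (f := fun x => hint mu (fun h => Im (F x h)))); last by move=> x; rewrite FE.
apply: (pf_param (F := fun x h => Im (F x h)) lG hintP) => // x0.
by exists K => //; near=> x => h /(F0 x) ->.
Unshelve. all: by end_near. Qed.

Lemma hdot_emb (f g : L2pre) : hdot (hemb f : regH) (hemb g) = ip f g.
Proof. exact: hd_emb. Qed.

Lemma regU_continuous F : continuous (fun x => regU x F).
Proof.
move=> x0 A /nbhs_rnorm[e e0 HA].
have e3 : 0 < e / 3 by rewrite divr_gt0.
have [f Hf] := hemb_dense F e3.
have cf : continuous (fun x => ip (translate x f) (translate x0 f) : R[i]^o).
  exact: ct_ip_translate.
have d0 : 0 < (e / 3) ^+ 2 / 3 by rewrite divr_gt0// exprn_gt0.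
have /ctC_epsP /(_ x0 _ d0) := cf; apply: filterS => x Hx; apply: HA.
have E : rnorm (hemb (translate x0 f) - hemb (translate x f) : regH) ^+ 2 <= 2 * ((e / 3) ^+ 2 / 3).
  have : hdot (hemb (translate x0 f) - hemb (translate x f) : regH)
              (hemb (translate x0 f) - hemb (translate x f)) =
      (ip (translate x0 f) (translate x0 f) - ip (translate x f) (translate x0 f)) +
      conjc (ip (translate x0 f) (translate x0 f) - ip (translate x f) (translate x0 f)).
    have cB (p q : R[i]) : conjc (p - q) = conjc p - conjc q by exact: rmorphB.
    rewrite hdotBr !hdotBl !hdot_emb cB -!ipC !ip_translate.
    move: (ip f f) (ip _ _) (ip _ _) => p q r; ring.
  rewrite hdot_rnorm; set z := ip _ _ - ip _ _ => /(congr1 (@complex.Re R)).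
  rewrite ReD ReJ [LHS]/= => ->; rewrite mulr_natl mulr2n.
  by apply: lerD; apply: le_trans (le_trans (ler_norm _) (ReX2_le z)) Hx.
have E' : rnorm (hemb (translate x0 f) - hemb (translate x f) : regH) < e / 3.
  rewrite -(ltr_pXn2r (n := 2))// ?nnegrE ?rnorm_ge0 ?(ltW e3)//.
  apply: (le_lt_trans E); rewrite mulrA ltr_pdivrMr// mulrC ltr_pM2l ?exprn_gt0//.
  by rewrite ltr_nat.
have -> : regU x0 F - regU x F = (regU x0 F - regU x0 (hemb f)) +
   ((regU x0 (hemb f) - regU x (hemb f)) + (regU x (hemb f) - regU x F)).
  exact: sub_telescope.
have UB y F1 F2 : regU y F1 - regU y F2 = regU y (F1 - F2).
  exact: (hopB (translate_adj y) F1 F2).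
apply: (le_lt_trans (rnormD _ _)).
have -> : e = e / 3 + (e / 3 + e / 3) by field.
apply: ler_ltD; first by rewrite UB regU_rnorm; exact: Hf.
apply: (le_lt_trans (rnormD _ _)); apply: ltr_leD; first by rewrite !regU_emb.
by rewrite UB regU_rnorm rdistC; exact: Hf.
Qed.

Lemma regular_rep : covariant_rep act regpi regU.
Proof.
have C0ct (c : X -> R[i]^o) : C0 c -> continuous c by case.
have cj (c : X -> R[i]^o) : C0 c -> continuous (fun x => conjc (c x) : R[i]^o) by move=> /C0ct; exact: ctC_conj.
split.
- by move=> c /multiply_adj[M A] k x y; exact: hop_linear A _ _ _.
- move=> k c c' C0c C0c' F; apply: hcompl_eq => w.
  have cc := C0ct _ C0c; have cc' := C0ct _ C0c'.
  have [M A] := multiply_adj C0c; have [M' A'] := multiply_adj C0c'.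
  have lin z : multiply (fun x => conjc (k * c x + c' x)) z =
      conjc k *: multiply (fun x => conjc (c x)) z + multiply (fun x => conjc (c' x)) z.
    rewrite -multiply_lin; [|exact: cj..].
    by congr (multiply _ z); apply/funext => x; rewrite rmorphD rmorphM.
  have adjs : adjointable (multiply (fun x => k * c x + c' x : R[i]^o))
     (multiply (fun x => conjc (k * c x + c' x))) (rnorm k * M + M').
    have [M0 A1 A2] := A; have [M0' A1' A2'] := A'.
    split; first by rewrite addr_ge0// mulr_ge0// rnorm_ge0.
      by move=> f g; rewrite multiply_lin// lin ipDl ipZl A1 A1' ip_linear.
    have snE (z : L2pre) : sn z = rnorm (hemb z) by rewrite hemb_rnorm.
    move=> f; rewrite lin !snE hembD (le_trans (rnormD _ _))// rnormZ rnormJ mulrDl; apply: lerD.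
      by rewrite -mulrA; apply: ler_wpM2l; [exact: rnorm_ge0|rewrite -!snE].
    by rewrite -!snE.
  by rewrite /regpi (hopE adjs) hvalD hvalZ (hopE A) (hopE A') lin hval_antilinear conjcK.
- move=> c c' C0c C0c' F; apply: hcompl_eq => w.
  have cc := C0ct _ C0c; have cc' := C0ct _ C0c'.
  have [M A] := multiply_adj C0c; have [M' A'] := multiply_adj C0c'.
  have lin z : multiply (fun x => conjc (c x * c' x)) z =
      multiply (fun x => conjc (c' x)) (multiply (fun x => conjc (c x)) z).
    rewrite -multiply_mul; [|exact: cj..].
    by congr (multiply _ z); apply/funext => x; rewrite rmorphM mulrC.
  have adjs : adjointable (multiply (fun x => c x * c' x : R[i]^o))
     (multiply (fun x => conjc (c x * c' x))) (M' * M).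
    have [M0 A1 A2] := A; have [M0' A1' A2'] := A'.
    split=> [|f g|f]; first exact: mulr_ge0.
      by rewrite lin -A1' -A1 multiply_mul//; congr (ip _ g).
    rewrite lin (le_trans (A2' _))// -mulrA; exact: ler_wpM2l.
  by rewrite /regpi (hopE adjs) lin (hopE A) (hopE A').
- move=> c C0c x y.
  have [M A] := multiply_adj C0c; have [M' A'] := multiply_adj (C0_conj C0c).
  rewrite (_ : (fun x : X => conjc (conjc (c x))) = c) in A'; last by apply/funext => z; rewrite conjcK.
  rewrite /= (hop_adj A A') /regpi.
  by congr (hd x (hop (multiply _) y)); apply/funext => z; rewrite conjcK.
- exact: regU_linear.
- exact: regU1.
- exact: regUM.
- exact: regU_isometry.
- exact: regU_continuous.
- move=> x c C0c F; apply: hcompl_eq => w.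
  have cc := C0ct _ C0c.
  have C0t : C0 (fun y => c (act (x^-1)%g y) : R[i]^o).
    split; first by apply: (ct_comp (f := fun y => act (x^-1)%g y) cc); apply: ct_act; ct.
    move=> e e0; have := C0c.2 e e0 => /(compact_image (f := act x)) H.
    have /H : continuous (act x) by apply: (ct_act (f := fun=> x) (g := id)); ct.
    congr compact; apply/seteqP; split=> [_ [y Hy <-]|y /= Hy] /=; first by rewrite gactVK.
    by exists (act (x^-1)%g y) => //; rewrite gactKV.
  rewrite regpiE// regUE regpiE// regUE invgK; congr (F _).
  apply: (@ccfun_eq R G) => h.
  rewrite multiplyE; last exact: ctC_conj C0t.1.
  rewrite translateE multiplyE; last exact: cj.
  by rewrite translateE invgK mulgA mulgV mul1g -gactM.
Qed.
End Regular.

Section Injectivity.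
Variables (R : realType) (G : topologicalGroupType) (X : topologicalType).
Hypotheses (hausG : hausdorff_space G) (lcG : locally_compact [set: G]).
Variables (mu : {measure set (borel G) -> \bar R}) (haar : left_haar mu).
Variables (Delta : G -> R) (act : continuousAction G X) (hX : hausdorff_space X).
Notation Re := complex.Re.
Notation Im := complex.Im.

Let lG : lch G. Proof. by []. Qed.
Let hintP := hint_posfun hausG haar.

(** If [z = c (v, g0)] were nonzero, the real part of [conj(z) c(h v, g)] would be
    positive for [h] near [1] and [g] near [g0].  The coefficient of the regular
    representation at [v] against bump functions near [1] and near [g0^-1] would
    then be positive. *)
Lemma full_norm_eq0 (c : X * G -> R[i]^o) : Cc c -> full_norm mu act c = 0 ->
  forall p, c p = 0.
Proof.
move=> cc c0 [v g0]; apply: contrapT => /eqP nz.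
pose z := c (v, g0).
have z0 : 0 < rnorm z.
  by rewrite lt_def rnorm_ge0 andbT; apply: contra_neq nz => /rnorm_eq0.
pose q (h g : G) : R := Re (conjc z * c (act h v, g)).
have cq : continuous (fun p : G * G => q p.1 p.2).
  have : continuous (fun p : G * G => conjc z * c (act p.1 v, p.2) : R[i]^o).
    apply: ctC_mul; first exact: ct_cst.
    apply: (ct_comp (f := fun p : G * G => (act p.1 v, p.2)) cc.1).
    by apply: ct_pair; [apply: ct_act; ct|ct].
  by move=> /ctC_P[].
have q0 : 0 < q 1%g g0.
  by rewrite /q gact1 -/z mulrC rnorm_sqr /= exprn_gt0.
pose t (p : G * G) := q p.1 (p.1 * p.2^-1)%g.
have ctt : continuous t.
  by apply: (ct_comp (f := fun p : G * G => (p.1, (p.1 * p.2^-1)%g)) cq); ct.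
have oT : open [set p : G * G | 0 < t p] by exact: open_gtf.
have T1 : nbhs (1%g, (g0^-1)%g) [set p : G * G | 0 < t p].
  by apply: open_nbhs_nbhs; split=> //=; rewrite /t /= invgK mul1g.
have [[A B] [/= A1 Bg] AB] := T1.
have [w [cw w01 w1 [Kw [cKw KwA wK]]]] := bump_pt R lG (open_interior A) A1.
have [u [cu u01 u1 [Ku [cKu KuB uK]]]] := bump_pt R lG (open_interior B) Bg.
have ccw : ccr w by split=> //; exists Kw.
have ccu : ccr u by split=> //; exists Ku.
have w0 h : 0 <= w h by have /andP[] := w01 h.
have u0 h : 0 <= u h by have /andP[] := u01 h.
(* The factor [z] makes the integrand of the coefficient have real part [Q]. *)
pose W : L2pre hausG haar := mkcc (fun h => z * (w h)%:C : R[i]^o).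
pose V : L2pre hausG haar := mkcc (fun h => (u h)%:C : R[i]^o).
have WE h : (W : ccfun R G) h = z * (w h)%:C.
  by rewrite mkccE//; apply: Cc_mull; [exact: ct_cst|exact: Cc_real].
have VE h : (V : ccfun R G) h = (u h)%:C by rewrite mkccE//; exact: Cc_real.
have := full_norm0_coefficient hausG lcG haar hX cc (regular_rep hausG lcG haar act v) c0 (hemb W) (hemb V).
pose Q (p : G * G) := w p.2 * (u (p.1^-1 * p.2)%g * q p.2 p.1).
move=> /(congr1 (@complex.Re R)); rewrite Re_cintegral.
have -> : (fun g => Re (coefficient (regpi act v) (regU (haar := haar)) c (hemb W) (hemb V) g)) =
    (fun g => hint mu (fun h => Q (g, h))).
  apply/funext => g; rewrite /coefficient regU_emb regpi_emb; last first.
    by apply: Cc_C0; exact: Cc_slice.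
  rewrite hdot_emb L2_ip Re_cintegral; congr hint; apply/funext => h.
  rewrite multiplyE; last exact: (Cc_slice _ hX cc).1.
  rewrite translateE WE VE /Q /q /=.
  by move: {+}z (c _) => [z1 z2] [c1 c2] /=; ring.
have Q0 p : 0 <= Q p.
  rewrite /Q; have [Kw2|/wK ->] := pselect (Kw p.2); last by rewrite mul0r.
  have [Ku2|/uK ->] := pselect (Ku (p.1^-1 * p.2)%g); last by rewrite mul0r mulr0.
  apply: mulr_ge0 => //; apply: mulr_ge0 => //; apply: ltW.
  have := AB (p.2, (p.1^-1 * p.2)%g); rewrite /= /t /= invgM invgK mulgA mulgV mul1g.
  by apply; split; apply: interior_subset; [exact: KwA|exact: KuB].
have cQ : ccr Q.
  split.
    apply: ct_mul; first by apply: (ct_comp (f := fun p : G * G => p.2) cw); ct.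
    apply: ct_mul; first by apply: (ct_comp (f := fun p : G * G => (p.1^-1 * p.2)%g) cu); ct.
    by apply: (ct_comp (f := fun p : G * G => (p.2, p.1)) cq); ct.
  exists ((fun p : G * G => ((p.1 * p.2^-1)%g, p.1)) @` (Kw `*` Ku)).
    by apply: compact_image; [ct|exact: compact_setX].
  move=> p n; rewrite /Q; have [Kw2|/wK ->] := pselect (Kw p.2); last by rewrite mul0r.
  have [Ku2|/uK ->] := pselect (Ku (p.1^-1 * p.2)%g); last by rewrite mul0r mulr0.
  case: n; exists (p.2, (p.1^-1 * p.2)%g) => //=.
  by rewrite invgM invgK mulgA mulgV mul1g; case: (p).
have pos : 0 < hint mu (fun g => hint mu (fun h => Q (g, h))).
  apply: (hint_gt0 hausG haar (x := g0)).
  - exact: (ccr_pfr lG hintP cQ).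
  - by move=> g; apply: (pf_ge0 hintP) => //; exact: ccr_slice.
  apply: (hint_gt0 hausG haar (x := 1%g)) => //; first exact: ccr_slice.
  by rewrite /Q /= mulg1 w1 u1 !mul1r.
by move=> e; move: pos; rewrite e ltxx.
Qed.

(** The full norm is a norm on [C_c(X x G)]: the regular representations
    separate its points. *)
Lemma crossed_inj (B : cstarAlgType R) (i : (X * G -> R[i]^o) -> B) :
  is_crossed_product mu Delta act i -> forall b c, Cc b -> Cc c -> i b = i c -> b = c.
Proof.
move=> iP b c cb cc bc; apply/funext => p.
have cd : Cc (fun p => -1 * b p + c p : R[i]^o) by exact: Cc_lin.
have := cp_norm iP cd; rewrite (cp_linear iP _ cb cc) bc scaleN1r addNr normr0.
move=> /esym /complexI /(full_norm_eq0 cd) /(_ p) /eqP.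
by rewrite mulN1r addrC subr_eq0 => /eqP.
Qed.
End Injectivity.

(** * Invariance of fibre integrals under a cocycle *)

Section Invariance.
Variables (R : realType) (G : topologicalGroupType).
Hypotheses (hausG : hausdorff_space G) (lcG : locally_compact [set: G]).
Variables (mu : {measure set (borel G) -> \bar R}) (haar : left_haar mu).
Variables (Delta : G -> R) (modular : modular_function mu Delta).
Variables (E : topologicalGraph) (a : graphAction G E).
Variables (phi : G -> edge E -> G) (cphi : is_cocycle a phi).
Variables (B : cstarAlgType R) (i : (vertex E * G -> R[i]^o) -> B).
Hypothesis crossedB : is_crossed_product mu Delta (vact a) i.
Variables (Y : correspondence B) (j : (edge E * G -> R[i]^o) -> Y).
Hypothesis corrY : is_cocycle_correspondence mu a phi i j.
Notation Re := complex.Re.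

Let lG : lch G. Proof. by []. Qed.
Let lV := lch_vertex E.
Let lE := lch_edge E.
Let lP : lch (edge E * G)%type. Proof. exact: lch_prod. Qed.
Let hintP := hint_posfun hausG haar.
Let LP v := fibre_int_posfun hausG haar a v.
Let P := (edge E * G)%type.
Notation tau := (cocycle_act a phi).

Let ctau2 : continuous (fun q : G * P => tau q.1 q.2).
Proof.
apply: ct_pair; first by apply: ct_act; ct.
apply: ct_mulg; last by ct.
by apply: (ct_comp (f := fun q : G * P => (q.1, q.2.1)) (cocycle_continuous cphi)); ct.
Qed.

Lemma Cc_realI (X : topologicalType) (u : X -> R) :
  Cc (fun x => (u x)%:C : R[i]^o) -> ccr u.
Proof. exact: Cc_Re. Qed.

Lemma cint_real (f : G -> R) : cintegral mu (fun h => (f h)%:C) = (hint mu f)%:C.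
Proof. by apply: complex_eq => //=; exact: (pf0 hintP). Qed.

Lemma y_inner_real v (x y : P -> R) : ccr x ->
  Re (y_inner mu a (fun p => (x p)%:C) (fun p => (y p)%:C) (v, 1%g)) =
  fibre_int mu a v (fun p => x p * y p).
Proof.
move=> cx; have [_ [K cK xK]] := cx.
have cK1 : compact (fst @` K) by apply: compact_image => //; exact: ct_fst.
rewrite /y_inner Re_cintegral /fibre_int; congr hint; apply/funext => h.
rewrite -/(fibre_sum (fun e => conjc (x (e, h))%:C * (y (e, (h * 1)%g))%:C) _).
rewrite (fibre_sum_morph (f := @complex.Re R) _ cK1) => //; last exact: ReD.
  by apply: eq_fibre_sum => e _; rewrite /= mulg1; ring.
by move=> e n; rewrite xK ?conjc0 ?mul0r// => k; apply: n; exists (e, h).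
Qed.

(** Adjointness of the left action, tested on real functions of product form. *)
Lemma adjoint_real v (be : vertex E -> R) (ga : G -> R) (x y : P -> R) :
  ccr be -> ccr ga -> ccr x -> ccr y ->
  hint mu (fun k => ga k * fibre_int mu a v (fun p =>
     be (range_map p.1) * x (tau (k^-1)%g p) * y p)) =
  hint mu (fun k => ga k * fibre_int mu a v (fun p =>
     be (vact a k (range_map p.1)) * x p * y (tau k p))).
Proof.
move=> cbe cga cx cy.
have hVG := (lch_prod lV lG).2.
pose b (p : vertex E * G) : R[i]^o := (be p.1 * ga p.2)%:C.
have cb : Cc b by apply: Cc_real => //; exact: ccr_tensor.
have cX : Cc (fun p => (x p)%:C : R[i]^o) by apply: Cc_real => //; exact: lP.2.
have cY : Cc (fun p => (y p)%:C : R[i]^o) by apply: Cc_real => //; exact: lP.2.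
have cbs : Cc (cp_star Delta (vact a) b) by apply: (cp_star_Cc hausG haar modular) => //; exact: lV.2.
have := lact_star (i b) (j (fun p => (x p)%:C)) (j (fun p => (y p)%:C)).
rewrite -(cp_starE crossedB cb) -(yc_lact corrY cb cX) -(yc_lact corrY cbs cY).
have cl1 := y_lact_Cc hausG lcG haar cphi cb cX.
have cl2 := y_lact_Cc hausG lcG haar cphi cbs cY.
rewrite (yc_inner corrY cl1 cY) (yc_inner corrY cX cl2).
move/(crossed_inj hausG lcG haar lV.2 crossedB (y_inner_Cc hausG lcG haar a cl1 cY)
  (y_inner_Cc hausG lcG haar a cX cl2)).
move/(congr1 (fun f => Re (f (v, 1%g)))).
have cact p : continuous (fun k => tau (k^-1)%g p).
  by apply: (ct_comp (f := fun k => ((k^-1)%g, p)) ctau2); ct.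
have cact' p : continuous (fun k => tau k p).
  by apply: (ct_comp (f := fun k => (k, p)) ctau2); ct.
have cr k : continuous (fun e : edge E => vact a k (range_map e)).
  by apply: ct_act; [exact: ct_cst|exact: range_continuous].
have cr' e : continuous (fun k : G => vact a k (range_map e)).
  by apply: ct_act; [exact: ct_id|exact: ct_cst].
pose l1 p := hint mu (fun k => be (range_map p.1) * ga k * x (tau (k^-1)%g p)).
have l1E : y_lact mu a phi b (fun p => (x p)%:C) = (fun p => (l1 p)%:C).
  apply/funext => p; rewrite /y_lact /l1 -cint_real; congr cintegral; apply/funext => k.
  by rewrite /b /= -!rmorphM.
pose l2 p := hint mu (fun k => be (vact a k (range_map p.1)) * ga k * y (tau k p)).
have l2E : y_lact mu a phi (cp_star Delta (vact a) b) (fun p => (y p)%:C) = (fun p => (l2 p)%:C).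
  apply/funext => p; rewrite /l2 -(hint_inv hausG lcG haar modular); last first.
    apply: ccr_mulr; first by apply: (ct_comp (f := fun k => tau k p) cy.1).
    by apply: ccr_mull => //; apply: (ct_comp (f := fun k => vact a k (range_map p.1)) cbe.1).
  rewrite -cint_real /y_lact; congr cintegral; apply/funext => k.
  rewrite /cp_star /b conjc_real -!rmorphM; congr (_%:C).
  by rewrite /= (DeltaV hausG haar modular); ring.
have cl1r : ccr l1 by apply: Cc_realI; rewrite -l1E.
rewrite l1E l2E (y_inner_real v y cl1r) (y_inner_real v l2 cx).
pose F1 (q : P * G) := be (range_map q.1.1) * ga q.2 * x (tau (q.2^-1)%g q.1) * y q.1.
pose F2 (q : P * G) := be (vact a q.2 (range_map q.1.1)) * ga q.2 * y (tau q.2 q.1) * x q.1.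
have [cga1 [Kg cKg gK]] := cga; have [cx1 [Kx cKx xK]] := cx; have [cy1 [Ky cKy yK]] := cy.
have cF1 : ccr F1.
  split; last first.
    exists (Ky `*` Kg); first exact: compact_setX.
    move=> [p k] n; rewrite /F1 /=; have [Kp|/yK ->] := pselect (Ky p); last by rewrite mulr0.
    by rewrite gK ?mulr0 ?mul0r// => Kk; apply: n.
  apply: ct_mul; last by apply: (ct_comp (f := fun q : P * G => q.1) cy1); ct.
  apply: ct_mul; last first.
    apply: (ct_comp (f := fun q : P * G => tau (q.2^-1)%g q.1) cx1).
    by apply: (ct_comp (f := fun q : P * G => ((q.2^-1)%g, q.1)) ctau2); ct.
  apply: ct_mul; last by apply: (ct_comp (f := fun q : P * G => q.2) cga1); ct.
  apply: (ct_comp (f := fun q : P * G => range_map q.1.1) cbe.1).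
  by apply: (ct_comp (f := fun q : P * G => q.1.1) (@range_continuous E)); ct.
have cF2 : ccr F2.
  split; last first.
    exists (Kx `*` Kg); first exact: compact_setX.
    move=> [p k] n; rewrite /F2 /=; have [Kp|/xK ->] := pselect (Kx p); last by rewrite mulr0.
    by rewrite gK ?mulr0 ?mul0r// => Kk; apply: n.
  apply: ct_mul; last by apply: (ct_comp (f := fun q : P * G => q.1) cx1); ct.
  apply: ct_mul; last first.
    apply: (ct_comp (f := fun q : P * G => tau q.2 q.1) cy1).
    by apply: (ct_comp (f := fun q : P * G => (q.2, q.1)) ctau2); ct.
  apply: ct_mul; last by apply: (ct_comp (f := fun q : P * G => q.2) cga1); ct.
  apply: (ct_comp (f := fun q : P * G => vact a q.2 (range_map q.1.1)) cbe.1).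
  apply: ct_act; first by ct.
  by apply: (ct_comp (f := fun q : P * G => q.1.1) (@range_continuous E)); ct.
have E1 : (fun p => l1 p * y p) = (fun p => hint mu (fun k => F1 (p, k))).
  apply/funext => p; rewrite /l1 -(pf_scaler hintP)//.
  apply: ccr_mulr; first by apply: (ct_comp (f := fun k => tau (k^-1)%g p) cx1).
  exact: ccr_scale.
have E2 : (fun p => x p * l2 p) = (fun p => hint mu (fun k => F2 (p, k))).
  apply/funext => p; rewrite mulrC /l2 -(pf_scaler hintP)//.
  apply: ccr_mulr; first by apply: (ct_comp (f := fun k => tau k p) cy1).
  by apply: ccr_mull => //; apply: (ct_comp (f := fun k => vact a k (range_map p.1)) cbe.1).
rewrite E1 E2 (pf_fubini lP lG (LP v) hintP cF1) (pf_fubini lP lG (LP v) hintP cF2) => H.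
have cS1 k : ccr (fun p : P => be (range_map p.1) * x (tau (k^-1)%g p) * y p).
  apply: ccr_mull => //; apply: ct_mul.
    by apply: (ct_comp (f := fun p : P => range_map p.1) cbe.1); apply: (ct_comp (f := fun q : P => q.1) (@range_continuous E)); ct.
  apply: (ct_comp (f := fun p : P => tau (k^-1)%g p) cx1).
  by apply: (ct_comp (f := fun p : P => ((k^-1)%g, p)) ctau2); ct.
have cS2 k : ccr (fun p : P => be (vact a k (range_map p.1)) * x p * y (tau k p)).
  apply: ccr_mulr.
    apply: (ct_comp (f := fun p : P => tau k p) cy1).
    by apply: (ct_comp (f := fun p : P => (k, p)) ctau2); ct.
  apply: ccr_mull => //.
  apply: (ct_comp (f := fun p : P => vact a k (range_map p.1)) cbe.1).
  by apply: (ct_comp (f := fun q : P => q.1) (cr k)); ct.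
transitivity (hint mu (fun k => fibre_int mu a v (fun p => F1 (p, k)))).
  congr hint; apply/funext => k; rewrite -(pfZ (LP v))//.
  by congr fibre_int; apply/funext => p; rewrite /F1 /=; ring.
rewrite H; congr hint; apply/funext => k; rewrite -(pfZ (LP v))//.
by congr fibre_int; apply/funext => p; rewrite /F2 /=; ring.
Qed.

(** The function [ga] of [adjoint_real] is arbitrary, so the two integrands agree: take
    [ga] to be their difference times a bump function. *)
Lemma fibre_int_adjoint v k (be : vertex E -> R) (x y : P -> R) :
  ccr be -> ccr x -> ccr y ->
  fibre_int mu a v (fun p => be (range_map p.1) * x (tau (k^-1)%g p) * y p) =
  fibre_int mu a v (fun p => be (vact a k (range_map p.1)) * x p * y (tau k p)).
Proof.
move=> cbe cx cy; have [cx1 [Kx cKx xK]] := cx; have [cy1 [Ky cKy yK]] := cy.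
pose F1 k (p : P) := be (range_map p.1) * x (tau (k^-1)%g p) * y p.
pose F2 k (p : P) := be (vact a k (range_map p.1)) * x p * y (tau k p).
pose D k := fibre_int mu a v (F1 k) - fibre_int mu a v (F2 k).
have cr : continuous (fun q : G * P => range_map q.2.1).
  by apply: (ct_comp (f := fun q : G * P => q.2.1) (@range_continuous E)); ct.
have cF1 : continuous (fun k => fibre_int mu a v (F1 k)).
  apply: (pf_param (F := F1) lP (LP v)); last first.
    move=> k0; exists Ky => //; near=> k' => p /yK yp.
    by rewrite /F1 yp mulr0.
  apply: ct_mul; last by apply: (ct_comp (f := fun q : G * P => q.2) cy1); ct.
  apply: ct_mul; first exact: (ct_comp cbe.1 cr).
  apply: (ct_comp (f := fun q : G * P => tau (q.1^-1)%g q.2) cx1).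
  by apply: (ct_comp (f := fun q : G * P => ((q.1^-1)%g, q.2)) ctau2); ct.
have cF2 : continuous (fun k => fibre_int mu a v (F2 k)).
  apply: (pf_param (F := F2) lP (LP v)); last first.
    move=> k0; exists Kx => //; near=> k' => p /xK xp.
    by rewrite /F2 xp mulr0 mul0r.
  apply: ct_mul.
    apply: ct_mul; last by apply: (ct_comp (f := fun q : G * P => q.2) cx1); ct.
    by apply: (ct_comp (f := fun q : G * P => vact a q.1 (range_map q.2.1)) cbe.1); apply: ct_act; [ct|].
  by apply: (ct_comp (f := fun q : G * P => tau q.1 q.2) cy1); exact: ctau2.
have cD : continuous D by exact: ct_sub.
apply/eqP; rewrite -subr_eq0; apply: contrapT => /negP Dk.
have [w [cw w01 w1]] := @ccr_bump R G [set k] lG (@compact_set1 _ k).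
have w0 h : 0 <= w h by have /andP[] := w01 h.
have cga : ccr (fun h => D h * w h) by exact: ccr_mull.
have := adjoint_real v cbe cga cx cy.
move/eqP; rewrite -subr_eq0 -(pfB hintP); [|exact: ccr_mulr..].
have : 0 < hint mu (fun h => D h * w h * D h).
  apply: (hint_gt0 hausG haar (x := k)); first exact: ccr_mulr.
    by move=> h; rewrite mulrAC mulr_ge0// -expr2 sqr_ge0.
  by rewrite w1// mulr1 -expr2 lt_def sqr_ge0 andbT sqrf_eq0.
rewrite (_ : (fun h => D h * w h * D h) = (fun h => D h * w h * fibre_int mu a v (F1 h) - D h * w h * fibre_int mu a v (F2 h))).
  by move=> pos /eqP e; move: pos; rewrite e ltxx.
by apply/funext => h; rewrite -mulrBr.
Unshelve. all: by end_near. Qed.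

(** The fibre integrals are invariant under the cocycle action: this is what
    adjointability of the left action means on functions. *)
Lemma fibre_int_cocycle k v (H : P -> R) : ccr H ->
  fibre_int mu a v (fun p => H (tau k p)) = fibre_int mu a v H.
Proof.
move=> cH; have [cH1 [K cK HK]] := cH.
have ctau h : continuous (tau h).
  by apply: (ct_comp (f := fun p : P => (h, p)) ctau2); ct.
have cK1 : compact ((fun p : P => range_map p.1) @` K).
  apply: compact_image => //.
  by apply: (ct_comp (f := fun q : P => q.1) (@range_continuous E)); ct.
have cK2 : compact (tau (k^-1)%g @` K) by apply: compact_image.
(* [be] is 1 on the ranges of the support of [H] and [x] is 1 on its translate, so
   that only [H] remains. *)
have [be [cbe _ be1]] := ccr_bump R lV cK1.
have [x [cx _ x1]] := ccr_bump R lP cK2.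
have := fibre_int_adjoint v k cbe cx cH.
have -> : (fun p => be (range_map p.1) * x (tau (k^-1)%g p) * H p) = H.
  apply/funext => p; have [Kp|/HK ->] := pselect (K p); last by rewrite mulr0.
  by rewrite be1 ?x1 ?mul1r//; exists p.
move=> ->; congr fibre_int; apply/funext => p.
have [Kp|/HK ->] := pselect (K (tau k p)); last by rewrite mulr0.
rewrite -(range_equivariant a) be1; last by exists (tau k p).
rewrite x1 ?mul1r//; exists (tau k p) => //.
exact: cocycle_actK.
Qed.
End Invariance.

(** * Completeness, automatic continuity and extension of isometries *)

Section Complete.
Variables (R : realType) (V : completeNormedModType R[i]).

(** Completeness in a form that spares the choice of sequences. *)
Lemma shrinking_limit (A : R -> set V) : (forall e, 0 < e -> A e !=set0) ->
  (forall d e, d <= e -> A d `<=` A e) ->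
  (forall e, 0 < e -> exists2 d, 0 < d & forall x y, A d x -> A d y -> rnorm (x - y) < e) ->
  exists l, forall e, 0 < e -> exists2 d, 0 < d & forall x, A d x -> rnorm (l - x) < e.
Proof.
move=> A0 mono small; pose F := filter_from [set e : R | 0 < e] A.
have PF : ProperFilter F.
  apply: filter_from_proper; last exact: A0.
  apply: filter_from_filter; first by exists 1 => /=.
  move=> d e d0 e0; exists (Num.min d e); first by rewrite /= lt_min; apply/andP.
  by move=> x Ax; split; apply: mono Ax; rewrite ge_min lexx ?orbT.
have : cvg F.
  apply: (cauchy_cvg F); apply/(cauchy_ballP F) => _ /pos_complex[e e0 ->].
  have [d d0 Hd] := small e e0.
  by exists (A d, A d) => /=; [split; exists d|move=> [x y] [/= h1 h2]; apply/rball; exact: Hd].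
move=> /cvg_ex[/= l Hl]; exists l => e e0.
have /Hl[d d0 Ad] : nbhs l [set x | rnorm (l - x) < e] by apply/nbhs_rnorm; exists e.
by exists d => // x /Ad.
Qed.

Lemma closed_rnorm (U : set V) x : closed U ->
  (forall e, 0 < e -> exists2 y, U y & rnorm (x - y) < e) -> U x.
Proof.
move=> cU H; apply: cU => O /nbhs_rnorm[e e0 HO].
by have [y Uy h] := H e e0; exists y; split=> //; exact: HO.
Qed.

(** The sets of [e]-almost fixed points shrink to the fixed point: they are nonempty
    because the iterates of [f] enter them, and small because [f] contracts. *)
Lemma contraction_fixed (U : set V) (f : V -> V) (q : R) x0 : closed U -> U x0 ->
  (forall x, U x -> U (f x)) -> 0 <= q < 1 ->
  (forall x y, U x -> U y -> rnorm (f x - f y) <= q * rnorm (x - y)) ->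
  exists2 x, U x & f x = x.
Proof.
move=> cU Ux0 Uf /andP[q0 q1] fq.
have q1' : 0 < 1 - q by rewrite subr_gt0.
pose A e := [set x | U x /\ rnorm (f x - x) <= e].
have A0 e : 0 < e -> A e !=set0.
  move=> e0; pose y n := iter n f x0.
  have Uy n : U (y n) by elim: n => //= n; exact: Uf.
  set C := rnorm (f x0 - x0) + 1.
  have C0 : 0 < C by rewrite ltr_wpDl// rnorm_ge0.
  have yC n : rnorm (y n.+1 - y n) <= q ^+ n * C.
    elim: n => [|n IH]; first by rewrite expr0 mul1r lerDl ler01.
    apply: (le_trans (fq _ _ (Uy n.+1) (Uy n))).
    by rewrite exprS -mulrA; apply: ler_wpM2l.
  have : (fun n => C * q ^+ n) @ \oo --> (0 : R).
    by have := @cvg_geometric R C q; rewrite ger0_norm//; apply.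
  move=> /cvgrPdist_lt /(_ e e0) [n _ /(_ n (leqnn n))] /=.
  rewrite sub0r normrN ger0_norm; last by rewrite mulr_ge0 ?exprn_ge0// ltW.
  move=> h; exists (y n); split; first exact: Uy.
  by apply: (le_trans (yC n)); rewrite mulrC ltW.
have [||e e0|l Hl] := @shrinking_limit A.
- exact: A0.
- by move=> d e de x [Ux h]; split=> //; exact: le_trans de.
- exists (e * (1 - q) / 3); first by rewrite divr_gt0// mulr_gt0.
  move=> x y [Ux hx] [Uy hy].
  have h : rnorm (x - y) <= rnorm (f x - x) + q * rnorm (x - y) + rnorm (f y - y).
    have E0 : x - y = - (f x - x) + (f x - f y) + (f y - y).
      by rewrite opprB -!addrA; congr (_ + _); rewrite addKr addKr.
    rewrite {1}E0; apply: (le_trans (rnormD _ _)); apply: lerD => //.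
    apply: (le_trans (rnormD _ _)); rewrite rnormN lerD2l; exact: fq.
  move: h hx hy; move: (rnorm (x - y)) (rnorm _) (rnorm _) => r s t h hs ht.
  have E : 3 * (e * (1 - q) / 3) = e * (1 - q) by field.
  have Epos : 0 < e * (1 - q) by rewrite mulr_gt0.
  rewrite -(ltr_pM2r q1'); nra.
- have lim e : 0 < e -> exists x, [/\ U x, rnorm (f x - x) <= e & rnorm (l - x) < e].
    move=> e0; have [d d0 Hd] := Hl e e0.
    pose m := Num.min d e; have m0 : 0 < m by rewrite lt_min d0.
    have [x [Ux hx]] := A0 m m0.
    exists x; split=> //; first by apply: (le_trans hx); rewrite ge_min lexx orbT.
    by apply: Hd; split=> //; apply: (le_trans hx); rewrite ge_min lexx.
  have Ul : U l by apply: closed_rnorm => // e /lim[x [Ux _ h]]; exists x.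
  exists l => //; apply/eqP; rewrite -subr_eq0; apply/eqP; apply: rnorm_eps0 => e e0.
  have e3 : 0 < e / 3 by rewrite divr_gt0.
  have [x [Ux h1 h2]] := lim _ e3.
  have -> : f l - l = (f l - f x) + ((f x - x) + (x - l)).
    by rewrite !subrKA.
  apply: (le_trans (rnormD _ _)); have -> : e = e / 3 + (e / 3 + e / 3) by field.
  apply: lerD.
    apply: (le_trans (fq _ _ Ul Ux)); apply: (le_trans _ (ltW h2)).
    by apply: ler_piMl; [exact: rnorm_ge0|exact: ltW].
  by apply: (le_trans (rnormD _ _)); apply: lerD => //; rewrite rdistC ltW.
Qed.
End Complete.

Section Lipschitz.
Variable R : realType.

Definition lip (V W : normedModType R[i]) (f : V -> W) :=
  exists K, forall x y, rnorm (f x - f y) <= K * rnorm (x - y).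

Lemma lip_ct (V W : normedModType R[i]) (f : V -> W) : lip f -> continuous f.
Proof. by move=> [K]; exact: ct_lip. Qed.

Lemma lip_comp (U V W : normedModType R[i]) (f : U -> V) (g : V -> W) :
  lip f -> lip g -> lip (fun x => g (f x)).
Proof.
move=> [K HK] [M HM]; exists (`|M| * K) => x y; apply: (le_trans (HM _ _)).
apply: (@le_trans _ _ (`|M| * rnorm (f x - f y))).
  by apply: ler_wpM2r; [exact: rnorm_ge0|exact: ler_norm].
by rewrite -mulrA; apply: ler_wpM2l.
Qed.

Lemma lip_id (V : normedModType R[i]) : lip (fun x : V => x).
Proof. by exists 1 => x y; rewrite mul1r. Qed.

Lemma lip_isometry (V W : normedModType R[i]) (f : V -> W) :
  (forall x y, rnorm (f x - f y) = rnorm (x - y)) -> lip f.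
Proof. by move=> H; exists 1 => x y; rewrite mul1r H. Qed.

Lemma lip_bounded (V W : normedModType R[i]) (f : V -> W) (K : R) :
  (forall x y, f (x - y) = f x - f y) -> (forall x, rnorm (f x) <= K * rnorm x) -> lip f.
Proof. by move=> fB fK; exists K => x y; rewrite -fB. Qed.

Lemma lip_add (V W : normedModType R[i]) (f g : V -> W) :
  lip f -> lip g -> lip (fun x => f x + g x).
Proof.
move=> [K HK] [M HM]; exists (K + M) => x y.
by rewrite opprD addrACA mulrDl (le_trans (rnormD _ _))// lerD.
Qed.

Lemma lip_scale (V W : normedModType R[i]) (k : R[i]) (f : V -> W) :
  lip f -> lip (fun x => k *: f x).
Proof.
move=> [K HK]; exists (rnorm k * K) => x y.
by rewrite -scalerBr rnormZ -mulrA; apply: ler_wpM2l; first exact: rnorm_ge0.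
Qed.

Lemma lip_cst (V W : normedModType R[i]) (w : W) : lip (fun _ : V => w).
Proof. by exists 0 => x y; rewrite subrr rnorm0 mul0r. Qed.

Lemma closed_lip_eq (V W : normedModType R[i]) (f g : V -> W) :
  lip f -> lip g -> closed [set x | f x = g x].
Proof.
move=> lf lg; have -> : [set x | f x = g x] = [set x | rnorm (f x - g x) = 0].
  apply/seteqP; split=> x /=; first by move=> ->; rewrite subrr rnorm0.
  by move/rnorm_eq0 => /eqP; rewrite subr_eq0 => /eqP.
apply: closed_eqf; apply: (@ct_comp V W _ (fun x => f x - g x) (fun w : W => rnorm w)).
  exact: ct_rnorm.
apply: lip_ct; rewrite (_ : (fun x => f x - g x) = (fun x => f x + (-1) *: g x)).
  by apply: lip_add => //; exact: lip_scale.
by apply/funext => x; rewrite scaleN1r.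
Qed.

Lemma dense_closed (T : topologicalType) (D S : set T) : dense D -> D `<=` S -> closed S ->
  forall x, S x.
Proof.
move=> dD DS cS x; apply: contrapT => nS.
have [y [/= h Dy]] := dD (~` S) (ex_intro _ x nS) (closed_openC cS).
by apply: h; exact: DS.
Qed.

Lemma dense_lip (V W : normedModType R[i]) (f g : V -> W) (D : set V) :
  dense D -> lip f -> lip g -> (forall x, D x -> f x = g x) -> forall x, f x = g x.
Proof. by move=> dD lf lg fg; apply: (dense_closed dD) => //; exact: closed_lip_eq. Qed.
End Lipschitz.

Section CstarFacts.
Variables (R : realType) (A : cstarAlgType R).
Implicit Types a b c : A.

Lemma cmulZr k a b : cmul a (k *: b) = k *: cmul a b.
Proof.
have h : cmul a 0 = 0 by have := cmul_linearr (-1) (0 : A) 0 a; rewrite scaler0 addr0 scaleN1r addNr.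
by rewrite -[k *: b]addr0 cmul_linearr h addr0.
Qed.
Lemma cmulDr a b c : cmul a (b + c) = cmul a b + cmul a c.
Proof. by rewrite -{1}(scale1r b) cmul_linearr scale1r. Qed.
Lemma cmulBr a b c : cmul a (b - c) = cmul a b - cmul a c.
Proof. by rewrite cmulDr -scaleN1r cmulZr scaleN1r. Qed.
Lemma cmulZl k a b : cmul (k *: a) b = k *: cmul a b.
Proof.
have h : cmul 0 b = 0 by have := cmul_linearl (-1) (0 : A) 0 b; rewrite scaler0 addr0 scaleN1r addNr.
by rewrite -[k *: a]addr0 cmul_linearl h addr0.
Qed.
Lemma cmulDl a b c : cmul (a + b) c = cmul a c + cmul b c.
Proof. by rewrite -{1}(scale1r a) cmul_linearl scale1r. Qed.
Lemma cmulBl a b c : cmul (a - b) c = cmul a c - cmul b c.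
Proof. by rewrite cmulDl -scaleN1r cmulZl scaleN1r. Qed.
Lemma cmul0r a : cmul a 0 = 0.
Proof. by rewrite -[in LHS](subrr 0) cmulBr subrr. Qed.
Lemma cstarD a b : cstar (a + b) = cstar a + cstar b.
Proof. by rewrite -{1}(scale1r a) cstar_antilinear conjc1 scale1r. Qed.
Lemma cstar0 : cstar (0 : A) = 0.
Proof. by apply: (addrI (cstar 0)); rewrite -cstarD !addr0. Qed.
Lemma cstarZ k a : cstar (k *: a) = conjc k *: cstar a.
Proof. by rewrite -[k *: a]addr0 cstar_antilinear cstar0 addr0. Qed.
Lemma cstarB a b : cstar (a - b) = cstar a - cstar b.
Proof. by rewrite cstarD -scaleN1r cstarZ rmorphN1 scaleN1r. Qed.

Lemma rnormcM a b : rnorm (cmul a b) <= rnorm a * rnorm b.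
Proof. by have := cnormM a b; rewrite !rnormE -rmorphM /= lecR. Qed.

Lemma rnorm_cstar_mul a : rnorm (cmul (cstar a) a) = rnorm a ^+ 2.
Proof. by have := cnorm_star a; rewrite !rnormE -rmorphXn => /complexI. Qed.

Lemma rnorm_cstar a : rnorm (cstar a) = rnorm a.
Proof.
have le b : rnorm b <= rnorm (cstar b).
  have [b0|b0] := eqVneq (rnorm b) 0; first by rewrite b0 rnorm_ge0.
  rewrite -(@ler_pM2r _ (rnorm b)); last by rewrite lt_def b0 rnorm_ge0.
  by rewrite -expr2 -rnorm_cstar_mul rnormcM.
by apply/le_anti; rewrite le andbT -{2}(cstarK a) le.
Qed.

Lemma lip_cstar : lip (@cstar R A).
Proof. by exists 1 => x y; rewrite -cstarB rnorm_cstar mul1r. Qed.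
Lemma lip_cmull a : lip (cmul a).
Proof. by apply: (lip_bounded (K := rnorm a)); [exact: cmulBr|move=> x; exact: rnormcM]. Qed.
Lemma lip_cmulr a : lip (fun x => cmul x a).
Proof.
by apply: (lip_bounded (K := rnorm a)); [move=> x y; exact: cmulBl|move=> x; rewrite mulrC rnormcM].
Qed.
End CstarFacts.

(** A [*]-representation of [A] by adjointable operators is bounded. *)
Section LeftAction.
Variables (R : realType) (A B : cstarAlgType R) (Y : normedModType R[i]).
Variables (dot : Y -> Y -> B) (L : A -> Y -> Y).
Hypotheses (dot_linear : forall x (k : R[i]) y z, dot x (k *: y + z) = k *: dot x y + dot x z)
  (dotC : forall x y, dot y x = cstar (dot x y))
  (dot_norm : forall x, `|x| ^+ 2 = `|dot x x| :> R[i])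
  (L_linl : forall (k : R[i]) b c x, L (k *: b + c) x = k *: L b x + L c x)
  (L_linr : forall b (k : R[i]) x y, L b (k *: x + y) = k *: L b x + L b y)
  (LM : forall b c x, L (cmul b c) x = L b (L c x))
  (L_star : forall b x y, dot (L b x) y = dot x (L (cstar b) y)).

Let dotDr x y z : dot x (y + z) = dot x y + dot x z.
Proof. by rewrite -{1}(scale1r y) dot_linear scale1r. Qed.
Let dot0r x : dot x 0 = 0.
Proof. by apply: (addrI (dot x 0)); rewrite -dotDr !addr0. Qed.
Let dotZr x k y : dot x (k *: y) = k *: dot x y.
Proof. by rewrite -[k *: y]addr0 dot_linear dot0r addr0. Qed.
Let dotBr x y z : dot x (y - z) = dot x y - dot x z.
Proof. by rewrite dotDr -scaleN1r dotZr scaleN1r. Qed.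
Let dotDl x y z : dot (x + y) z = dot x z + dot y z.
Proof. by rewrite dotC dotDr cstarD -!dotC. Qed.
Let dotZl x k y : dot (k *: x) y = conjc k *: dot x y.
Proof. by rewrite dotC dotZr cstarZ -!dotC. Qed.
Let dotBl x y z : dot (x - y) z = dot x z - dot y z.
Proof. by rewrite dotC dotBr cstarB -!dotC. Qed.
Let L0l x : L 0 x = 0.
Proof. by have := L_linl (-1) 0 0 x; rewrite scaler0 addr0 scaleN1r addNr. Qed.
Let LZl k b x : L (k *: b) x = k *: L b x.
Proof. by rewrite -[k *: b]addr0 L_linl L0l addr0. Qed.
Let LDl b c x : L (b + c) x = L b x + L c x.
Proof. by rewrite -{1}(scale1r b) L_linl scale1r. Qed.
Let L0r b : L b 0 = 0.
Proof. by have := L_linr b (-1) 0 0; rewrite scaler0 addr0 scaleN1r addNr. Qed.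
Let LZr k b x : L b (k *: x) = k *: L b x.
Proof. by rewrite -[k *: x]addr0 L_linr L0r addr0. Qed.
Let LDr b x y : L b (x + y) = L b x + L b y.
Proof. by rewrite -{1}(scale1r x) L_linr scale1r. Qed.
Let LBr b x y : L b (x - y) = L b x - L b y.
Proof. by rewrite LDr -scaleN1r LZr scaleN1r. Qed.

Let dot_eq_rnorm x y : dot x x = dot y y -> rnorm x = rnorm y.
Proof.
move=> h; have : `|x| ^+ 2 = `|y| ^+ 2 :> R[i] by rewrite !dot_norm h.
rewrite !rnormE -!rmorphXn => /complexI h2.
by apply/eqP; rewrite -(@eqrXn2 _ 2)// ?rnorm_ge0// h2.
Qed.

(** The element [1 - sqrt (1 - c^2)], found without a unit as a fixed point. *)
Let root_ex (c : A) : cstar c = c -> rnorm c < 1 ->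
  exists q : A, [/\ cstar q = q, cmul c q = cmul q c & cmul c c + cmul q q = q + q].
Proof.
move=> sc c1; set rho := rnorm c.
have rho0 : 0 <= rho by exact: rnorm_ge0.
have h1 : 0 < 1 - rho ^+ 2 by rewrite subr_gt0 expr_lt1.
pose s := Num.sqrt (1 - rho ^+ 2).
have s2 : s ^+ 2 = 1 - rho ^+ 2 by rewrite sqr_sqrtr// ltW.
have s0 : 0 < s by rewrite sqrtr_gt0.
have s1 : s <= 1 by rewrite -(@ler_sqr _ s 1) ?nnegrE ?(ltW s0)// s2 expr1n lerBlDr lerDl sqr_ge0.
(* [r] solves [(rho^2 + r^2) / 2 = r], so [f] preserves the ball of radius [r]. *)
pose r := 1 - s; have r01 : 0 <= r < 1 by rewrite subr_ge0 s1 ltrBlDr ltrDl.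
have /andP[r0 r1] := r01.
pose f (q : A) : A := (2^-1 : R)%:C *: (cmul c c + cmul q q).
pose U := [set q : A | [/\ rnorm q <= r, cstar q = q & cmul c q = cmul q c]].
have half (x : A) : (2^-1 : R)%:C *: x + (2^-1 : R)%:C *: x = x.
  have e : 2^-1 + 2^-1 = 1 :> R by field.
  by rewrite -scalerDl -rmorphD e scale1r.
have hn : rnorm ((2^-1 : R)%:C) = 2^-1 by rewrite rnorm_real ger0_norm.
have [|||||q [_ sq cq] fq] := @contraction_fixed R A U f r 0.
- have -> : U = [set q | 0 <= r - rnorm q] `&` [set q | cstar q = q] `&` [set q | cmul c q = cmul q c].
    apply/seteqP; split=> q /=; rewrite subr_ge0; first by move=> [].
    by move=> [[]].
  apply: closedI; first apply: closedI.
  + by apply: closed_gef; apply: ct_sub; [exact: ct_cst|exact: ct_rnorm].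
  + by apply: closed_lip_eq; [exact: lip_cstar|exact: lip_id].
  + by apply: closed_lip_eq; [exact: lip_cmull|exact: lip_cmulr].
- by split; rewrite ?rnorm0 ?cstar0 ?cmul0r// -(scale0r 0) cmulZl !scale0r.
- move=> q [qr sq cq]; split.
  + rewrite /f rnormZ hn -ler_pdivlMl ?invr_gt0// invrK.
    apply: (le_trans (rnormD _ _)).
    have -> : 2 * r = rho * rho + r * r.
      have rr : rho * rho = 1 - s ^+ 2 by rewrite s2; ring.
      by rewrite rr /r; ring.
    apply: lerD; apply: (le_trans (rnormcM _ _)) => //.
    by apply: ler_pM => //; exact: rnorm_ge0.
  + by rewrite /f cstarZ conjc_real cstarD !cstarM sc sq.
  + rewrite /f cmulZr cmulZl; congr (_ *: _); rewrite cmulDr cmulDl cmulA; congr (_ + _).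
    by rewrite cmulA cq -cmulA cq cmulA.
- exact: r01.
- move=> x y [hx _ _] [hy _ _]; rewrite /f -scalerBr opprD addrACA subrr add0r rnormZ hn.
  have -> : cmul x x - cmul y y = cmul x (x - y) + cmul (x - y) y.
    by rewrite cmulBr cmulBl subrKA.
  rewrite -ler_pdivlMl ?invr_gt0// invrK (le_trans (rnormD _ _))//.
  have -> : 2 * (r * rnorm (x - y)) = r * rnorm (x - y) + rnorm (x - y) * r by ring.
  apply: lerD; apply: (le_trans (rnormcM _ _)).
    by apply: ler_wpM2r => //; exact: rnorm_ge0.
  by apply: ler_wpM2l => //; exact: rnorm_ge0.
exists q; split=> //.
by rewrite -{3 4}fq half.
Qed.

(** [c] is half the sum of the unitaries [c + i sqrt(1 - c^2)] and
    [c - i sqrt(1 - c^2)]. *)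
Lemma selfadjoint_contractive c : cstar c = c -> rnorm c < 1 ->
  forall x, rnorm (L c x) <= rnorm x.
Proof.
move=> sc c1 x; have [q [sq cq eq]] := root_ex sc c1.
set X := L c x; set z := x - L q x.
have h1 : dot X z = dot z X.
  rewrite /X L_star sc /z LBr dotBr -LM cq LM.
  by rewrite dotBl L_star sq.
have h2 : dot X X + dot z z = dot x x.
  rewrite {1}/X L_star sc -/X /z dotBr !dotBl (L_star q) sq (L_star q) sq.
  rewrite -!LM opprB addrA addrA.
  have e2 : dot x (L (cmul c c) x) + dot x (L (cmul q q) x) = dot x (L q x) + dot x (L q x).
    by rewrite -!dotDr -!LDl eq.
  rewrite [X in X + _ - _]addrC -!addrA.
  by rewrite (addrA (dot x (L (cmul c c) x))) e2 addrK addNr addr0.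
have i2 : 'i%C * 'i%C = -1 :> R[i] by rewrite -expr2 sqr_i.
have ci : conjc ('i%C : R[i]) = - 'i%C by apply: complex_eq => /=; rewrite ?oppr0.
have n k : conjc k = - k -> k * k = -1 -> rnorm (X + k *: z) = rnorm x.
  move=> ck k2; apply: dot_eq_rnorm.
  rewrite dotDr !dotDl !dotZr !dotZl ck h1 scalerA mulrN k2 opprK scale1r scaleNr -h2.
  by rewrite subrKA.
have n1 := n _ ci i2.
have n2 : rnorm (X - 'i%C *: z) = rnorm x.
  rewrite -scaleNr; apply: n; last by rewrite mulrNN.
  by apply: complex_eq => /=; rewrite ?oppr0 ?opprK.
have : rnorm (X + X) <= rnorm x + rnorm x.
  rewrite -{1}n1 -{1}n2 (_ : X + X = (X + 'i%C *: z) + (X - 'i%C *: z)) ?rnormD//.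
  by rewrite addrACA subrr addr0.
rewrite -{1 2}(scale1r X) -scalerDl rnormZ -[1 + 1]/(2%:R).
rewrite -(rmorph_nat (real_complex R)) rnorm_real normr_nat.
by move: (rnorm X) (rnorm x) => u w; lra.
Qed.

Lemma selfadjoint_bounded c x : cstar c = c -> rnorm (L c x) <= rnorm c * rnorm x.
Proof.
move=> sc; apply/ler_addgt0Pr => e e0.
have x1 : 0 < rnorm x + 1 by rewrite ltr_wpDl// rnorm_ge0.
pose d := rnorm c + e / (rnorm x + 1).
have d0 : 0 < d by rewrite ltr_wpDl ?rnorm_ge0// divr_gt0.
have dn : rnorm (d^-1)%:C = d^-1 :> R by rewrite rnorm_real ger0_norm// invr_ge0 ltW.
have h : rnorm (L ((d^-1)%:C *: c) x) <= rnorm x.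
  apply: selfadjoint_contractive; first by rewrite cstarZ conjc_real sc.
  by rewrite rnormZ dn mulrC ltr_pdivrMr// mul1r ltrDl divr_gt0.
rewrite LZl rnormZ dn mulrC ler_pdivrMr// in h.
apply: (le_trans h); rewrite mulrC mulrDl lerD2l mulrAC ler_pdivrMr//.
by apply: ler_wpM2l; [exact: ltW|rewrite lerDl].
Qed.

Lemma left_action_bounded b x : rnorm (L b x) <= 2 * rnorm b * rnorm x.
Proof.
pose h : A := (2^-1 : R)%:C *: (b + cstar b).
pose k : A := (2^-1 : R)%:C *: ('i%C *: (cstar b - b)).
have sh : cstar h = h by rewrite /h cstarZ conjc_real cstarD cstarK addrC.
have ci : conjc ('i%C : R[i]) = - 'i%C by apply: complex_eq => /=; rewrite ?oppr0.
have sk : cstar k = k.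
  by rewrite /k cstarZ conjc_real cstarZ cstarB cstarK ci scaleNr -scalerN opprB.
have half (y : A) : (2^-1 : R)%:C *: y + (2^-1 : R)%:C *: y = y.
  have e : 2^-1 + 2^-1 = 1 :> R by field.
  by rewrite -scalerDl -rmorphD e scale1r.
have bE : b = 'i%C *: k + h.
  have i2 : 'i%C * 'i%C = -1 :> R[i] by rewrite -expr2 sqr_i.
  rewrite /k !scalerA mulrAC i2 mulN1r scaleNr -scalerN opprB /h -scalerDr.
  by rewrite addrACA addNr addr0 scalerDr half.
have hn : rnorm ((2^-1 : R)%:C) = 2^-1 by rewrite rnorm_real ger0_norm.
have nh : rnorm h <= rnorm b.
  rewrite /h rnormZ hn -ler_pdivlMl ?invr_gt0// invrK mulr_natl mulr2n.
  by rewrite (le_trans (rnormD _ _))// rnorm_cstar.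
have ni : rnorm ('i%C : R[i]) = 1 by rewrite rnormC /= expr0n add0r expr1n sqrtr1.
have nk : rnorm k <= rnorm b.
  rewrite /k !rnormZ hn ni mul1r -ler_pdivlMl ?invr_gt0// invrK mulr_natl mulr2n.
  by rewrite (le_trans (rnormB _ _))// rnorm_cstar.
rewrite {1}bE L_linl (le_trans (rnormD _ _))// rnormZ ni mul1r -mulrA mulr_natl mulr2n.
by apply: lerD; apply: (le_trans (selfadjoint_bounded _ _)) => //;
  apply: ler_wpM2r => //; exact: rnorm_ge0.
Qed.

(** By polarization.  The constant is crude, but only continuity of the inner
    product is drawn from this bound. *)
Lemma dot_bounded x y : rnorm (dot x y) <= 2 * (rnorm x + rnorm y) ^+ 2.
Proof.
have i2 : 'i%C * 'i%C = -1 :> R[i] by rewrite -expr2 sqr_i.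
have ni : rnorm ('i%C : R[i]) = 1 by rewrite rnormC /= expr0n add0r expr1n sqrtr1.
have ci : conjc ('i%C : R[i]) = - 'i%C by apply: complex_eq => /=; rewrite ?oppr0.
have nS w : rnorm (dot w w) = rnorm w ^+ 2.
  by have := dot_norm w; rewrite !rnormE -rmorphXn => /complexI <-.
pose Q w := dot x w + dot w x.
have QE w : Q w = dot (x + w) (x + w) - (dot x x + dot w w).
  rewrite dotDr !dotDl /Q (addrC (dot x w) (dot w w)) addrACA.
  by rewrite [X in _ = X - _]addrC addrK addrC.
have nQ w : rnorm (Q w) <= 2 * (rnorm x + rnorm w) ^+ 2.
  rewrite QE mulr_natl mulr2n (le_trans (rnormB _ _))//; apply: lerD.
    by rewrite nS ler_sqr ?nnegrE ?rnorm_ge0 ?addr_ge0 ?rnorm_ge0// rnormD.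
  rewrite (le_trans (rnormD _ _))// !nS sqrrD.
  by rewrite -addrA lerD2l lerDr mulrn_wge0// mulr_ge0// rnorm_ge0.
have E : (2 : R)%:C *: dot x y = Q y - 'i%C *: Q ('i%C *: y).
  rewrite /Q dotZr dotZl ci scalerDr !scalerA mulrN i2 opprK scale1r scaleN1r.
  rewrite opprD opprK addrACA subrr addr0 rmorph_nat scaler_nat mulr2n.
  by [].
have : rnorm ((2 : R)%:C *: dot x y) <= 2 * (2 * (rnorm x + rnorm y) ^+ 2).
  rewrite E (le_trans (rnormB _ _))// rnormZ ni mul1r mulr_natl mulr2n; apply: lerD => //.
  by have := nQ ('i%C *: y); rewrite rnormZ ni mul1r.
by rewrite rnormZ rnorm_real ger0_norm// ler_pM2l.
Qed.

Lemma lip_dotr x : lip (dot x).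
Proof.
apply: (lip_bounded (K := 8 * (rnorm x + 1))) => [y z|y]; first exact: dotBr.
have [y0|y0] := eqVneq (rnorm y) 0.
  by rewrite (rnorm_eq0 y0) dot0r !rnorm0 mulr0.
have yp : 0 < rnorm y by rewrite lt_def y0 rnorm_ge0.
(* Rescale [y] to have norm [|x| + 1]. *)
pose t := (rnorm x + 1) / rnorm y.
have x1 : 0 < rnorm x + 1 by rewrite ltr_wpDl// rnorm_ge0.
have tp : 0 < t by rewrite divr_gt0.
have := dot_bounded x (t%:C *: y); rewrite dotZr !rnormZ rnorm_real gtr0_norm//.
rewrite [X in rnorm x + X]mulfVK// => h.
have h' : t * rnorm (dot x y) <= 2 * (2 * (rnorm x + 1)) ^+ 2.
  apply: (le_trans h); rewrite ler_pM2l// ler_sqr ?nnegrE.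
  - by rewrite mulr_natl mulr2n lerD2r lerDl.
  - by rewrite addr_ge0 ?rnorm_ge0 ?(ltW x1).
  - by rewrite mulr_ge0 ?(ltW x1).
rewrite -(ler_pM2l tp) (le_trans h')// /t.
by rewrite le_eqVlt; apply/orP; left; apply/eqP; field.
Qed.
End LeftAction.

Section Corollaries.
Variable R : realType.

(** Let [A] act on [B] by left multiplication through [f]. *)
Lemma star_hom_bounded (A B : cstarAlgType R) (f : {linear A -> B}) : star_hom f ->
  forall a, rnorm (f a) <= 2 * rnorm a.
Proof.
move=> [fM fS] a.
have bnd (x : B) : rnorm (cmul (f a) x) <= 2 * rnorm a * rnorm x.
  apply: (@left_action_bounded R A B B (fun x y => cmul (cstar x) y) (fun c y => cmul (f c) y)).
  - by move=> y k z w; rewrite cmul_linearr.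
  - by move=> y z; rewrite cstarM cstarK.
  - by move=> y; rewrite cnorm_star.
  - by move=> k c d y; rewrite linearP cmul_linearl.
  - by move=> c k y z; rewrite cmul_linearr.
  - by move=> c d y; rewrite fM cmulA.
  - by move=> c y z; rewrite cstarM fS cmulA.
have [a0|a0] := eqVneq (rnorm (f a)) 0; first by rewrite a0 mulr_ge0// rnorm_ge0.
have := bnd (cstar (f a)).
rewrite -{1}(cstarK (f a)) rnorm_cstar_mul rnorm_cstar expr2.
by rewrite ler_pM2r// lt_def a0 rnorm_ge0.
Qed.

Lemma lip_star_hom (A B : cstarAlgType R) (f : {linear A -> B}) : star_hom f -> lip f.
Proof.
move=> hf; apply: (lip_bounded (K := 2)); last exact: star_hom_bounded.
by move=> x y; rewrite linearB.
Qed.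

Section Correspondence.
Variables (B : cstarAlgType R) (Y : correspondence B).
Implicit Types (x y z : Y) (b c : B).

Lemma lact_bounded b x : rnorm (lact b x) <= 2 * rnorm b * rnorm x.
Proof.
exact: (left_action_bounded (@bdot_linear R B Y) (@bdotC R B Y) (@bdot_norm R B Y)
  (@lact_linearl R B Y) (@lact_linearr R B Y) (@lactM R B Y) (@lact_star R B Y)).
Qed.

Lemma bdot_rnorm x : rnorm x ^+ 2 = rnorm (bdot x x).
Proof. by have := bdot_norm x; rewrite !rnormE -rmorphXn => /complexI. Qed.

Lemma lip_bdotr x : lip (bdot x).
Proof.
exact: (lip_dotr (@bdot_linear R B Y) (@bdotC R B Y) (@bdot_norm R B Y)).
Qed.

Lemma lip_bdotl y : lip (fun x : Y => bdot x y).
Proof.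
rewrite (_ : (fun x => bdot x y) = (fun x => cstar (bdot y x))).
  by apply: lip_comp; [exact: lip_bdotr|exact: lip_cstar].
by apply/funext => x; rewrite -bdotC.
Qed.

Lemma ractBl x y b : ract (x - y) b = ract x b - ract y b.
Proof. by rewrite addrC -scaleN1r ract_linearl scaleN1r addrC. Qed.
Lemma ractBr x b c : ract x (b - c) = ract x b - ract x c.
Proof. by rewrite addrC -scaleN1r ract_linearr scaleN1r addrC. Qed.
Lemma lactBl b c x : lact (b - c) x = lact b x - lact c x.
Proof. by rewrite addrC -scaleN1r lact_linearl scaleN1r addrC. Qed.
Lemma lactBr b x y : lact b (x - y) = lact b x - lact b y.
Proof. by rewrite addrC -scaleN1r lact_linearr scaleN1r addrC. Qed.

Lemma ract_bounded x b : rnorm (ract x b) <= rnorm x * rnorm b.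
Proof.
rewrite -ler_sqr ?nnegrE ?mulr_ge0 ?rnorm_ge0// bdot_rnorm bdot_ract bdotC bdot_ract cstarM.
rewrite -bdotC exprMn (le_trans (rnormcM _ _))//.
rewrite bdot_rnorm [rnorm b ^+ 2]expr2 mulrA; apply: ler_wpM2r; first exact: rnorm_ge0.
by rewrite mulrC -{1}(rnorm_cstar b) rnormcM.
Qed.

Lemma lip_ractl b : lip (fun x : Y => ract x b).
Proof.
apply: (lip_bounded (K := rnorm b)) => [x y|x]; first exact: ractBl.
by rewrite mulrC ract_bounded.
Qed.
Lemma lip_ractr x : lip (ract x).
Proof. by apply: (lip_bounded (K := rnorm x)) => [b c|b]; [exact: ractBr|exact: ract_bounded]. Qed.
Lemma lip_lactl x : lip (fun b : B => lact b x).
Proof.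
apply: (lip_bounded (K := 2 * rnorm x)) => [b c|b]; first exact: lactBl.
by rewrite mulrAC lact_bounded.
Qed.
Lemma lip_lactr b : lip (fun x : Y => lact b x).
Proof.
by apply: (lip_bounded (K := 2 * rnorm b)) => [x y|x]; [exact: lactBr|exact: lact_bounded].
Qed.
End Correspondence.
End Corollaries.

Section LinearPack.
Variables (R : realType) (V W : normedModType R[i]).

Definition pack_linear (f : V -> W) (lf : linear f) : {linear V -> W} :=
  HB.pack f (GRing.isLinear.Build R[i] V W *:%R f lf).

End LinearPack.

(** Points of the two completions correspond when they have common approximants
    in [D].  This relation preserves distances, and completeness makes it total
    in both directions. *)
Section Extension.
Variables (R : realType) (V W : completeNormedModType R[i]) (T : Type) (D : set T).
Variables (j : T -> V) (j' : T -> W).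
Hypotheses (dj : dense (j @` D)) (dj' : dense (j' @` D))
  (iso : forall s t, D s -> D t -> rnorm (j s - j t) = rnorm (j' s - j' t))
  (lin : forall (k : R[i]) s t, D s -> D t ->
     exists u, [/\ D u, j u = k *: j s + j t & j' u = k *: j' s + j' t]).

Lemma dense_rnorm (X : normedModType R[i]) (h : T -> X) : dense (h @` D) ->
  forall x e, 0 < e -> exists2 t, D t & rnorm (h t - x) < e.
Proof.
move=> dh x e e0.
have [||y [/= xy [t Dt ty]]] := dh (ball x e%:C)^°.
- by exists x; rewrite /interior /=; apply/nbhs_rnorm; exists e => // y h'; exact/rball.
- exact: open_interior.
by exists t => //; rewrite ty rdistC; apply/rball; exact: interior_subset xy.
Qed.

Let Rel x y := forall e, 0 < e -> exists t, [/\ D t, rnorm (j t - x) < e & rnorm (j' t - y) < e].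

Let Rel_dist x y x' y' : Rel x y -> Rel x' y' -> rnorm (x - x') = rnorm (y - y').
Proof.
move=> Hx Hx'; apply/eqP; rewrite -subr_eq0 -normr_eq0 -(rnorm_real (_ - _)); apply/eqP.
rewrite (rnorm_eps0 (v := (rnorm (x - x') - rnorm (y - y'))%:C : R[i])) ?rnorm0// => e e0.
have e4 : 0 < e / 4 by rewrite divr_gt0.
have [t [Dt t1 t2]] := Hx _ e4; have [s [Ds s1 s2]] := Hx' _ e4.
have tri (X : normedModType R[i]) (p q p' q' : X) : rnorm (p - p') < e / 4 ->
    rnorm (q - q') < e / 4 -> rnorm (p' - q') <= rnorm (p - q) + e / 2.
  move=> h1 h2; have -> : p' - q' = - (p - p') + (p - q) + (q - q').
    by rewrite opprB subrKA subrKA.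
  rewrite (le_trans (rnormD _ _))// (_ : e / 2 = e / 4 + e / 4); last by field.
  rewrite [leRHS]addrA; apply: lerD; last exact: ltW.
  by apply: (le_trans (rnormD _ _)); rewrite rnormN [leRHS]addrC lerD2r ltW.
have a1 := tri _ _ _ _ _ t1 s1; have a2 := tri _ _ _ _ _ t2 s2.
have b1 : rnorm (j t - j s) <= rnorm (x - x') + e / 2.
  by apply: tri; rewrite rdistC.
have b2 : rnorm (j' t - j' s) <= rnorm (y - y') + e / 2.
  by apply: tri; rewrite rdistC.
rewrite rnorm_real ler_norml; rewrite (iso Dt Ds) in a1 b1.
by move: a1 a2 b1 b2; move: (rnorm _) (rnorm _) (rnorm _) => u v w; lra.
Qed.

Let Rel_ex x : exists y, Rel x y.
Proof.
pose A e := [set y | exists t, [/\ D t, rnorm (j t - x) < e & y = j' t]].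
have [|||l Hl] := @shrinking_limit R W A.
- by move=> e e0; have [t Dt h] := dense_rnorm dj x e0; exists (j' t), t.
- by move=> d e de y [t [Dt h ->]]; exists t; split=> //; exact: lt_le_trans de.
- move=> e e0; exists (e / 2); first by rewrite divr_gt0.
  move=> _ _ [t [Dt ht ->]] [s [Ds hs ->]]; rewrite -iso//.
  have -> : j t - j s = (j t - x) - (j s - x) by rewrite opprB subrKA.
  by rewrite (splitr e) (le_lt_trans (rnormB _ _))// ltrD.
exists l => e e0; have [d d0 Hd] := Hl e e0.
have m0 : 0 < Num.min d e by rewrite lt_min d0.
have [t Dt] := dense_rnorm dj x m0; rewrite lt_min => /andP[h1 h2].
by exists t; split=> //; rewrite rdistC; apply: Hd; exists t.
Qed.

Let Rel_ex' y : exists x, Rel x y.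
Proof.
pose A e := [set x | exists t, [/\ D t, rnorm (j' t - y) < e & x = j t]].
have [|||l Hl] := @shrinking_limit R V A.
- by move=> e e0; have [t Dt h] := dense_rnorm dj' y e0; exists (j t), t.
- by move=> d e de x [t [Dt h ->]]; exists t; split=> //; exact: lt_le_trans de.
- move=> e e0; exists (e / 2); first by rewrite divr_gt0.
  move=> _ _ [t [Dt ht ->]] [s [Ds hs ->]]; rewrite iso//.
  have -> : j' t - j' s = (j' t - y) - (j' s - y) by rewrite opprB subrKA.
  by rewrite (splitr e) (le_lt_trans (rnormB _ _))// ltrD.
exists l => e e0; have [d d0 Hd] := Hl e e0.
have m0 : 0 < Num.min d e by rewrite lt_min d0.
have [t Dt] := dense_rnorm dj' y m0; rewrite lt_min => /andP[h1 h2].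
by exists t; split=> //; rewrite rdistC; apply: Hd; exists t.
Qed.

Lemma isometric_extension : exists f : {linear V -> W},
  [/\ bijective f, forall t, D t -> f (j t) = j' t & lip f].
Proof.
have /choice[f Hf] := Rel_ex; have /choice[g Hg] := Rel_ex'.
have eq0 (X : normedModType R[i]) (x y : X) : rnorm (x - y) = 0 -> x = y.
  by move/rnorm_eq0/eqP; rewrite subr_eq0 => /eqP.
have Reljj t : D t -> Rel (j t) (j' t).
  by move=> Dt e e0; exists t; rewrite !subrr !rnorm0.
have fj t : D t -> f (j t) = j' t.
  by move=> Dt; apply: eq0; rewrite -(Rel_dist (Hf _) (Reljj _ Dt)) subrr rnorm0.
have fdist x y : rnorm (f x - f y) = rnorm (x - y) by rewrite (Rel_dist (Hf x) (Hf y)).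
have lf : linear f.
  have lipf : lip f by exact: lip_isometry.
  move=> k x y; move: x; apply: (dense_lip dj).
  - apply: (lip_comp (f := fun x => k *: x + y)) lipf.
    by apply: lip_add; [apply: lip_scale; exact: lip_id|exact: lip_cst].
  - by apply: lip_add; [apply: lip_scale|exact: lip_cst].
  move=> _ [s Ds <-]; move: y; apply: (dense_lip dj).
  - apply: (lip_comp (f := fun y => k *: j s + y)) lipf.
    by apply: lip_add; [exact: lip_cst|exact: lip_id].
  - by apply: lip_add; [exact: lip_cst|].
  move=> _ [t Dt <-]; have [u [Du ju j'u]] := lin k Ds Dt.
  by rewrite -ju !fj.
exists (pack_linear lf); split.
- exists g => [x|y] /=; apply: eq0.
    by rewrite (Rel_dist (Hg (f x)) (Hf x)) subrr rnorm0.
  by rewrite -(Rel_dist (Hf (g y)) (Hg y)) subrr rnorm0.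
- exact: fj.
- exact: lip_isometry.
Qed.
End Extension.

(** * Toeplitz and Cuntz-Pimsner algebras of isomorphic correspondences *)

Section Isomorphisms.
Variable R : realType.

(** A [*]-endomorphism fixing generators is the identity, since its fixed points
    form a closed [*]-subalgebra. *)
Lemma generated_fixed (T D : cstarAlgType R) (X : set T) (f : {linear T -> D}) (g : {linear D -> T}) :
  star_hom f -> star_hom g -> cstar_generated X -> (forall x, X x -> g (f x) = x) -> cancel f g.
Proof.
move=> [fM fS] [gM gS] gen fix_X a.
have : [set a | g (f a) = a] = setT.
  apply: gen => //; split.
  - apply: closed_lip_eq; last exact: lip_id.
    by apply: (lip_comp (f := f)); exact: lip_star_hom.
  - by rewrite /= !raddf0.
  - by move=> k x y /= hx hy; rewrite !linearP hx hy.
  - by move=> x y /= hx hy; rewrite fM gM hx hy.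
  - by move=> x /= hx; rewrite fS gS hx.
by move=> H; have : [set a | g (f a) = a] a by rewrite H.
Qed.

(** The linear inverses are part of the data, so that the notion is visibly
    symmetric. *)
Record corr_iso (B B' : cstarAlgType R) (Y : correspondence B) (Y' : correspondence B') :=
  CorrIso {
  ci_alg : {linear B -> B'} ; ci_map : {linear Y -> Y'} ;
  ci_algV : {linear B' -> B} ; ci_mapV : {linear Y' -> Y} ;
  ci_hom : star_hom ci_alg ;
  ci_algK : cancel ci_alg ci_algV ; ci_algVK : cancel ci_algV ci_alg ;
  ci_mapK : cancel ci_map ci_mapV ; ci_mapVK : cancel ci_mapV ci_map ;
  ci_bdot : forall x y, bdot (ci_map x) (ci_map y) = ci_alg (bdot x y) ;
  ci_ract : forall x b, ci_map (ract x b) = ract (ci_map x) (ci_alg b) ;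
  ci_lact : forall b x, ci_map (lact b x) = lact (ci_alg b) (ci_map x)
}.

Lemma corr_iso_of (B B' : cstarAlgType R) (Y : correspondence B) (Y' : correspondence B') :
  correspondence_isomorphic Y Y' -> inhabited (corr_iso Y Y').
Proof.
move=> [f [F [[hf bf] bF h1 h2 h3]]].
have [g fK gK] := bf; have [H FK HK] := bF.
have lg : linear g by move=> k x y; apply: (can_inj fK); rewrite gK linearP !gK.
have lH : linear H by move=> k x y; apply: (can_inj FK); rewrite HK linearP !HK.
exact: inhabits (@CorrIso B B' Y Y' f F (pack_linear lg) (pack_linear lH) hf fK gK FK HK h1 h2 h3).
Qed.

Section Inverse.
Variables (B B' : cstarAlgType R) (Y : correspondence B) (Y' : correspondence B').
Variable c : corr_iso Y Y'.

Lemma ci_homV : star_hom (ci_algV c).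
Proof.
have [fM fS] := ci_hom c; have inj := can_inj (ci_algK c).
by split=> [a b|a]; apply: inj; rewrite ?fM ?fS !(ci_algVK c).
Qed.

Definition corr_isoV : corr_iso Y' Y.
Proof.
apply: (@CorrIso B' B Y' Y (ci_algV c) (ci_mapV c) (ci_alg c) (ci_map c)).
- exact: ci_homV.
- exact: ci_algVK.
- exact: ci_algK.
- exact: ci_mapVK.
- exact: ci_mapK.
- by move=> x y; apply: (can_inj (ci_algK c)); rewrite -ci_bdot !ci_mapVK ci_algVK.
- by move=> x b; apply: (can_inj (ci_mapK c)); rewrite ci_ract !ci_mapVK ci_algVK.
- by move=> b x; apply: (can_inj (ci_mapK c)); rewrite ci_lact !ci_mapVK ci_algVK.
Defined.

Lemma ci_map_rnorm x : rnorm (ci_map c x) ^+ 2 <= 2 * rnorm x ^+ 2.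
Proof. by rewrite !bdot_rnorm ci_bdot; apply: star_hom_bounded; exact: ci_hom. Qed.

Lemma ci_map_bound : exists2 K : R, 0 < K & forall x, rnorm (ci_map c x) <= K * rnorm x.
Proof.
exists 2 => // x; rewrite -ler_sqr ?nnegrE ?mulr_ge0 ?rnorm_ge0//.
rewrite (le_trans (ci_map_rnorm x))// exprMn; apply: ler_wpM2r; first exact: sqr_ge0.
by rewrite expr2 ler_pMr// ler1n.
Qed.
End Inverse.

Section Transfer.
Variables (B B' : cstarAlgType R) (Y : correspondence B) (Y' : correspondence B').
Variable c : corr_iso Y Y'.
Notation F := (ci_map c).
Notation F' := (ci_mapV c).
Notation f := (ci_alg c).

Lemma ci_theta xi eta x : F (theta xi eta (F' x)) = theta (F xi) (F eta) x.
Proof. by rewrite /theta ci_ract -ci_bdot ci_mapVK. Qed.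

Lemma ci_compact T : compact_operators T -> compact_operators (fun x : Y' => F (T (F' x))).
Proof.
move=> cT e e0.
have [K K0 FK] := ci_map_bound c; have [K' K'0 FK'] := ci_map_bound (corr_isoV c).
have d0 : 0 < e / (K * K') by rewrite divr_gt0// mulr_gt0.
have [s Hs] := cT _ d0; exists [seq (F p.1, F p.2) | p <- s] => x.
rewrite big_map /= (eq_bigr (fun p => F (theta p.1 p.2 (F' x)))); last by move=> p _; rewrite ci_theta.
rewrite -raddf_sum -raddfB !rnormE -rmorphM lecR.
apply: (le_trans (FK _)).
have h := Hs (F' x); rewrite !rnormE -rmorphM lecR in h.
apply: (@le_trans _ _ (K * (e / (K * K') * (K' * rnorm x)))).
  apply: ler_wpM2l; first exact: ltW.
  apply: (le_trans h); apply: ler_wpM2l; first exact: ltW.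
  exact: FK'.
rewrite le_eqVlt; apply/orP; left; apply/eqP; field.
by rewrite !gt_eqF.
Qed.

Lemma ci_katsura b : katsura_ideal Y b -> katsura_ideal Y' (f b).
Proof.
move=> [cb bc]; split.
  have := ci_compact cb; congr compact_operators; apply/funext => x.
  by rewrite ci_lact ci_mapVK.
move=> d d0; have [fM _] := ci_hom c.
rewrite -(ci_algVK c d) -fM bc ?raddf0// => x.
apply: (can_inj (ci_mapK c)); rewrite ci_lact ci_algVK raddf0; exact: d0.
Qed.

Variables (D : cstarAlgType R) (psi : {linear Y' -> D}) (zeta : {linear B' -> D}).

Lemma ci_toeplitz : toeplitz_rep psi zeta -> toeplitz_rep (psi \o F) (zeta \o f).
Proof.
have [fM fS] := ci_hom c.
move=> [[zM zS] h1 h2]; split=> /=.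
- by split=> [a b|a] /=; rewrite ?fM ?fS.
- by move=> x y; rewrite h1 ci_bdot.
- by move=> b x; rewrite h2 ci_lact.
Qed.

(** The homomorphism on compact operators is transported by conjugation with the
    isomorphism. *)
Lemma ci_covariant : cp_covariant psi zeta -> cp_covariant (psi \o F) (zeta \o f).
Proof.
move=> [p1 [[h1 h2 h3 h4] hk]]; exists (fun T => p1 (fun x => F (T (F' x)))); split; first split.
- move=> k S T cS cT; rewrite -h1; [|exact: ci_compact..].
  by congr p1; apply/funext => x; rewrite linearP.
- move=> S T cS cT; rewrite -h2; [|exact: ci_compact..].
  by congr p1; apply/funext => x /=; rewrite ci_mapK.
- move=> S T cS cT adj; apply: h3; [exact: ci_compact..|] => x y.
  by rewrite -{1}(ci_mapVK c y) ci_bdot adj -ci_bdot ci_mapVK.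
- move=> xi eta; rewrite /= -h4; congr p1; apply/funext => x; exact: ci_theta.
move=> b kb; rewrite [RHS]/= -(hk _ (ci_katsura kb)); congr p1; apply/funext => x.
by rewrite ci_lact ci_mapVK.
Qed.
End Transfer.

(** The two maps supplied by universality are mutually inverse on generators. *)
Lemma universal_isomorphic (B B' : cstarAlgType R) (Y : correspondence B) (Y' : correspondence B')
    (c : corr_iso Y Y') (T T' : cstarAlgType R)
    (psi : {linear Y -> T}) (zeta : {linear B -> T})
    (psi' : {linear Y' -> T'}) (zeta' : {linear B' -> T'}) :
  cstar_generated (range psi `|` range zeta) ->
  cstar_generated (range psi' `|` range zeta') ->
  (exists f : {linear T -> T'}, [/\ star_hom f, forall xi, f (psi xi) = psi' (ci_map c xi) &
     forall b, f (zeta b) = zeta' (ci_alg c b)]) ->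
  (exists f : {linear T' -> T}, [/\ star_hom f, forall xi, f (psi' xi) = psi (ci_mapV c xi) &
     forall b, f (zeta' b) = zeta (ci_algV c b)]) ->
  star_isomorphic T T'.
Proof.
move=> gen gen' [f [hf f1 f2]] [g [hg g1 g2]]; exists f; split=> //; exists g.
- apply: (generated_fixed hf hg gen) => _ [[x _ <-]|[b _ <-]].
  + by rewrite f1 g1 ci_mapK.
  + by rewrite f2 g2 ci_algK.
- apply: (generated_fixed hg hf gen') => _ [[x _ <-]|[b _ <-]].
  + by rewrite g1 f1 ci_mapVK.
  + by rewrite g2 f2 ci_algVK.
Qed.

Lemma toeplitz_isomorphic (B B' : cstarAlgType R) (Y : correspondence B) (Y' : correspondence B')
    (T T' : cstarAlgType R) : correspondence_isomorphic Y Y' ->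
  is_toeplitz_algebra Y T -> is_toeplitz_algebra Y' T' -> star_isomorphic T T'.
Proof.
move=> /corr_iso_of[c] [psi [zeta [rep gen univ]]] [psi' [zeta' [rep' gen' univ']]].
apply: (universal_isomorphic (c := c) gen gen').
  exact: univ (ci_toeplitz c rep').
exact: univ' (ci_toeplitz (corr_isoV c) rep).
Qed.

Lemma cuntz_pimsner_isomorphic (B B' : cstarAlgType R) (Y : correspondence B)
    (Y' : correspondence B') (T T' : cstarAlgType R) : correspondence_isomorphic Y Y' ->
  is_cuntz_pimsner_algebra Y T -> is_cuntz_pimsner_algebra Y' T' -> star_isomorphic T T'.
Proof.
move=> /corr_iso_of[c] [psi [zeta [rep cov gen univ]]] [psi' [zeta' [rep' cov' gen' univ']]].
apply: (universal_isomorphic (c := c) gen gen').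
  exact: univ (ci_toeplitz c rep') (ci_covariant c cov').
exact: univ' (ci_toeplitz (corr_isoV c) rep) (ci_covariant (corr_isoV c) cov).
Qed.
End Isomorphisms.

(** * The twist by a cohomology *)

Lemma Cc_homeo (R : realType) (X Y : topologicalType) (u : X -> Y) (u' : Y -> X)
    (f : Y -> R[i]^o) : hausdorff_space X ->
  continuous u -> continuous u' -> cancel u u' -> cancel u' u ->
  Cc f -> Cc (fun x => f (u x) : R[i]^o).
Proof.
move=> hX cu cu' K1 K2 cf; have [K cK fK] := Cc_supp cf.
apply: (CcI (K := u' @` K)) => //.
- exact: (ct_comp cf.1 cu).
- exact: compact_image.
- by move=> x n; apply: fK => Ku; apply: n; exists (u x).
Qed.

Section Twist.
Variables (R : realType) (G : topologicalGroupType).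
Hypotheses (hausG : hausdorff_space G) (lcG : locally_compact [set: G]).
Variables (mu : {measure set (borel G) -> \bar R}) (haar : left_haar mu).
Variables (Delta : G -> R) (modular : modular_function mu Delta).
Variables (E : topologicalGraph) (a : graphAction G E).
Variables (phi1 phi2 : G -> edge E -> G) (psi : edge E -> G).
Hypotheses (c1 : is_cocycle a phi1) (c2 : is_cocycle a phi2) (ctpsi : continuous psi)
  (rel : forall g e, phi2 g e = (psi (eact a g e) * phi1 g e * (psi e)^-1)%g)
  (stab : forall e, vact a (psi e) (source_map e) = source_map e).
Notation Re := complex.Re.
Notation Im := complex.Im.

Let P := (edge E * G)%type.
Let lG : lch G. Proof. by []. Qed.
Let lV := lch_vertex E.
Let lE := lch_edge E.
Let lP : lch P. Proof. exact: lch_prod. Qed.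

Implicit Types (xi eta : P -> R[i]^o) (b : vertex E * G -> R[i]^o).

Hypotheses
  (inv1 : forall v y (H : P -> R), ccr H ->
     fibre_int mu a v (fun p => H (cocycle_act a phi1 y p)) = fibre_int mu a v H)
  (inv2 : forall v y (H : P -> R), ccr H ->
     fibre_int mu a v (fun p => H (cocycle_act a phi2 y p)) = fibre_int mu a v H).

Lemma twist_jacobian : exists d : edge E -> R, [/\ continuous d, forall e, 0 < d e,
  forall y e, d (eact a y e) = d e &
  forall v (H : P -> R), ccr H ->
    fibre_int mu a v (fun p => H (p.1, ((psi p.1)^-1 * p.2)%g)) =
    fibre_int mu a v (fun p => H p * d p.1)].
Proof.
(* The translation is by [psi^-1], which exchanges the roles of the cocycles. *)
have ct : continuous (fun e => ((psi e)^-1)%g) by exact: ct_invg.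
have st e : vact a ((psi e)^-1)%g (source_map e) = source_map e.
  by rewrite -{1}(stab e) -gactM mulVg gact1.
have cj y e : (phi1 y e * (psi e)^-1)%g = ((psi (eact a y e))^-1 * phi2 y e)%g.
  by rewrite rel !mulgA mulVg mul1g.
exact: (fibre_jacobian hausG lcG haar modular ct st c1 inv2 inv1 cj).
Qed.

Variable d : edge E -> R.
Hypotheses (ctd : continuous d) (d0 : forall e, 0 < d e)
  (dinv : forall y e, d (eact a y e) = d e)
  (dint : forall v (H : P -> R), ccr H ->
    fibre_int mu a v (fun p => H (p.1, ((psi p.1)^-1 * p.2)%g)) =
    fibre_int mu a v (fun p => H p * d p.1)).

Let w e := Num.sqrt (d e)^-1.

Let w0 e : 0 < w e. Proof. by rewrite sqrtr_gt0 invr_gt0. Qed.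

Let w2 e : w e * w e = (d e)^-1.
Proof. by rewrite -expr2 sqr_sqrtr// invr_ge0 ltW. Qed.

Let ctdV : continuous (fun e => (d e)^-1).
Proof.
move=> e; apply: (@cvgV R _ (nbhs e) _ d (d e)); last exact: ctd.
by rewrite gt_eqF.
Qed.

Let ctw : continuous w.
Proof. by apply: (ct_comp (g := fun r : R => Num.sqrt r)); [exact: sqrt_continuous|]. Qed.

(** The twist [xi(e, g) |-> d(e)^(-1/2) xi(e, psi(e)^-1 g)]; the Jacobian makes it
    isometric. *)
Definition twist xi : P -> R[i]^o :=
  fun p => (w p.1)%:C * xi (p.1, ((psi p.1)^-1 * p.2)%g).

Let T (p : P) : P := (p.1, ((psi p.1)^-1 * p.2)%g).
Let T' (p : P) : P := (p.1, (psi p.1 * p.2)%g).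
Let ctT : continuous T.
Proof.
apply: ct_pair; first by ct.
by apply: ct_mulg; [apply: ct_invg; apply: (ct_comp (f := fun p : P => p.1) ctpsi); ct|ct].
Qed.
Let ctT' : continuous T'.
Proof.
apply: ct_pair; first by ct.
by apply: ct_mulg; [apply: (ct_comp (f := fun p : P => p.1) ctpsi); ct|ct].
Qed.
Let TK : cancel T T'. Proof. by case=> e g; rewrite /T /T' /= mulgA mulgV mul1g. Qed.
Let T'K : cancel T' T. Proof. by case=> e g; rewrite /T /T' /= mulgA mulVg mul1g. Qed.

Let ctw1 : continuous (fun p : P => (w p.1)%:C : R[i]^o).
Proof. by apply: ctC_real; apply: (ct_comp (f := fun p : P => p.1) ctw); ct. Qed.

Lemma twist_Cc xi : Cc xi -> Cc (twist xi).
Proof.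
move=> cx; apply: Cc_mull; first exact: ctw1.
exact: (Cc_homeo lP.2 ctT ctT' TK T'K cx).
Qed.

(** The inverse is [eta (e, g) = d(e)^(1/2) xi (e, psi(e) g)]. *)
Lemma twist_surj xi : Cc xi -> exists2 eta, Cc eta & twist eta = xi.
Proof.
move=> cx; exists (fun p => ((w p.1)^-1)%:C * xi (T' p)).
  apply: Cc_mull; last exact: (Cc_homeo lP.2 ctT' ctT T'K TK cx).
  apply: ctC_real; apply: (ct_comp (f := fun p : P => p.1) (g := fun e => (w e)^-1)); last by ct.
  by move=> e; apply: (@cvgV R _ (nbhs e) _ w (w e)); [rewrite gt_eqF|exact: ctw].
apply/funext => p; rewrite /twist /= mulrA -rmorphM mulfV ?gt_eqF// mul1r.
by rewrite -[X in xi X]/(T' (T p)) TK.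
Qed.

Lemma twist_lin (k : R[i]) xi eta :
  twist (fun p => k * xi p + eta p) = (fun p => k * twist xi p + twist eta p).
Proof. by apply/funext => p; rewrite /twist; ring. Qed.

Lemma y_inner_parts xi eta v g : Cc xi -> Cc eta ->
  Re (y_inner mu a xi eta (v, g)) =
    fibre_int mu a v (fun p => Re (conjc (xi p) * eta (p.1, (p.2 * g)%g))) /\
  Im (y_inner mu a xi eta (v, g)) =
    fibre_int mu a v (fun p => Im (conjc (xi p) * eta (p.1, (p.2 * g)%g))).
Proof.
move=> cx ce; have [K cK xK] := Cc_supp cx.
have cK1 : compact (fst @` K) by apply: compact_image => //; exact: ct_fst.
have z h e : ~ (fst @` K) e -> conjc (xi (e, h)) * eta (e, (h * g)%g) = 0.
  by move=> n; rewrite xK ?conjc0 ?mul0r// => k; apply: n; exists (e, h).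
split; rewrite /y_inner /= /fibre_int; congr hint; apply/funext => h.
  rewrite -/(fibre_sum (fun e => conjc (xi (e, h)) * eta (e, (h * g)%g)) _).
  by apply: (fibre_sum_morph (f := @complex.Re R) _ cK1 (z h)) => //; exact: ReD.
rewrite -/(fibre_sum (fun e => conjc (xi (e, h)) * eta (e, (h * g)%g)) _).
by apply: (fibre_sum_morph (f := @complex.Im R) _ cK1 (z h)) => //; exact: ImD.
Qed.

(** The Jacobian, applied to [H / d], cancels the two factors [d^(-1/2)]. *)
Lemma twist_inner xi eta : Cc xi -> Cc eta ->
  y_inner mu a (twist xi) (twist eta) = y_inner mu a xi eta.
Proof.
move=> cx ce; apply/funext => -[v g].
have cV1 := twist_Cc cx; have cV2 := twist_Cc ce.
have [r1 i1] := y_inner_parts v g cV1 cV2; have [r2 i2] := y_inner_parts v g cx ce.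
pose Z (p : P) : R[i]^o := conjc (xi p) * eta (p.1, (p.2 * g)%g).
have cZ : Cc Z.
  have -> : Z = (fun p => eta (p.1, (p.2 * g)%g) * conjc (xi p)) by apply/funext => p; rewrite mulrC.
  apply: Cc_mull; last exact: Cc_conj.
  by apply: (ct_comp (f := fun p : P => (p.1, (p.2 * g)%g)) ce.1); ct.
have ZT p : conjc (twist xi p) * twist eta (p.1, (p.2 * g)%g) = ((d p.1)^-1)%:C * Z (T p).
  rewrite /twist /Z /T -w2 /= !mulgA.
  by move: (xi _) (eta _) (w _) => [u1 u2] [v1 v2] t; apply: complex_eq => /=; ring.
have ctd1 : continuous (fun p : P => (d p.1)^-1).
  by apply: (ct_comp (f := fun p : P => p.1) ctdV); ct.
have main (H : P -> R) : ccr H -> fibre_int mu a v (fun p => (d p.1)^-1 * H (T p)) = fibre_int mu a v H.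
  move=> cH; have cHd : ccr (fun p : P => (d p.1)^-1 * H p) by exact: ccr_mull.
  rewrite (dint v cHd); congr fibre_int; apply/funext => p.
  by rewrite mulrAC mulVf ?mul1r// gt_eqF.
apply: complex_eq.
  rewrite r1 r2 -(main _ (Cc_Re cZ)); congr fibre_int; apply/funext => p.
  by rewrite ZT; case: (Z _) => z1 z2 /=; ring.
rewrite i1 i2 -(main _ (Cc_Im cZ)); congr fibre_int; apply/funext => p.
by rewrite ZT; case: (Z _) => z1 z2 /=; ring.
Qed.

Lemma Cc_slicer (Z : topologicalType) (f : Z * G -> R[i]^o) z : Cc f -> Cc (fun h => f (z, h) : R[i]^o).
Proof.
move=> cf; have [K cK fK] := Cc_supp cf.
apply: (CcI (K := snd @` K)) => //.
- by apply: (ct_comp (f := fun h => (z, h)) cf.1); apply: ct_pair; [exact: ct_cst|exact: ct_id].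
- by apply: compact_image => //; exact: ct_snd.
- by move=> h n; apply: fK => k; apply: n; exists (z, h).
Qed.

(** Substitute [psi(e) h] for [h]; the element [psi(e)] fixes [s(e)]. *)
Lemma twist_ract xi b : Cc xi -> Cc b -> y_ract mu a (twist xi) b = twist (y_ract mu a xi b).
Proof.
move=> cx cb; apply/funext => -[e g]; rewrite /y_ract /twist /=.
pose f h : R[i]^o := xi (e, h) * b (vact a (h^-1)%g (source_map e), (h^-1 * ((psi e)^-1 * g))%g).
have cf : Cc f.
  rewrite (_ : f = fun h => b (vact a (h^-1)%g (source_map e), (h^-1 * ((psi e)^-1 * g))%g) * xi (e, h)); last first.
    by apply/funext => h; rewrite mulrC.
  apply: Cc_mull; last exact: Cc_slicer.
  apply: (ct_comp (f := fun h => (vact a (h^-1)%g (source_map e), (h^-1 * ((psi e)^-1 * g))%g)) cb.1).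
  by apply: ct_pair; [apply: ct_act; ct|ct].
rewrite -/(cintegral mu f) -(cint_scale hausG haar _ cf).
rewrite -(cint_left hausG haar (psi e)^-1 (f := fun h => (w e)%:C * f h)); last first.
  by apply: Cc_mull => //; exact: ct_cst.
congr cintegral; apply/funext => h; rewrite /f -mulrA; congr (_ * (_ * b (_, _))).
  by rewrite invgM invgK gactM stab.
by rewrite invgM invgK -!mulgA mulVKg.
Qed.

(** The cohomology relation moves the translation past the cocycle, and invariance of
    [d] lets the scalar factor out of the integral. *)
Lemma twist_lact xi b : Cc xi -> Cc b ->
  y_lact mu a phi2 b (twist xi) = twist (y_lact mu a phi1 b xi).
Proof.
move=> cx cb; apply/funext => -[e g]; rewrite /y_lact /twist /=.
pose f h : R[i]^o := b (range_map e, h) *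
  xi (eact a (h^-1)%g e, (phi1 (h^-1)%g e * ((psi e)^-1 * g))%g).
have cf : Cc f.
  rewrite (_ : f = fun h => xi (eact a (h^-1)%g e, (phi1 (h^-1)%g e * ((psi e)^-1 * g))%g) * b (range_map e, h)); last first.
    by apply/funext => h; rewrite mulrC.
  apply: Cc_mull; last exact: Cc_slicer.
  apply: (ct_comp (f := fun h => (eact a (h^-1)%g e, (phi1 (h^-1)%g e * ((psi e)^-1 * g))%g)) cx.1).
  apply: ct_pair; first by apply: ct_act; ct.
  apply: ct_mulg; last by ct.
  by apply: (ct_comp (f := fun h => ((h^-1)%g, e)) (cocycle_continuous c1)); ct.
rewrite -/(cintegral mu f) -(cint_scale hausG haar _ cf).
congr cintegral; apply/funext => h; rewrite /f /w dinv mulrCA; congr (_ * (_ * xi (_, _))).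
by rewrite rel !mulgA mulVg mul1g.
Qed.
End Twist.

(** * The isomorphism of correspondences *)

Section CrossedProducts.
Variables (R : realType) (G : topologicalGroupType).
Variables (mu : {measure set (borel G) -> \bar R}) (Delta : G -> R).
Hypotheses (hausG : hausdorff_space G) (lcG : locally_compact [set: G]) (haar : left_haar mu)
  (modular : modular_function mu Delta).
Variables (X : topologicalType) (act : continuousAction G X) (lX : lch X).
Implicit Types b c : X * G -> R[i]^o.

Lemma cp_sub (B : cstarAlgType R) (i : (X * G -> R[i]^o) -> B) :
  is_crossed_product mu Delta act i -> forall b c, Cc b -> Cc c ->
  i b - i c = i (fun p => -1 * c p + b p).
Proof. by move=> iP b c cb cc; rewrite (cp_linear iP _ cc cb) scaleN1r addrC. Qed.

Lemma cp_rnorm (B : cstarAlgType R) (i : (X * G -> R[i]^o) -> B) :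
  is_crossed_product mu Delta act i -> forall b, Cc b -> rnorm (i b) = full_norm mu act b.
Proof. by move=> iP b cb; have := cp_norm iP cb; rewrite rnormE => /complexI. Qed.

(** Both norms restrict to the full norm, so [i b |-> i' b] is isometric. *)
Lemma crossed_product_iso (B B' : cstarAlgType R) (i : (X * G -> R[i]^o) -> B)
    (i' : (X * G -> R[i]^o) -> B') :
  is_crossed_product mu Delta act i -> is_crossed_product mu Delta act i' ->
  exists f : {linear B -> B'}, [/\ star_hom f, bijective f & forall b, Cc b -> f (i b) = i' b].
Proof.
move=> iP iP'.
have [f [bf fi lf]] : exists f : {linear B -> B'},
    [/\ bijective f, forall t, (@Cc R (X * G)%type) t -> f (i t) = i' t & lip f].
  apply: (isometric_extension (cp_dense iP) (cp_dense iP')).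
  - move=> b c cb cc; have cd : Cc (fun p => -1 * c p + b p : R[i]^o) by exact: Cc_lin.
    by rewrite (cp_sub iP cb cc) (cp_sub iP' cb cc) (cp_rnorm iP cd) (cp_rnorm iP' cd).
  - move=> k b c cb cc; exists (fun p => k * b p + c p); split; first exact: Cc_lin.
      exact: (cp_linear iP).
    exact: (cp_linear iP').
exists f; split=> //; split.
- move=> x y; move: x; apply: (dense_lip (cp_dense iP)).
  + by apply: (lip_comp (f := fun x => cmul x y)) lf; exact: lip_cmulr.
  + by apply: (lip_comp (g := fun z => cmul z (f y)) lf); exact: lip_cmulr.
  move=> _ [b cb <-]; move: y; apply: (dense_lip (cp_dense iP)).
  + by apply: (lip_comp (f := fun y => cmul (i b) y)) lf; exact: lip_cmull.
  + by apply: (lip_comp lf); exact: lip_cmull.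
  move=> _ [c cc <-]; rewrite -(cp_mulE iP cb cc) fi; last exact: (cp_mul_Cc hausG lcG haar).
  by rewrite (cp_mulE iP' cb cc) !fi.
- apply: (dense_lip (cp_dense iP)).
  + by apply: (lip_comp (f := @cstar R B)) lf; exact: lip_cstar.
  + by apply: (lip_comp lf); exact: lip_cstar.
  move=> _ [b cb <-]; rewrite -(cp_starE iP cb) fi; last exact: (cp_star_Cc hausG haar modular _ lX.2).
  by rewrite (cp_starE iP' cb) fi.
Qed.
End CrossedProducts.

Section SameGraph.
Variables (R : realType) (G : topologicalGroupType).
Hypotheses (hausG : hausdorff_space G) (lcG : locally_compact [set: G]).
Variables (mu : {measure set (borel G) -> \bar R}) (haar : left_haar mu).
Variables (Delta : G -> R) (modular : modular_function mu Delta).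
Variables (E : topologicalGraph) (a : graphAction G E).
Variables (phi1 phi2 : G -> edge E -> G) (coh : cohomologous a phi1 phi2).
Variables (B B' : cstarAlgType R).
Variables (i : (vertex E * G -> R[i]^o) -> B) (i' : (vertex E * G -> R[i]^o) -> B').
Hypotheses (iP : is_crossed_product mu Delta (vact a) i)
  (iP' : is_crossed_product mu Delta (vact a) i').
Variables (Y : correspondence B) (j : (edge E * G -> R[i]^o) -> Y).
Variables (Y' : correspondence B') (j' : (edge E * G -> R[i]^o) -> Y').
Hypotheses (jP : is_cocycle_correspondence mu a phi1 i j)
  (jP' : is_cocycle_correspondence mu a phi2 i' j').

Lemma yc_sub (B0 : cstarAlgType R) i0 (Y0 : correspondence B0) phi (j0 : (edge E * G -> R[i]^o) -> Y0) :
  is_cocycle_correspondence mu a phi i0 j0 -> forall xi eta, Cc xi -> Cc eta ->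
  j0 xi - j0 eta = j0 (fun p => -1 * eta p + xi p).
Proof. by move=> h xi eta cx ce; rewrite (yc_linear h _ ce cx) scaleN1r addrC. Qed.

Lemma yc_rnorm (B0 : cstarAlgType R) i0 (Y0 : correspondence B0) phi (j0 : (edge E * G -> R[i]^o) -> Y0) :
  is_crossed_product mu Delta (vact a) i0 ->
  is_cocycle_correspondence mu a phi i0 j0 -> forall xi, Cc xi ->
  rnorm (j0 xi) ^+ 2 = full_norm mu (vact a) (y_inner mu a xi xi).
Proof.
move=> h0 h xi cx; rewrite bdot_rnorm (yc_inner h cx cx) (cp_rnorm h0)//.
exact: (y_inner_Cc hausG lcG haar).
Qed.

(** All operations are Lipschitz in each variable, so the identities are checked on
    compactly supported functions only. *)
Theorem cohomologous_isomorphic : correspondence_isomorphic Y Y'.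
Proof.
have [c1 c2 [psi [ctpsi rel stab]]] := coh.
have inv1 v y H : ccr H -> _ := @fibre_int_cocycle R G hausG lcG mu haar Delta modular E a phi1 c1 B i iP Y j jP y v H.
have inv2 v y H : ccr H -> _ := @fibre_int_cocycle R G hausG lcG mu haar Delta modular E a phi2 c2 B' i' iP' Y' j' jP' y v H.
have [d [ctd d0 dinv dint]] := twist_jacobian hausG lcG haar modular c1 ctpsi rel stab inv1 inv2.
pose V := @twist R G E psi d.
have cV xi : Cc xi -> Cc (V xi) by exact: twist_Cc.
have Vlin k xi eta : V (fun p => k * xi p + eta p) = (fun p => k * V xi p + V eta p).
  exact: twist_lin.
have Vinner xi eta : Cc xi -> Cc eta -> y_inner mu a (V xi) (V eta) = y_inner mu a xi eta.
  exact: twist_inner.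
have [iota [hio bio ioE]] := crossed_product_iso hausG lcG haar modular (lch_vertex E) iP iP'.
have lio := lip_star_hom hio.
have [Phi [bPhi PhiE lPhi]] : exists f : {linear Y -> Y'},
    [/\ bijective f, forall t, (@Cc R (edge E * G)%type) t -> f (j t) = j' (V t) & lip f].
  apply: (isometric_extension (j' := fun t => j' (V t)) (yc_dense jP)).
  - rewrite (_ : [set j' (V t) | t in _] = j' @` @Cc R (edge E * G)%type); first exact: (yc_dense jP').
    apply/seteqP; split=> _ [t ct <-]; first by exists (V t) => //; exact: cV.
    have [u cu <-] := twist_surj hausG lcG ctpsi ctd d0 ct.
    by exists u.
  - move=> xi eta cx ce; have cz : Cc (fun p => -1 * eta p + xi p : R[i]^o) by exact: Cc_lin.
    apply/eqP; rewrite -(@eqrXn2 _ 2)// ?rnorm_ge0//; apply/eqP.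
    rewrite (yc_sub jP cx ce) (yc_sub jP' (cV _ cx) (cV _ ce)) -Vlin.
    rewrite (yc_rnorm iP jP cz) (yc_rnorm iP' jP' (cV _ cz)).
    by rewrite Vinner.
  - move=> k xi eta cx ce; exists (fun p => k * xi p + eta p); split; first exact: Cc_lin.
      exact: (yc_linear jP).
    by rewrite Vlin; exact: (yc_linear jP' _ (cV _ cx) (cV _ ce)).
exists iota, Phi; split=> //.
- move=> x y; move: x; apply: (dense_lip (yc_dense jP)).
  + by apply: (lip_comp (g := fun z : Y' => bdot z (Phi y)) lPhi); exact: lip_bdotl.
  + by apply: (lip_comp (f := fun x => bdot x y)) lio; exact: lip_bdotl.
  move=> _ [xi cx <-]; move: y; apply: (dense_lip (yc_dense jP)).
  + by apply: (lip_comp lPhi); exact: lip_bdotr.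
  + by apply: (lip_comp (f := bdot (j xi))) lio; exact: lip_bdotr.
  move=> _ [eta ce <-]; rewrite (PhiE _ cx) (PhiE _ ce) (yc_inner jP' (cV _ cx) (cV _ ce)).
  by rewrite Vinner// (yc_inner jP cx ce) ioE//; exact: (y_inner_Cc hausG lcG haar).
- move=> x b; move: x; apply: (dense_lip (yc_dense jP)).
  + by apply: (lip_comp (f := fun x => ract x b)) lPhi; exact: lip_ractl.
  + by apply: (lip_comp (g := fun z : Y' => ract z (iota b)) lPhi); exact: lip_ractl.
  move=> _ [xi cx <-]; move: b; apply: (dense_lip (cp_dense iP)).
  + by apply: (lip_comp (f := ract (j xi))) lPhi; exact: lip_ractr.
  + by apply: (lip_comp lio); exact: lip_ractr.
  move=> _ [b cb <-]; rewrite -(yc_ract jP cx cb) (PhiE _ cx) (ioE _ cb).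
  rewrite -(yc_ract jP' (cV _ cx) cb) PhiE; last exact: (y_ract_Cc hausG lcG haar).
  by congr j'; rewrite /V (twist_ract hausG haar stab).
- move=> b x; move: x; apply: (dense_lip (yc_dense jP)).
  + by apply: (lip_comp (f := fun x => lact b x)) lPhi; exact: lip_lactr.
  + by apply: (lip_comp lPhi); exact: lip_lactr.
  move=> _ [xi cx <-]; move: b; apply: (dense_lip (cp_dense iP)).
  + by apply: (lip_comp (f := fun b => lact b (j xi))) lPhi; exact: lip_lactl.
  + by apply: (lip_comp (g := fun b => lact b (Phi (j xi))) lio); exact: lip_lactl.
  move=> _ [b cb <-]; rewrite -(yc_lact jP cb cx) (PhiE _ cx) (ioE _ cb).
  rewrite -(yc_lact jP' cb (cV _ cx)) PhiE; last exact: (y_lact_Cc hausG lcG haar).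
  by congr j'; rewrite /V (twist_lact hausG haar c1 rel dinv).
Qed.
End SameGraph.

(** An equivariant homeomorphism carries covariant representations from one space
    to the other, hence preserves the full norm. *)
Section RepTransport.
Variables (R : realType) (G : topologicalGroupType).
Variables (mu : {measure set (borel G) -> \bar R}).
Variables (X Z : topologicalType) (act : continuousAction G X) (act' : continuousAction G Z).
Variables (u : X -> Z) (u' : Z -> X).
Hypotheses (cu : continuous u) (cu' : continuous u') (uK : cancel u u') (u'K : cancel u' u)
  (ueq : forall g x, u (act g x) = act' g (u x)).

Lemma C0_homeo (f : Z -> R[i]^o) : C0 f -> C0 (fun x => f (u x) : R[i]^o).
Proof.
move=> [cf Kf]; split; first exact: (ct_comp cf cu).
move=> e /Kf/(compact_image cu'); congr compact.
apply/seteqP; split=> [_ [z hz <-]|x hx] /=; first by rewrite u'K.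
by exists (u x).
Qed.

Lemma covariant_rep_homeo (H : hilbertSpace R) pi U : @covariant_rep R G X act H pi U ->
  covariant_rep act' (fun f => pi (fun x => f (u x))) U.
Proof.
move=> rep; split.
- by move=> f /C0_homeo C0f; exact: (crep_op_linear rep C0f).
- by move=> k f f' /C0_homeo C0f /C0_homeo C0f'; exact: (crep_linear rep k C0f C0f').
- by move=> f f' /C0_homeo C0f /C0_homeo C0f'; exact: (crep_mul rep C0f C0f').
- by move=> f /C0_homeo C0f; exact: (crep_star rep C0f).
- exact: (crep_U_linear rep).
- exact: (crep_U1 rep).
- exact: (crep_UM rep).
- exact: (crep_U_isometry rep).
- exact: (crep_U_continuous rep).
- move=> g f /C0_homeo C0f x; rewrite -(crep_covariant rep g C0f).
  by congr (pi _ x); apply/funext => y; rewrite ueq.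
Qed.

Lemma integrated_coefficients_homeo (b : Z * G -> R[i]^o) :
  integrated_coefficients mu act (fun p => b (u p.1, p.2)) `<=` integrated_coefficients mu act' b.
Proof.
move=> r [H [pi [U [x [y [rep x1 y1 rE]]]]]].
exists H, (fun f => pi (fun x => f (u x))), U, x, y; split=> //.
exact: covariant_rep_homeo.
Qed.
End RepTransport.

Section Transport.
Variables (R : realType) (G : topologicalGroupType).
Hypotheses (hausG : hausdorff_space G) (lcG : locally_compact [set: G]).
Variables (mu : {measure set (borel G) -> \bar R}) (Delta : G -> R).
Variables (E F : topologicalGraph) (aE : graphAction G E) (aF : graphAction G F).
Variables (t0 : vertex F -> vertex E) (t0' : vertex E -> vertex F).
Variables (t1 : edge F -> edge E) (t1' : edge E -> edge F).
Hypotheses (ct0 : continuous t0) (ct0' : continuous t0') (t0K : cancel t0 t0') (t0'K : cancel t0' t0)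
  (ct1 : continuous t1) (ct1' : continuous t1') (t1K : cancel t1 t1') (t1'K : cancel t1' t1)
  (eq0 : forall g v, t0 (vact aF g v) = vact aE g (t0 v))
  (eq1 : forall g f, t1 (eact aF g f) = eact aE g (t1 f))
  (t_range : forall f, range_map (t1 f) = t0 (range_map f))
  (t_source : forall f, source_map (t1 f) = t0 (source_map f)).

Let lG : lch G. Proof. by []. Qed.

Let eq0' g v : t0' (vact aE g v) = vact aF g (t0' v).
Proof. by apply: (can_inj t0K); rewrite eq0 !t0'K. Qed.
Let eq1' g e : t1' (eact aE g e) = eact aF g (t1' e).
Proof. by apply: (can_inj t1K); rewrite eq1 !t1'K. Qed.
Let t_range' e : range_map (t1' e) = t0' (range_map e).
Proof. by apply: (can_inj t0K); rewrite -t_range t0'K t1'K. Qed.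
Let t_source' e : source_map (t1' e) = t0' (source_map e).
Proof. by apply: (can_inj t0K); rewrite -t_source t0'K t1'K. Qed.

Definition pull0 (b : vertex F * G -> R[i]^o) : vertex E * G -> R[i]^o := fun p => b (t0' p.1, p.2).
Definition pull1 (xi : edge F * G -> R[i]^o) : edge E * G -> R[i]^o := fun p => xi (t1' p.1, p.2).

Let pair_homeo (X Z : topologicalType) (u : X -> Z) : continuous u ->
  continuous (fun p : X * G => (u p.1, p.2)).
Proof.
move=> cu; apply: ct_pair; last exact: ct_snd.
by apply: (ct_comp (f := fun p : X * G => p.1) cu); exact: ct_fst.
Qed.

Lemma pull0_Cc b : Cc b -> Cc (pull0 b).
Proof.
apply: (Cc_homeo (lch_prod (lch_vertex E) lG).2 (pair_homeo ct0') (pair_homeo ct0)).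
  by case=> v g; rewrite /= t0'K.
by case=> v g; rewrite /= t0K.
Qed.

Lemma pull1_Cc xi : Cc xi -> Cc (pull1 xi).
Proof.
apply: (Cc_homeo (lch_prod (lch_edge E) lG).2 (pair_homeo ct1') (pair_homeo ct1)).
  by case=> v g; rewrite /= t1'K.
by case=> v g; rewrite /= t1K.
Qed.

Lemma pull0_image : [set pull0 b | b in @Cc R (vertex F * G)%type] = @Cc R (vertex E * G)%type.
Proof.
apply/seteqP; split=> [_ [b cb <-]|b cb]; first exact: pull0_Cc.
exists (fun p => b (t0 p.1, p.2)).
  apply: (Cc_homeo (lch_prod (lch_vertex F) lG).2 (pair_homeo ct0) (pair_homeo ct0')) cb.
    by case=> v g; rewrite /= t0K.
  by case=> v g; rewrite /= t0'K.
by apply/funext => -[v g]; rewrite /pull0 /= t0'K.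
Qed.

Lemma pull1_image : [set pull1 b | b in @Cc R (edge F * G)%type] = @Cc R (edge E * G)%type.
Proof.
apply/seteqP; split=> [_ [b cb <-]|b cb]; first exact: pull1_Cc.
exists (fun p => b (t1 p.1, p.2)).
  apply: (Cc_homeo (lch_prod (lch_edge F) lG).2 (pair_homeo ct1) (pair_homeo ct1')) cb.
    by case=> v g; rewrite /= t1K.
  by case=> v g; rewrite /= t1'K.
by apply/funext => -[v g]; rewrite /pull1 /= t1'K.
Qed.

(** Every ingredient of the definition is natural under equivariant homeomorphisms. *)
Lemma crossed_product_pull (B : cstarAlgType R) (i : (vertex E * G -> R[i]^o) -> B) :
  is_crossed_product mu Delta (vact aE) i ->
  is_crossed_product mu Delta (vact aF) (fun b => i (pull0 b)).
Proof.
move=> iP; split.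
- by move=> k b c cb cc; rewrite -(cp_linear iP k (pull0_Cc cb) (pull0_Cc cc)).
- move=> b c cb cc; rewrite -(cp_mulE iP (pull0_Cc cb) (pull0_Cc cc)); congr i.
  apply/funext => -[v g]; rewrite /pull0 /cp_mul /=; congr cintegral; apply/funext => h.
  by rewrite eq0'.
- move=> b cb; rewrite -(cp_starE iP (pull0_Cc cb)); congr i.
  by apply/funext => -[v g]; rewrite /pull0 /cp_star /= eq0'.
- move=> b cb; rewrite (cp_norm iP (pull0_Cc cb)); congr (_%:C).
  rewrite /full_norm; congr sup; apply/seteqP; split.
    exact: (integrated_coefficients_homeo (act := vact aE) (act' := vact aF) ct0' ct0 t0'K t0K eq0').
  have -> : b = (fun p => pull0 b (t0 p.1, p.2)) by apply/funext => -[v g]; rewrite /pull0 /= t0K.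
  have := @integrated_coefficients_homeo R G mu _ _ (vact aF) (vact aE) t0 t0' ct0 ct0' t0K t0'K eq0 (pull0 b).
  congr (_ `<=` _); congr (integrated_coefficients _ _ _); apply/funext => -[v g].
  by rewrite /pull0 /= t0K.
- rewrite (_ : [set i (pull0 b) | b in _] = i @` @Cc R (vertex E * G)%type); first exact: (cp_dense iP).
  by rewrite -pull0_image image_comp.
Qed.

(** The only operation that is not a pointwise substitution is the inner product,
    where the sum over a fibre is reindexed. *)
Lemma cocycle_correspondence_pull (phi : G -> edge E -> G) (B : cstarAlgType R)
    (i : (vertex E * G -> R[i]^o) -> B) (Y : correspondence B) (j : (edge E * G -> R[i]^o) -> Y) :
  is_cocycle_correspondence mu aE phi i j ->
  is_cocycle_correspondence mu aF (fun g f => phi g (t1 f)) (fun b => i (pull0 b))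
    (fun xi => j (pull1 xi)).
Proof.
move=> jP; split.
- by move=> k b c cb cc; rewrite -(yc_linear jP k (pull1_Cc cb) (pull1_Cc cc)).
- move=> xi eta cx ce; rewrite (yc_inner jP (pull1_Cc cx) (pull1_Cc ce)); congr i.
  apply/funext => -[v g]; rewrite /pull0 /pull1 /y_inner /=; congr cintegral; apply/funext => h.
  rewrite (reindex_fsbig t1' [set e | source_map e = vact aE h v]) //.
  split.
  + by move=> e /= se; rewrite t_source' se eq0'.
  + by move=> e e' _ _; exact: (can_inj t1'K).
  + move=> f /= sf; exists (t1 f); last by rewrite t1K.
    by rewrite /= t_source sf eq0 t0'K.
- move=> xi b cx cb; rewrite -(yc_ract jP (pull1_Cc cx) (pull0_Cc cb)); congr j.
  apply/funext => -[e g]; rewrite /pull0 /pull1 /y_ract /=; congr cintegral; apply/funext => h.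
  by rewrite t_source' eq0'.
- move=> b xi cb cx; rewrite -(yc_lact jP (pull0_Cc cb) (pull1_Cc cx)); congr j.
  apply/funext => -[e g]; rewrite /pull0 /pull1 /y_lact /=; congr cintegral; apply/funext => h.
  by rewrite t_range' eq1' t1'K.
- rewrite (_ : [set j (pull1 b) | b in _] = j @` @Cc R (edge E * G)%type); first exact: (yc_dense jP).
  by rewrite -pull1_image image_comp.
Qed.
End Transport.

Theorem corollary4p9 (R : realType)
    (G : topologicalGroupType)
    (hausG : hausdorff_space G) (lcG : locally_compact [set: G])
    (mu : {measure set (borel G) -> \bar R}) (haar : left_haar mu)
    (Delta : G -> R) (modular : modular_function mu Delta)
    (E F : topologicalGraph) (aE : graphAction G E) (aF : graphAction G F)
    (phi : G -> edge E -> G) (cocycle_phi : is_cocycle aE phi)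
    (phi' : G -> edge F -> G) (cocycle_phi' : is_cocycle aF phi')
    (conj_phi : cohomology_conjugate aE phi aF phi')
    (B : cstarAlgType R) (i : (vertex E * G -> R[i]^o) -> B)
    (crossedB : is_crossed_product mu Delta (vact aE) i)
    (B' : cstarAlgType R) (i' : (vertex F * G -> R[i]^o) -> B')
    (crossedB' : is_crossed_product mu Delta (vact aF) i')
    (Y : correspondence B) (j : (edge E * G -> R[i]^o) -> Y)
    (corrY : is_cocycle_correspondence mu aE phi i j)
    (Y' : correspondence B') (j' : (edge F * G -> R[i]^o) -> Y')
    (corrY' : is_cocycle_correspondence mu aF phi' i' j') :
  [/\ correspondence_isomorphic Y Y',
      forall T T' : cstarAlgType R,
        is_toeplitz_algebra Y T -> is_toeplitz_algebra Y' T' ->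
        star_isomorphic T T' &
      forall O O' : cstarAlgType R,
        is_cuntz_pimsner_algebra Y O -> is_cuntz_pimsner_algebra Y' O' ->
        star_isomorphic O O'].
Proof.
have iso : correspondence_isomorphic Y Y'.
  have [t0 [t1 [[[ct0 [t0' [ct0' t0K t0'K]]] [ct1 [t1' [ct1' t1K t1'K]]]] eq0 eq1 [tr ts] [_ coh]]]] := conj_phi.
  have iP := crossed_product_pull hausG lcG ct0 ct0' t0K t0'K eq0 crossedB.
  have jP := cocycle_correspondence_pull hausG lcG ct0 ct0' t0K t0'K ct1 ct1' t1K t1'K eq0 eq1 tr ts corrY.
  exact: (cohomologous_isomorphic hausG lcG haar modular coh iP crossedB' jP corrY').
split=> // T T'.
- exact: toeplitz_isomorphic.
- exact: cuntz_pimsner_isomorphic.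
Qed.
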